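(* Let $p,q>0$ be coprime integers, let $l$ be a positive integer, and let $L$ be the positive torus link $T(lp,lq)$. Then $$sp(L)=\frac{l(l-1)}{2}\,pq.$$
   Context: $T(a,b)$ for $a,b>0$ is the positive torus link, the closure of the $a$-strand braid $(\sigma_1\cdots\sigma_{a-1})^b$ with all crossings positive; $T(lp,lq)$ has $l$ components, each a torus knot $T(p,q)$. The splitting number $sp(L)$ of a link $L=L_1\cup\dots\cup L_l$ is the minimal number of crossing changes between different components of $L$ needed to make the link (completely) split, i.e. to turn $L$ into the split union $L_1\sqcup\dots\sqcup L_l$ of its components; arbitrary isotopies are allowed between crossing changes. *)

(* Defs.v *)
(* MathComp / MathComp-Analysis. *)
From mathcomp Require Import all_boot all_order all_algebra all_fingroup.
From mathcomp Require Import all_classical all_reals all_analysis.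
Set Implicit Arguments.
Unset Strict Implicit.
Unset Printing Implicit Defensive.
Import Order.TTheory GRing.Theory Num.Theory numFieldNormedType.Exports.
Local Open Scope classical_set_scope.
Local Open Scope ring_scope.

(** ** Polygonal links in R^3 *)

Definition space (R : realType) := 'rV[R]_3.

Definition xyz {R : realType} (x y z : R) : space R := \row_j [:: x; y; z]`_j.

Definition height {R : realType} (v : space R) : R := v ord0 (inord 2).

(* Orthogonal projection to the xy-plane, the plane of all link diagrams. *)
Definition shadow {R : realType} (v : space R) : R * R :=
  (v ord0 (inord 0), v ord0 (inord 1)).

(* A closed polygon is given by its cyclic sequence of vertices. *)
Definition polygon (R : realType) := seq (space R).

Definition vertex {R : realType} (P : polygon R) (k : nat) : space R :=
  P`_(k %% size P).

(* The point of parameter t on the edge from vertex k to vertex k + 1. *)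
Definition edge_point {R : realType} (P : polygon R) (k : nat) (t : R) :
    space R :=
  (1 - t) *: vertex P k + t *: vertex P k.+1.

Definition carrier {R : realType} (P : polygon R) : set (space R) :=
  [set v | exists k t, [/\ (k < size P)%N, 0 <= t < 1 & v = edge_point P k t]].

(* A family of closed polygons indexed by the set I of components. *)
Definition polygons (R : realType) (I : finType) := I -> polygon R.

(* A place (i, k, t) is the parameter t on the k-th edge of component i.  Edges
   are half-open (0 <= t < 1), so that each point of an embedded polygon has
   exactly one place. *)
Definition place (R : realType) (I : finType) := (I * nat * R)%type.

Definition is_place {R : realType} {I : finType} (L : polygons R I)
    (a : place R I) : Prop :=
  (a.1.2 < size (L a.1.1))%N /\ 0 <= a.2 < 1.

Definition at_place {R : realType} {I : finType} (L : polygons R I)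
    (a : place R I) : space R :=
  edge_point (L a.1.1) a.1.2 a.2.

(* Tame links: pairwise disjoint simple closed polygons. *)
Definition is_link {R : realType} {I : finType} (L : polygons R I) : Prop :=
  (forall i, 2 < size (L i))%N /\
  (forall a b, is_place L a -> is_place L b ->
     at_place L a = at_place L b -> a = b).

(** ** Ambient isotopy *)

Definition homeomorphism {R : realType} (f : space R -> space R) : Prop :=
  continuous f /\
  exists g : space R -> space R, [/\ continuous g, cancel f g & cancel g f].

(* An ambient isotopy of R^3 taking A i onto B i for every label i. *)
Definition ambient_isotopic {R : realType} {I : Type} (A B : I -> set (space R)) :
    Prop :=
  exists H : R -> space R -> space R,
    [/\ {within `[0, 1] `*` setT, continuous (fun u : R * space R => H u.1 u.2)},
        forall t, 0 <= t <= 1 -> homeomorphism (H t),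
        forall v, H 0 v = v
      & forall i, H 1 @` A i = B i].

Definition link_isotopic {R : realType} {I : finType} (L M : polygons R I) :
    Prop :=
  ambient_isotopic (fun i => carrier (L i)) (fun i => carrier (M i)).

Definition knot_isotopic {R : realType} (P Q : polygon R) : Prop :=
  ambient_isotopic (fun _ : unit => carrier P) (fun _ : unit => carrier Q).

(** ** Diagrams and crossing changes *)

Definition double_point {R : realType} {I : finType} (L : polygons R I)
    (a b : place R I) : Prop :=
  [/\ is_place L a, is_place L b, a <> b
    & shadow (at_place L a) = shadow (at_place L b)].

(* Regular position: finitely many multiple points, all of them double, and
   none of them the shadow of a vertex.  All double points are then transverse
   crossings of two edges. *)
Definition regular {R : realType} {I : finType} (L : polygons R I) : Prop :=
  [/\ finite_set [set ab : place R I * place R I | double_point L ab.1 ab.2],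
      forall a b c, double_point L a b -> double_point L a c -> b = c
    & forall a b, double_point L a b -> a.2 != 0].

Definition same_shadow {R : realType} {I : finType} (L M : polygons R I) : Prop :=
  forall i, map shadow (L i) = map shadow (M i).

Definition above {R : realType} {I : finType} (L : polygons R I)
    (a b : place R I) : bool :=
  height (at_place L b) < height (at_place L a).

(* The diagrams of L and M differ exactly in which strand is the upper one at a
   single crossing, and this crossing involves two different components. *)
Definition crossing_change {R : realType} {I : finType} (L M : polygons R I) :
    Prop :=
  [/\ regular L, same_shadow L M
    & exists a b : place R I,
        [/\ double_point L a b, a.1.1 != b.1.1
          & forall c d, double_point L c d ->
              above M c d =
                ((c, d) \in [:: (a, b); (b, a)]) (+) above L c d]].

(** ** Splitting number *)

(* [reachable L n M]: some sequence of isotopies and exactly n crossing changes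
   between different components leads from L to M through links. *)
Inductive reachable {R : realType} {I : finType} (L : polygons R I) :
    nat -> polygons R I -> Prop :=
| reachable_start : is_link L -> reachable L 0 L
| reachable_isotopy n M N :
    reachable L n M -> is_link N -> link_isotopic M N -> reachable L n N
| reachable_crossing n M N :
    reachable L n M -> is_link N -> crossing_change M N -> reachable L n.+1 N.

(* M is the split union of the components of L.  Balls of 'rV[R]_3 are those of
   the max norm, i.e. open cubes. *)
Definition split_union_of {R : realType} {I : finType} (L M : polygons R I) :
    Prop :=
  (forall i, knot_isotopic (L i) (M i)) /\
  exists (c : I -> space R) (r : I -> R),
    (forall i, carrier (M i) `<=` ball (c i) (r i)) /\
    trivIset setT (fun i => ball (c i) (r i)).

Definition splits_in {R : realType} {I : finType} (L : polygons R I) (n : nat) :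
    Prop :=
  exists M, reachable L n M /\ split_union_of L M.

Definition is_splitting_number {R : realType} {I : finType} (L : polygons R I)
    (n : nat) : Prop :=
  splits_in L n /\ forall m, splits_in L m -> (n <= m)%N.

(** ** Closed braids and torus links *)

(* Words on n + 1 strands: the letter (i, true) is the generator exchanging the
   slots i and i + 1 (slots are numbered from 0) in a positive crossing, and
   (i, false) is its inverse. *)
Definition braid_word (n : nat) := seq ('I_n * bool).

Definition swap_slots {n : nat} (i : 'I_n) : 'S_n.+1 :=
  tperm (widen_ord (leqnSn n) i) (lift ord0 i).

Definition braid_perm {n : nat} (w : braid_word n) : 'S_n.+1 :=
  (\prod_(g <- w) swap_slots g.1)%g.

(* Braids run in the y-direction, the j-th letter filling j <= y <= j + 1, and
   are seen from z = +oo.  With this orientation the crossing in which the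
   strand going from x = i to x = i + 1 passes over is positive. *)
Definition passes_over {n : nat} (g : 'I_n * bool) (s : 'I_n.+1) : bool :=
  if g.2 then s == g.1 :> nat else s == g.1.+1 :> nat.

Definition letter_vertices (R : realType) {n : nat} (g : 'I_n * bool) (j : nat)
    (s : 'I_n.+1) : seq (space R) :=
  let x : R := s%:R in
  let x' : R := (swap_slots g.1 s)%:R in
  let y : R := j%:R in
  let h : R := (passes_over g s)%:R in
  [:: xyz x y 0;
      xyz ((3 * x + x') / 4) (y + 1 / 4) h;
      xyz ((x + 3 * x') / 4) (y + 3 / 4) h].

Fixpoint strand_vertices (R : realType) {n : nat} (w : braid_word n) (j : nat)
    (s : 'I_n.+1) : seq (space R) :=
  if w is g :: w' then
    letter_vertices R g j s ++ strand_vertices R w' j.+1 (swap_slots g.1 s)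
  else [::].

(* The closing arc from the top end (s, m, 0) of slot s, around the right-hand
   side of the braid, back to just below its bottom end (s, 0, 0).  These arcs
   are nested and lie in the plane z = 0. *)
Definition closing_vertices (R : realType) (n m : nat) (s : 'I_n.+1) :
    seq (space R) :=
  let x : R := s%:R in
  let d : R := (n - s)%N.+1%:R in
  [:: xyz x m%:R 0;
      xyz x (m%:R + d) 0;
      xyz (n%:R + d) (m%:R + d) 0;
      xyz (n%:R + d) (- d) 0;
      xyz x (- d) 0].

(* The components of the closure correspond to the cycles of the permutation of
   the braid, each one represented by a chosen slot (its root). *)
Definition braid_component {n : nat} (w : braid_word n) : finType :=
  {s : 'I_n.+1 | froots (braid_perm w) s}.

Definition braid_closure (R : realType) {n : nat} (w : braid_word n) :
    polygons R (braid_component w) :=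
  fun c => flatten
    [seq strand_vertices R w 0 s ++
         closing_vertices R (size w) (braid_perm w s)
    | s <- fingraph.orbit (braid_perm w) (val c)].
Arguments braid_closure R {n} w c.

(* (sigma_1 ... sigma_(a-1))^b; meant for a > 0 only. *)
Definition torus_word (a b : nat) : braid_word a.-1 :=
  flatten (nseq b [seq (i, true) | i <- enum 'I_a.-1]).

Definition torus_link (R : realType) (a b : nat) :
    polygons R (braid_component (torus_word a b)) :=
  braid_closure R (torus_word a b).
Arguments torus_link : clear implicits.

(* Main.v *)
From mathcomp Require Import all_boot all_order all_algebra all_fingroup.
From mathcomp Require Import all_classical all_reals all_analysis.
From mathcomp Require Import complex lra ring zify.
Require Import Defs.
(** The splitting number is bounded below by linking numbers, and the bound is
attained by explicit crossing changes.

Lower bound.  Let [lk P Q] be the linking number of two disjoint closed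
polygons.  Changing a crossing of two different components changes one of
these numbers, by one ([crossing_lk]); an isotopy preserves their absolute
values ([isotopy_lk]); and they vanish for components in disjoint balls
([split_lk]).  So at least as many changes are needed as the absolute value of
the sum of all linking numbers ([splits_lower_bound]).

Upper bound.  In the closed braid [torus_word (l p) (l q)] the component of a
strand is determined by its bottom slot modulo l ([fconnect_residue],
[residue_fconnect]).  The letters come in l q blocks, and in block k the strand
from slot k passes over each of the other strands in turn, all slots being
taken modulo l p.  Reverse those crossings in which the upper strand has the
larger residue modulo l.  Among the other strands, p (k mod l) have a residue
smaller than k mod l, and summing over k gives p q l (l - 1) / 2 reversals
([size_descents]).  Afterwards a component of smaller residue passes over one
of larger residue everywhere.  The same diagram results from keeping all
crossings but pulling the components down by large multiples of their
residues, and after that they lie in disjoint boxes ([lowered_split]).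

Sharpness.  No linking number has to be computed.  All reversed crossings are
positive, so that each reversal lowers the sum of the linking numbers by
exactly one, and the sum is zero at the end.  Hence it was equal to the number
of reversals at the beginning ([lowered_reachable]), and the lower bound is the
upper bound.

Linking numbers.  They come from the Gauss description: lk P Q counts
how often the solid angle of P, seen from a point running along Q, grows by
4 pi.  For a polygon P this needs neither integrals nor degree theory.  The
function [solid P] below is an explicit trace of a product of 2 x 2 matrices,
one for each vertex; it does not vanish off P, and its argument is half of the
solid angle.  So lk P Q is the winding number around 0 of [solid P] along Q.
Winding numbers are defined by counting how often a fine inscribed polygon
crosses the negative real axis.

Isotopy invariance is homotopy invariance of winding numbers, applied to fine
polygons inscribed in the moving component, since inserting points on the edges
multiplies [solid P] by positive factors ([solid_subdivide]).  The isotopy is only known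
to match the components as sets at its end, and two simple parametrisations of
a closed curve are homotopic within the curve up to orientation ([reparam]);
this is why absolute values appear.

For crossing changes, [solid P] is up to positive factors a product with one
complex factor for each edge ([solid_link_arg]).  Its imaginary part depends
only on the shadows, and where it vanishes the sign of its real part tells
which of the two strands is above.  A crossing change therefore moves one
factor at one instant from the positive to the negative real axis, which
changes the winding number by one ([winding_jump]). *)

Set Implicit Arguments.
Unset Strict Implicit.
Unset Printing Implicit Defensive.
Import Order.TTheory GRing.Theory Num.Theory numFieldNormedType.Exports.
Local Open Scope classical_set_scope.
Local Open Scope ring_scope.

(** * Signed crossings of the negative real axis *)

Section Cut.
Variable R : realType.
Implicit Types z w v e : R[i].
Local Notation Re := complex.Re.
Local Notation Im := complex.Im.

Definition dotc z w : R := Re z * Re w + Im z * Im w.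
Definition crossc z w : R := Re z * Im w - Im z * Re w.
Definition upper z : bool := 0 <= Im z.

(** The half-line of negative reals counts as part of the closed upper half
plane; a short segment from z to w crossing it counterclockwise counts 1, and
clockwise -1. *)
Definition cut z w : int :=
  ([&& upper z, ~~ upper w & 0 < crossc z w] : nat)%:Z
  - ([&& ~~ upper z, upper w & crossc z w < 0] : nat)%:Z.

Lemma crosscC z w : crossc w z = - crossc z w.
Proof. by rewrite /crossc; ring. Qed.

Lemma cutC z w : cut w z = - cut z w.
Proof.
rewrite /cut crosscC oppr_gt0 oppr_lt0 opprB.
by congr (_ - _); rewrite andbCA.
Qed.

Lemma cutzz z : cut z z = 0.
Proof. by rewrite /cut; case: upper. Qed.

(** The half-plane of the vectors having positive product with e contains at
most one half of the real axis, so that all segments from its upper to its lower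
part turn the same way.  The two Pluecker identities express that three plane
vectors are dependent. *)
Lemma crossc_upper e z w v : 0 < dotc e z -> 0 < dotc e w -> 0 < dotc e v ->
  upper z -> upper w -> ~~ upper v -> 0 < crossc w v -> 0 < crossc z v.
Proof.
rewrite /upper -ltNge => ez ew ev uz uw nv wv; rewrite ltNge; apply/negP => zv.
have plI : crossc z w * Im v + crossc w v * Im z + crossc v z * Im w = 0.
  by rewrite /crossc; ring.
have ple : crossc z w * dotc e v + crossc w v * dotc e z + crossc v z * dotc e w = 0.
  by rewrite /crossc /dotc; ring.
have vz : 0 <= crossc v z by rewrite crosscC oppr_ge0.
have zw : 0 <= crossc z w.
  rewrite leNgt; apply/negP => zw.
  have : 0 < crossc z w * Im v by rewrite nmulr_rgt0.
  have : 0 <= crossc w v * Im z by rewrite mulr_ge0 // ltW.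
  have : 0 <= crossc v z * Im w by rewrite mulr_ge0.
  by lra.
have : 0 <= crossc z w * dotc e v by rewrite mulr_ge0 // ltW.
have : 0 < crossc w v * dotc e z by rewrite mulr_gt0.
have : 0 <= crossc v z * dotc e w by rewrite mulr_ge0 // ltW.
by lra.
Qed.

Lemma crossc_lower e z w v : 0 < dotc e z -> 0 < dotc e w -> 0 < dotc e v ->
  ~~ upper z -> ~~ upper w -> upper v -> crossc w v < 0 -> crossc z v < 0.
Proof.
rewrite /upper -!ltNge => ez ew ev uz uw nv wv; rewrite ltNge; apply/negP => zv.
have plI : crossc z w * Im v + crossc w v * Im z + crossc v z * Im w = 0.
  by rewrite /crossc; ring.
have ple : crossc z w * dotc e v + crossc w v * dotc e z + crossc v z * dotc e w = 0.
  by rewrite /crossc /dotc; ring.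
have vz : crossc v z <= 0 by rewrite crosscC oppr_le0.
have zw : crossc z w <= 0.
  rewrite leNgt; apply/negP => zw.
  have : 0 <= crossc z w * Im v by rewrite mulr_ge0 // ltW.
  have : 0 < crossc w v * Im z by rewrite nmulr_rgt0.
  have : 0 <= crossc v z * Im w by rewrite mulr_le0 // ltW.
  by lra.
have : crossc z w * dotc e v <= 0 by rewrite mulr_le0_ge0 // ltW.
have : crossc w v * dotc e z < 0 by rewrite pmulr_llt0.
have : crossc v z * dotc e w <= 0 by rewrite mulr_le0_ge0 // ltW.
by lra.
Qed.

(** Within an open half-plane through 0, the crossing count depends only on the
sides of the end points, hence is additive.  All properties of winding numbers
come from this cocycle identity. *)
Lemma cut_trans e z w v : 0 < dotc e z -> 0 < dotc e w -> 0 < dotc e v ->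
  cut z w + cut w v = cut z v.
Proof.
move=> ez ew ev.
have uu x y t : 0 < dotc e x -> 0 < dotc e y -> 0 < dotc e t ->
    upper x -> upper y -> ~~ upper t -> (0 < crossc x t) = (0 < crossc y t).
  move=> ex ey et ux uy ut.
  by apply/idP/idP; [apply: (crossc_upper ey ex et)|apply: (crossc_upper ex ey et)].
have ll x y t : 0 < dotc e x -> 0 < dotc e y -> 0 < dotc e t ->
    ~~ upper x -> ~~ upper y -> upper t -> (crossc x t < 0) = (crossc y t < 0).
  move=> ex ey et ux uy ut.
  by apply/idP/idP; [apply: (crossc_lower ey ex et)|apply: (crossc_lower ex ey et)].
rewrite /cut.
case uz: (upper z); case uw: (upper w); case uv: (upper v) => /=; rewrite ?subr0 ?sub0r ?add0r ?addr0 //.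
- by rewrite (uu z w v) ?uz ?uw ?uv.
- by rewrite (crosscC v w) oppr_lt0 (uu v z w) ?uv ?uz ?uw // subrr.
- by rewrite (crosscC w z) (crosscC v z) !oppr_gt0 (ll w v z) ?uv ?uz ?uw.
- by rewrite (crosscC w z) (crosscC v z) !oppr_lt0 (uu w v z) ?uv ?uz ?uw.
- by rewrite (crosscC v w) oppr_gt0 (ll v z w) ?uv ?uz ?uw // addNr.
- by rewrite (ll z w v) ?uz ?uw ?uv.
Qed.

End Cut.

(** * Winding numbers *)

Section Compactness.
Variable R : realType.

(** A Lebesgue number argument.  Applied to the dot product of two values of a
nonvanishing function, it makes the values at neighbouring mesh points lie in a
common half-plane. *)
Lemma compact_diag_pos (T : pseudoMetricType R) (A : set T) (D : T * T -> R) :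
  compact A -> continuous D -> (forall x, A x -> 0 < D (x, x)) ->
  exists2 e : R, 0 < e & forall p q, A p -> ball p e q -> 0 < D (p, q).
Proof.
move=> /compact_near_coveringP cA cD pD.
have : \forall e \near (0 : R)^'+, A `<=` [set p | forall q, ball p e q -> 0 < D (p, q)].
  apply: cA => x Ax.
  have : \forall y \near (x, x), 0 < D y.
    by move: (cD (x, x)) => /cvgr_gt; apply; apply: pD.
  move=> [[U V]] /= [/nbhs_ballP[e1 /= e10 U1] /nbhs_ballP[e2 /= e20 V1]] UV.
  near=> x' e => /= q x'q; apply: UV; split => /=.
    by apply: U1; near: x'; apply: nbhsx_ballx.
  apply: V1; rewrite [e2]splitr; apply: (@ball_triangle _ _ x').
    by near: x'; apply: nbhsx_ballx; rewrite divr_gt0.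
  apply: (le_ball _ x'q); apply: ltW; near: e.
  by apply: nbhs_right_lt; rewrite divr_gt0.
move=> H; near (0 : R)^'+ => e; exists e.
  by near: e; apply: nbhs_right_gt.
by move=> p q Ap; apply: (near H e).
Unshelve. all: by end_near. Qed.

Lemma compact_pos_lb (T : topologicalType) (A : set T) (f : T -> R) :
  compact A -> continuous f -> (forall x, A x -> 0 < f x) ->
  exists2 e : R, 0 < e & forall p, A p -> e < f p.
Proof.
move=> /compact_near_coveringP cA cf pf.
have : \forall e \near (0 : R)^'+, A `<=` [set p | e < f p].
  apply: cA => x Ax; have fx := pf x Ax.
  near=> x' e => /=; apply: (@lt_trans _ _ (f x / 2)).
    by near: e; apply: nbhs_right_lt; rewrite divr_gt0.
  near: x'; apply: (cvgr_gt (f x)); first exact: cf.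
  by rewrite ltr_pdivrMr // ltr_pMr // ltr1n.
move=> H; near (0 : R)^'+ => e; exists e.
  by near: e; apply: nbhs_right_gt.
by move=> p Ap; apply: (near H e).
Unshelve. all: by end_near. Qed.

End Compactness.

Section Winding.
Variable R : realType.
Local Notation Re := (@complex.Re R).
Local Notation Im := (@complex.Im R).

Lemma cfD (T : topologicalType) (f g : T -> R) : continuous f -> continuous g ->
  continuous (fun x => f x + g x).
Proof. by move=> cf cg x; apply: continuousD; [exact: cf|exact: cg]. Qed.

Lemma cfN (T : topologicalType) (f : T -> R) : continuous f ->
  continuous (fun x => - f x).
Proof. by move=> cf x; apply: continuousN; exact: cf. Qed.

Lemma cfB (T : topologicalType) (f g : T -> R) : continuous f -> continuous g ->
  continuous (fun x => f x - g x).
Proof. by move=> cf cg; apply: cfD => //; apply: cfN. Qed.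

Lemma cfM (T : topologicalType) (f g : T -> R) : continuous f -> continuous g ->
  continuous (fun x => f x * g x).
Proof. by move=> cf cg x; apply: continuousM; [exact: cf|exact: cg]. Qed.

Lemma cf_cst (T : topologicalType) (a : R) : continuous (fun _ : T => a).
Proof. by move=> x; exact: cvg_cst. Qed.

Lemma cf_comp (T U V : topologicalType) (h : T -> U) (f : U -> V) :
  continuous h -> continuous f -> continuous (fun x => f (h x)).
Proof. by move=> ch cf x; apply: (@continuous_comp _ _ _ h f); [exact: ch|exact: cf]. Qed.

Lemma cf_pair (T U V : topologicalType) (f : T -> U) (g : T -> V) :
  continuous f -> continuous g -> continuous (fun x => (f x, g x)).
Proof.
move=> cf cg x; apply: (@cvg_pair _ _ _ (nbhs x) (nbhs (f x)) (nbhs (g x)) _ _ _ f g).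
  exact: cf.
exact: cg.
Qed.

Lemma cf_fst (U V : topologicalType) : continuous (@fst U V).
Proof. by move=> x; exact: cvg_fst. Qed.

Lemma cf_snd (U V : topologicalType) : continuous (@snd U V).
Proof. by move=> x; exact: cvg_snd. Qed.

Lemma cf_id (T : topologicalType) : continuous (fun x : T => x).
Proof. by move=> x; exact: cvg_id. Qed.

(** Continuity by real and imaginary parts, which spares a topology on [R[i]]. *)
Definition ccont (T : topologicalType) (f : T -> R[i]) : Prop :=
  continuous (Re \o f) /\ continuous (Im \o f).

Definition unit_itv : set R := `[0, 1].
Definition unit_sq : set (R * R) := unit_itv `*` unit_itv.

Lemma unit_itvP (s : R) : unit_itv s <-> 0 <= s <= 1.
Proof. by rewrite /unit_itv /= in_itv. Qed.

Lemma compact_unit_sq : compact unit_sq.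
Proof. by apply: compact_setX; apply: segment_compact. Qed.

Lemma ccont_mesh (K : R * R -> R[i]) : ccont K ->
  (forall p, unit_sq p -> K p != 0) ->
  \forall N \near \oo, forall p q, unit_sq p ->
    `|p.1 - q.1| <= N%:R^-1 -> `|p.2 - q.2| <= N%:R^-1 -> 0 < dotc (K p) (K q).
Proof.
move=> [cR cI] K0.
have [||e e0 H] := @compact_diag_pos R _ unit_sq
    (fun pq => dotc (K pq.1) (K pq.2)) compact_unit_sq.
- have c1 : continuous (@fst (R * R) (R * R)) by move=> x; exact: cvg_fst.
  have c2 : continuous (@snd (R * R) (R * R)) by move=> x; exact: cvg_snd.
  by apply: cfD; apply: cfM; [exact: (cf_comp c1 cR)|exact: (cf_comp c2 cR)|
    exact: (cf_comp c1 cI)|exact: (cf_comp c2 cI)].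
- move=> x Ax; rewrite /dotc /= -!expr2 lt_neqAle addr_ge0 ?sqr_ge0 // andbT eq_sym.
  apply: contra (K0 _ Ax); rewrite paddr_eq0 ?sqr_ge0 // !sqrf_eq0.
  by case: (K x) => a b /= /andP[/eqP -> /eqP ->].
near=> N => p q Ap h1 h2.
have Ne : N%:R^-1 < e.
  rewrite invf_plt ?posrE //; last first.
    by rewrite ltr0n; near: N; exists 1%N.
  by near: N; apply: nbhs_infty_gtr.
by apply: H => //; split; rewrite /ball /= ?(le_lt_trans h1) ?(le_lt_trans h2).
Unshelve. all: by end_near. Qed.

Definition turns (N : nat) (g : R -> R[i]) : int :=
  \sum_(0 <= k < N) cut (g (k%:R / N%:R)) (g (k.+1%:R / N%:R)).

(** The value at which the crossing counts of finer and finer inscribed polygons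
settle; by [turns_winding] it exists for every loop. *)
Definition winding (g : R -> R[i]) : int :=
  xget 0 [set z | \forall N \near \oo, turns N g = z].

Definition is_loop (g : R -> R[i]) : Prop :=
  [/\ ccont g, forall s, 0 <= s <= 1 -> g s != 0 & g 0 = g 1].

Lemma grid_itv (N k : nat) : (k <= N)%N -> 0 <= (k%:R / N%:R : R) <= 1.
Proof.
move=> kN; rewrite divr_ge0 ?ler0n //=.
case: N kN => [|N] kN; first by rewrite invr0 mulr0 ler01.
by rewrite ler_pdivrMr ?ltr0n // mul1r ler_nat.
Qed.

Lemma grid_step (N k : nat) : `|k%:R / N%:R - k.+1%:R / N%:R| <= N%:R^-1 :> R.
Proof.
rewrite -mulrBl -natr1 opprD addrA subrr sub0r mulN1r normrN ger0_norm //.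
Qed.

Lemma is_loop_mesh g : is_loop g ->
  \forall N \near \oo, forall s s', 0 <= s <= 1 ->
     `|s - s'| <= N%:R^-1 -> 0 < dotc (g s) (g s').
Proof.
case=> -[cR cI] g0 _.
have [||] := @ccont_mesh (g \o snd).
- by split=> x; [apply: (@continuous_comp _ _ _ snd (Re \o g))|
    apply: (@continuous_comp _ _ _ snd (Im \o g))]; by [apply: cvg_snd|apply: cR|apply: cI].
- by move=> [a b] [_] /unit_itvP /= bP; apply: g0.
move=> N0 _ H; exists N0 => // N NN0 s s' sP ss'.
apply: (H N NN0 (0, s) (0, s')) => //=; last by rewrite subrr normr0.
by split => /=; apply/unit_itvP => //; rewrite lexx ler01.
Qed.

Lemma cut_chain (e : R[i]) (z : nat -> R[i]) (a n : nat) :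
  (forall k, (a <= k <= a + n)%N -> 0 < dotc e (z k)) ->
  \sum_(a <= k < a + n) cut (z k) (z k.+1) = cut (z a) (z (a + n)%N).
Proof.
elim: n => [|n IHn] H; first by rewrite addn0 big_geq // cutzz.
rewrite addnS big_nat_recr ?leq_addr //= IHn; last first.
  by move=> k /andP[ak kn]; apply: H; rewrite ak addnS ltnW.
by rewrite (cut_trans (e := e)) ?addnS //; apply: H; lia.
Qed.

(** Between two mesh points all values lie in the half-plane around the first
one, so that [cut_trans] telescopes. *)
Lemma turns_refine g : is_loop g ->
  \forall N \near \oo, forall M, (0 < M)%N -> turns (N * M) g = turns N g.
Proof.
move=> lg; near=> N => M M0.
have N0 : (0 < N)%N by near: N; exists 1%N.
have mesh : forall s s', 0 <= s <= 1 -> `|s - s'| <= N%:R^-1 -> 0 < dotc (g s) (g s').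
  by near: N; apply: is_loop_mesh.
rewrite /turns big_nat_mul; apply: eq_big_nat => k /andP[_ kN].
have nz (n : nat) : (0 < n)%N -> n%:R != 0 :> R by rewrite pnatr_eq0 -lt0n.
have e1 : g (k%:R / N%:R) = g ((k * M)%:R / (N * M)%:R).
  congr g; rewrite !natrM; field; by rewrite ?nz.
have e2 : g (k.+1%:R / N%:R) = g ((k * M + M)%:R / (N * M)%:R).
  congr g; rewrite !natrM -natr1 natrD natrM; field; by rewrite ?nz.
rewrite e1 e2 mulSn addnC.
apply: (@cut_chain (g (k%:R / N%:R)) (fun j => g (j%:R / (N * M)%:R))) => j /andP[kj jk].
apply: mesh; first exact/grid_itv/ltnW.
have -> : k%:R / N%:R = (k * M)%:R / (N * M)%:R :> R.
  by rewrite !natrM; field; rewrite ?nz.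
rewrite distrC -mulrBl -natrB // normrM normfV !normr_nat ler_pdivrMr ?ltr0n ?muln_gt0 ?N0 //.
by rewrite natrM mulKf ?nz // ler_nat leq_subLR.
Unshelve. all: by end_near. Qed.

Lemma turns_winding g : is_loop g -> \forall N \near \oo, turns N g = winding g.
Proof.
move=> lg; rewrite /winding; case: xgetP => [z _ //|] /(_ _) H.
have [N0 _ R0] := turns_refine lg.
exfalso; apply: (H (turns N0.+1 g)); exists N0.+1 => // N /= N0N.
have N0' : (0 < N)%N by apply: leq_trans N0N.
rewrite -(R0 N0.+1 _ N) ?leqW //= mulnC; symmetry; apply: R0 => //=.
exact: ltnW.
Qed.

(** A discrete Stokes theorem: on a grid whose cells have their values in
half-planes, [cut] is the coboundary of the potential [phi], and sums along
paths depend on the end points only. *)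
Section Grid.
Variables (Z : nat -> nat -> R[i]) (N : nat).
Hypothesis Zmesh : forall i j a b, (i < N)%N -> (j < N)%N -> (a <= 1)%N -> (b <= 1)%N ->
  0 < dotc (Z i j) (Z (a + i) (b + j)).

Let phi i j := \sum_(0 <= i' < i) cut (Z i' 0) (Z i'.+1 0)
  + \sum_(0 <= j' < j) cut (Z i j') (Z i j'.+1).

Let phi_step i j : (i < N)%N -> (j <= N)%N ->
  phi i.+1 j = phi i j + cut (Z i j) (Z i.+1 j).
Proof.
move=> iN; elim: j => [|j IHj] jN.
  by rewrite /phi !(@big_geq _ _ _ 0%N 0%N) // !addr0 big_nat_recr.
have := IHj (ltnW jN); rewrite /phi [\sum_(0 <= j' < j.+1) cut (Z i.+1 _) _]big_nat_recr //=.
rewrite [\sum_(0 <= j' < j.+1) cut (Z i _) _]big_nat_recr //= => IH.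
have M := Zmesh iN jN.
have key : cut (Z i j) (Z i.+1 j) + cut (Z i.+1 j) (Z i.+1 j.+1)
    = cut (Z i j) (Z i j.+1) + cut (Z i j.+1) (Z i.+1 j.+1).
  rewrite (cut_trans (e := Z i j)); [|exact: (M 0 0)|exact: (M 1 0)|exact: (M 1 1)].
  by rewrite (cut_trans (e := Z i j)); [|exact: (M 0 0)|exact: (M 0 1)|exact: (M 1 1)].
by rewrite [LHS]addrA [X in X + _ = _]IH -[LHS]addrA [X in _ + X = _]key !addrA.
Qed.

Let phi_top i j : (i <= N)%N -> (j <= N)%N ->
  phi i j = phi 0 j + \sum_(0 <= i' < i) cut (Z i' j) (Z i'.+1 j).
Proof.
move=> iN jN; elim: i iN => [|i IHi] iN; first by rewrite big_geq // addr0.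
by rewrite phi_step // IHi 1?ltnW // -addrA [in RHS]big_nat_recr.
Qed.

Lemma grid_boundary :
  \sum_(0 <= i < N) cut (Z i 0) (Z i.+1 0) + \sum_(0 <= j < N) cut (Z N j) (Z N j.+1)
  = \sum_(0 <= j < N) cut (Z 0 j) (Z 0 j.+1) + \sum_(0 <= i < N) cut (Z i N) (Z i.+1 N).
Proof.
have := @phi_top N N (leqnn _) (leqnn _); rewrite /phi => ->.
by rewrite (@big_geq _ _ _ 0%N 0%N) // add0r.
Qed.

Lemma grid_diag :
  \sum_(0 <= i < N) cut (Z i i) (Z i.+1 i.+1)
  = \sum_(0 <= i < N) cut (Z i 0) (Z i.+1 0) + \sum_(0 <= j < N) cut (Z N j) (Z N j.+1).
Proof.
suff H i : (i <= N)%N -> \sum_(0 <= k < i) cut (Z k k) (Z k.+1 k.+1) = phi i i.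
  by rewrite H.
elim: i => [|i IHi] iN; first by rewrite /phi !big_geq // addr0.
rewrite big_nat_recr //= IHi 1?ltnW //.
have M := Zmesh iN iN.
have h1 : phi i.+1 i.+1 = phi i.+1 i + cut (Z i.+1 i) (Z i.+1 i.+1).
  by rewrite /phi [\sum_(0 <= j' < i.+1) cut (Z i.+1 _) _]big_nat_recr //= addrA.
rewrite h1 phi_step // 1?ltnW // -[RHS]addrA; congr (_ + _); apply/esym.
by rewrite (cut_trans (e := Z i i)); [|exact: (M 0 0)|exact: (M 1 0)|exact: (M 1 1)].
Qed.

End Grid.

Lemma ccont_grid (K : R * R -> R[i]) : ccont K ->
  (forall p, unit_sq p -> K p != 0) ->
  \forall N \near \oo, forall i j a b, (i < N)%N -> (j < N)%N ->
    (a <= 1)%N -> (b <= 1)%N ->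
    0 < dotc (K (i%:R / N%:R, j%:R / N%:R)) (K ((a + i)%:R / N%:R, (b + j)%:R / N%:R)).
Proof.
move=> cK K0; have [N0 _ H] := ccont_mesh cK K0; exists N0 => // N N0N i j a b iN jN a1 b1.
have st k c : (c <= 1)%N -> `|k%:R / N%:R - (c + k)%:R / N%:R| <= N%:R^-1 :> R.
  case: c => [|[|//]] _; last exact: grid_step.
  by rewrite add0n subrr normr0 invr_ge0.
apply: (H N N0N) => //=; try exact: st.
by split; apply/unit_itvP; apply: grid_itv; apply: ltnW.
Qed.

Lemma is_loop_section (K : R * R -> R[i]) (t : R) : 0 <= t <= 1 -> ccont K ->
  (forall p, unit_sq p -> K p != 0) -> K (t, 0) = K (t, 1) ->
  is_loop (fun s => K (t, s)).
Proof.
move=> t01 [cR cI] K0 Kt; split => //.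
  have ct : continuous (fun s : R => (t, s)).
    by move=> s; apply: (@cvg_pair _ _ _ (nbhs s) (nbhs t) (nbhs s) _ _ _ (fun=> t) id); [exact: cvg_cst|exact: cvg_id].
  by split=> s; [apply: (@continuous_comp _ _ _ (fun s => (t, s)) (Re \o K))|
    apply: (@continuous_comp _ _ _ (fun s => (t, s)) (Im \o K))]; by [apply: ct|apply: cR|apply: cI].
by move=> s s01; apply: K0; split; apply/unit_itvP.
Qed.

(** The crossing counts along the two vertical sides of the parameter square
differ by those along the horizontal sides, which cancel because all curves of
the homotopy are closed. *)
Lemma winding_homotopy (K : R * R -> R[i]) : ccont K ->
  (forall p, unit_sq p -> K p != 0) ->
  (forall t, 0 <= t <= 1 -> K (t, 0) = K (t, 1)) ->
  winding (fun s => K (0, s)) = winding (fun s => K (1, s)).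
Proof.
move=> cK K0 Kc.
have t0 : 0 <= (0 : R) <= 1 by rewrite lexx ler01.
have t1 : 0 <= (1 : R) <= 1 by rewrite lexx ler01.
have l0 := is_loop_section t0 cK K0 (Kc _ t0).
have l1 := is_loop_section t1 cK K0 (Kc _ t1).
near \oo => N.
have <- : turns N (fun s => K (0, s)) = winding (fun s => K (0, s)).
  by near: N; apply: turns_winding.
have <- : turns N (fun s => K (1, s)) = winding (fun s => K (1, s)).
  by near: N; apply: turns_winding.
have N0 : (0 < N)%N by near: N; exists 1%N.
have NN : N%:R / N%:R = 1 :> R by rewrite divff // pnatr_eq0 -lt0n.
have G : forall i j a b, (i < N)%N -> (j < N)%N -> (a <= 1)%N -> (b <= 1)%N ->
    0 < dotc (K (i%:R / N%:R, j%:R / N%:R)) (K ((a + i)%:R / N%:R, (b + j)%:R / N%:R)).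
  by near: N; exact: ccont_grid.
have := @grid_boundary (fun i j => K (i%:R / N%:R, j%:R / N%:R)) N G; rewrite NN mul0r.
rewrite /turns => E; apply/esym; move: E; rewrite addrC => E.
apply: (addIr _ (etrans E _)); congr (_ + _).
by apply: eq_big_nat => i /andP[_ iN]; rewrite !Kc ?grid_itv // ltnW.
Unshelve. all: by end_near. Qed.

Lemma ccontM (T : topologicalType) (f g : T -> R[i]) : ccont f -> ccont g ->
  ccont (fun x => f x * g x).
Proof.
move=> [fR fI] [gR gI]; split.
  have -> : Re \o (fun x => f x * g x)
      = (fun x => Re (f x) * Re (g x) - Im (f x) * Im (g x)).
    by apply/funext => x /=; case: (f x) => a b; case: (g x) => c d.
  by apply: cfB; apply: cfM.
have -> : Im \o (fun x => f x * g x)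
    = (fun x => Re (f x) * Im (g x) + Im (f x) * Re (g x)).
  by apply/funext => x /=; case: (f x) => a b; case: (g x) => c d.
by apply: cfD; apply: cfM.
Qed.

Lemma ccontD (T : topologicalType) (f g : T -> R[i]) : ccont f -> ccont g ->
  ccont (fun x => f x + g x).
Proof.
move=> [fR fI] [gR gI]; split.
  have -> : Re \o (fun x => f x + g x) = (fun x => Re (f x) + Re (g x)).
    by apply/funext => x /=; case: (f x) => a b; case: (g x) => c d.
  exact: cfD.
have -> : Im \o (fun x => f x + g x) = (fun x => Im (f x) + Im (g x)).
  by apply/funext => x /=; case: (f x) => a b; case: (g x) => c d.
exact: cfD.
Qed.

Lemma ccont_comp (T U : topologicalType) (h : T -> U) (f : U -> R[i]) :
  continuous h -> ccont f -> ccont (f \o h).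
Proof.
move=> ch [cR cI]; split => x.
  by apply: (@continuous_comp _ _ _ h (Re \o f)); [exact: ch|exact: cR].
by apply: (@continuous_comp _ _ _ h (Im \o f)); [exact: ch|exact: cI].
Qed.

Lemma ccont_cst (T : topologicalType) (z : R[i]) : ccont (fun _ : T => z).
Proof. by split => x; apply: cvg_cst. Qed.

Lemma winding_cst (z : R[i]) : z != 0 -> winding (fun=> z) = 0.
Proof.
move=> z0; near \oo => N.
have <- : turns N (fun=> z) = winding (fun=> z).
  near: N; apply: turns_winding; split=> //; exact: ccont_cst.
by rewrite /turns big1 // => k _; rewrite cutzz.
Unshelve. all: by end_near. Qed.

Lemma is_loopM f g : is_loop f -> is_loop g -> is_loop (fun s => f s * g s).
Proof.
move=> [cf f0 fc] [cg g0 gc]; split; first exact: ccontM.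
  by move=> s s01; rewrite mulf_neq0 ?f0 ?g0.
by rewrite fc gc.
Qed.

Lemma is_loop_cst (z : R[i]) : z != 0 -> is_loop (fun=> z).
Proof. by move=> z0; split => //; apply: ccont_cst. Qed.

Definition lerp (z w : R[i]) (t : R) : R[i] :=
  (((1 - t) * Re z + t * Re w)%R +i* ((1 - t) * Im z + t * Im w)%R)%C.

Lemma lerp0 z w : lerp z w 0 = z.
Proof. by case: z => a b; rewrite /lerp /= !subr0 !mul1r !mul0r !addr0. Qed.

Lemma lerp1 z w : lerp z w 1 = w.
Proof. by case: w => a b; rewrite /lerp /= !subrr !mul0r !mul1r !add0r. Qed.

Lemma ccont_lerp (T : topologicalType) (f g : T -> R[i]) (h : T -> R) :
  ccont f -> ccont g -> continuous h -> ccont (fun x => lerp (f x) (g x) (h x)).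
Proof.
move=> [fR fI] [gR gI] ch; split; rewrite /lerp /=.
  by apply: cfD; apply: cfM => //; apply: cfB => //; exact: cf_cst.
by apply: cfD; apply: cfM => //; apply: cfB => //; exact: cf_cst.
Qed.

Lemma winding_mul_path (f : R -> R[i]) (z w : R[i]) : is_loop f ->
  (forall t, 0 <= t <= 1 -> lerp z w t != 0) ->
  winding (fun s => f s * z) = winding (fun s => f s * w).
Proof.
move=> [cf f0 fc] zw.
have := @winding_homotopy (fun p => f p.2 * lerp z w p.1).
rewrite /= lerp0 lerp1; apply.
- apply: ccontM; first by apply: (@ccont_comp _ _ snd) => // x; exact: cvg_snd.
  by apply: ccont_lerp; [exact: ccont_cst|exact: ccont_cst|move=> x; exact: cvg_fst].
- move=> [t s] [/unit_itvP /= t01 /unit_itvP /= s01].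
  by rewrite mulf_neq0 ?f0 ?zw.
- by move=> t _; rewrite fc.
Qed.

Lemma eq_complex0 (z : R[i]) : (z == 0) = (Re z == 0) && (Im z == 0).
Proof. by case: z => a b; rewrite eq_complex. Qed.

(** A segment from z to 1 in the plane may run through 0; when the real part of
z is not positive, the path makes a detour through the imaginary unit. *)
Lemma winding_scale (f : R -> R[i]) (z : R[i]) : is_loop f -> z != 0 ->
  winding (fun s => f s * z) = winding f.
Proof.
move=> lf z0.
have -> : winding f = winding (fun s => f s * 1) by congr winding; apply/funext=> s; rewrite mulr1.
have pos z' : 0 < Re z' -> winding (fun s => f s * z') = winding (fun s => f s * 1).
  move=> p; apply: winding_mul_path => // t /andP[t0 t1].
  rewrite eq_complex0 /lerp negb_and /= gt_eqF //.
  have [->|tn] := eqVneq t 1; first by rewrite subrr mul0r add0r mulr1 ltr01.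
  by rewrite ltr_pwDl ?mulr_ge0 // mulr_gt0 // subr_gt0 lt_neqAle tn.
have [/pos //|] := ltP 0 (Re z).
rewrite le_eqVlt => /predU1P[Rz|nz].
  have Iz : Im z != 0 by move: z0; rewrite eq_complex0 Rz eqxx.
  rewrite -(pos (1 +i* 0)%C) ?ltr01 //; apply: winding_mul_path => // t /andP[t0 t1].
  rewrite eq_complex0 /lerp negb_and /= Rz mulr0 add0r mulr1 mulr0 addr0.
  have [->|tn] := eqVneq t 0; last by [].
  by rewrite subr0 mul1r Iz orbT.
transitivity (winding (fun s => f s * (0 +i* 1)%C)).
  apply: winding_mul_path => // t /andP[t0 t1].
  rewrite eq_complex0 /lerp negb_and /= mulr0 addr0 mulr1.
  have [->|tn] := eqVneq t 1; first by rewrite subrr !mul0r add0r oner_eq0 orbT.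
  by rewrite mulf_neq0 // ?subr_eq0 1?eq_sym // 1?eq_sym lt_eqF.
apply: winding_mul_path => // t /andP[t0 t1].
rewrite eq_complex0 /lerp negb_and /= !mulr0 add0r mulr1 addr0.
by have [->|tn] := eqVneq t 0; last by []; rewrite subr0 mul1r oner_eq0 orbT.
Qed.

(** On the square, f s * g t is counted along the diagonal on the left-hand
side, and along two sides on the right-hand side. *)
Lemma windingM f g : is_loop f -> is_loop g ->
  winding (fun s => f s * g s) = winding f + winding g.
Proof.
move=> lf lg; have [cf f0 fc] := lf; have [cg g0 gc] := lg.
have z01 : 0 <= (0 : R) <= 1 by rewrite lexx ler01.
have o01 : 0 <= (1 : R) <= 1 by rewrite lexx ler01.
have <- : winding (fun s => f s * g 0) = winding f by apply: winding_scale; rewrite ?g0.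
have <- : winding (fun s => g s * f 1) = winding g by apply: winding_scale; rewrite ?f0.
pose K p := f p.1 * g p.2.
have cK : ccont K.
  by apply: ccontM; [apply: (@ccont_comp _ _ fst)|apply: (@ccont_comp _ _ snd)] => // x;
    [exact: cvg_fst|exact: cvg_snd].
have K0 p : unit_sq p -> K p != 0.
  by case: p => t s [/unit_itvP /= t01 /unit_itvP /= s01]; rewrite mulf_neq0 ?f0 ?g0.
near \oo => N.
have <- : turns N (fun s => f s * g s) = winding (fun s => f s * g s).
  by near: N; apply: turns_winding; apply: is_loopM.
have <- : turns N (fun s => f s * g 0) = winding (fun s => f s * g 0).
  by near: N; apply: turns_winding; apply: is_loopM => //; apply: is_loop_cst; rewrite g0.
have <- : turns N (fun s => g s * f 1) = winding (fun s => g s * f 1).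
  by near: N; apply: turns_winding; apply: is_loopM => //; apply: is_loop_cst; rewrite f0.
have N0 : (0 < N)%N by near: N; exists 1%N.
have NN : N%:R / N%:R = 1 :> R by rewrite divff // pnatr_eq0 -lt0n.
have G : forall i j a b, (i < N)%N -> (j < N)%N -> (a <= 1)%N -> (b <= 1)%N ->
    0 < dotc (K (i%:R / N%:R, j%:R / N%:R)) (K ((a + i)%:R / N%:R, (b + j)%:R / N%:R)).
  by near: N; exact: ccont_grid.
have := @grid_diag (fun i j => K (i%:R / N%:R, j%:R / N%:R)) N G; rewrite NN mul0r.
move=> E; rewrite /turns E; congr (_ + _).
by apply: eq_big_nat => i /andP[_ iN]; rewrite /K /= ![_ * f 1]mulrC.
Unshelve. all: by end_near. Qed.

Lemma winding_pos (a : R -> R) : continuous a ->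
  (forall s, 0 <= s <= 1 -> 0 < a s) -> a 0 = a 1 -> winding (fun s => (a s)%:C%C) = 0.
Proof.
move=> ca a0 ac; near \oo => N.
have <- : turns N (fun s => (a s)%:C%C) = winding (fun s => (a s)%:C%C).
  near: N; apply: turns_winding; split; last by rewrite ac.
    by split => //= x; exact: cvg_cst.
  by move=> s s01; rewrite eq_complex0 /= gt_eqF ?a0.
by rewrite /turns big1 // => k _; rewrite /cut /upper /= lexx.
Unshelve. all: by end_near. Qed.

(** The product of f with its conjugate is positive, and does not wind. *)
Lemma winding_conj f : is_loop f -> winding (fun s => (f s)^*%C) = - winding f.
Proof.
move=> lf; have [[cR cI] f0 fc] := lf.
apply/eqP; rewrite -subr_eq0 opprK; apply/eqP.
have lc : is_loop (fun s => (f s)^*%C).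
  split; last by rewrite fc.
    split.
      by have -> : Re \o (fun s => (f s)^*%C) = Re \o f; [apply/funext => s /=; case: (f s)|].
    have -> : Im \o (fun s => (f s)^*%C) = (fun s => - Im (f s)).
      by apply/funext => s /=; case: (f s).
    exact: cfN.
  move=> s s01; move: (f0 s s01); rewrite !eq_complex0; case: (f s) => a b /=.
  by rewrite oppr_eq0.
rewrite -windingM //.
transitivity (winding (fun s => (Re (f s) ^+ 2 + Im (f s) ^+ 2)%:C%C)).
  congr winding; apply/funext => s; case: (f s) => a b /=.
  by apply/eqP; rewrite eq_complex /=; apply/andP; split; apply/eqP; ring.
apply: winding_pos; last by rewrite fc.
  by apply: cfD; apply: cfM.
move=> s /f0; rewrite eq_complex0 negb_and => /orP[] h.
  by rewrite ltr_pwDl ?sqr_ge0 // lt_neqAle eq_sym sqrf_eq0 h sqr_ge0.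
by rewrite ltr_wpDl ?sqr_ge0 // lt_neqAle eq_sym sqrf_eq0 h sqr_ge0.
Qed.

Lemma winding_rev f : is_loop f -> winding (fun s => f (1 - s)) = - winding f.
Proof.
move=> lf; have [cf f0 fc] := lf.
near \oo => N.
have <- : turns N (fun s => f (1 - s)) = winding (fun s => f (1 - s)).
  near: N; apply: turns_winding; split; last by rewrite subr0 subrr.
    apply: (@ccont_comp _ _ (fun s : R => 1 - s) f) => //.
    by apply: cfB; [exact: cf_cst|move=> s; exact: cvg_id].
  by move=> s /andP[s0 s1]; apply: f0; rewrite subr_ge0 s1 gerBl s0.
have <- : turns N f = winding f by near: N; apply: turns_winding.
have N0 : (0 < N)%N by near: N; exists 1%N.
rewrite /turns big_nat_rev /= add0n -sumrN; apply: eq_big_nat => k /andP[_ kN].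
have E j : (j <= N)%N -> 1 - (N - j)%:R / N%:R = j%:R / N%:R :> R.
  by move=> jN; rewrite natrB //; field; rewrite pnatr_eq0 -lt0n.
by rewrite subnSK // !E ?(ltnW kN) // cutC.
Unshelve. all: by end_near. Qed.

End Winding.

(** * Spin matrices and solid angles *)

Section Spin.
Variable R : realType.
Local Notation Re := (@complex.Re R).
Local Notation Im := (@complex.Im R).
Implicit Types (a b v x : space R).

Definition cx v : R := v ord0 (inord 0).
Definition cy v : R := v ord0 (inord 1).
Definition cz v : R := v ord0 (inord 2).

Lemma ord3P (P : 'I_3 -> Prop) : P (inord 0) -> P (inord 1) -> P (inord 2) ->
  forall i, P i.
Proof.
move=> P0 P1 P2 [[|[|[|//]]] i3].
- by have -> : Ordinal i3 = inord 0; [apply/val_inj; rewrite /= inordK|].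
- by have -> : Ordinal i3 = inord 1; [apply/val_inj; rewrite /= inordK|].
- by have -> : Ordinal i3 = inord 2; [apply/val_inj; rewrite /= inordK|].
Qed.

Lemma space_eqP a b : cx a = cx b -> cy a = cy b -> cz a = cz b -> a = b.
Proof. by move=> h0 h1 h2; apply/rowP; apply: ord3P. Qed.

Lemma cxD a b : cx (a + b) = cx a + cx b. Proof. by rewrite /cx mxE. Qed.
Lemma cyD a b : cy (a + b) = cy a + cy b. Proof. by rewrite /cy mxE. Qed.
Lemma czD a b : cz (a + b) = cz a + cz b. Proof. by rewrite /cz mxE. Qed.
Lemma cxN a : cx (- a) = - cx a. Proof. by rewrite /cx mxE. Qed.
Lemma cyN a : cy (- a) = - cy a. Proof. by rewrite /cy mxE. Qed.
Lemma czN a : cz (- a) = - cz a. Proof. by rewrite /cz mxE. Qed.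
Lemma cxZ (k : R) a : cx (k *: a) = k * cx a. Proof. by rewrite /cx mxE. Qed.
Lemma cyZ (k : R) a : cy (k *: a) = k * cy a. Proof. by rewrite /cy mxE. Qed.
Lemma czZ (k : R) a : cz (k *: a) = k * cz a. Proof. by rewrite /cz mxE. Qed.
Lemma cx0 : cx 0 = 0. Proof. by rewrite /cx mxE. Qed.
Lemma cy0 : cy 0 = 0. Proof. by rewrite /cy mxE. Qed.
Lemma cz0 : cz 0 = 0. Proof. by rewrite /cz mxE. Qed.

Definition cE := (cxD, cyD, czD, cxN, cyN, czN, cxZ, cyZ, czZ, cx0, cy0, cz0).

Definition dot a b : R := cx a * cx b + cy a * cy b + cz a * cz b.
Definition nrm a : R := Num.sqrt (dot a a).

Lemma dot_ge0 a : 0 <= dot a a.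
Proof. by rewrite /dot !addr_ge0 // -expr2 sqr_ge0. Qed.

Lemma nrm_ge0 a : 0 <= nrm a. Proof. exact: sqrtr_ge0. Qed.

Lemma nrm_sqr a : nrm a * nrm a = dot a a.
Proof. by rewrite -expr2 sqr_sqrtr // dot_ge0. Qed.

Lemma dot_eq0 a : dot a a = 0 -> a = 0.
Proof.
have := sqr_ge0 (cx a); have := sqr_ge0 (cy a); have := sqr_ge0 (cz a).
rewrite /dot -!expr2 => h2 h1 h0 H.
have/eqP : cx a ^+ 2 = 0 by lra.
have/eqP : cy a ^+ 2 = 0 by lra.
have/eqP : cz a ^+ 2 = 0 by lra.
rewrite !sqrf_eq0 => /eqP e2 /eqP e1 /eqP e0.
by apply: space_eqP; rewrite cE.
Qed.

Lemma nrm_eq0 a : nrm a = 0 -> a = 0.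
Proof. by move=> h; apply: dot_eq0; rewrite -nrm_sqr h mul0r. Qed.

Lemma nrm0 : nrm 0 = 0.
Proof. by rewrite /nrm /dot !cE !mul0r !addr0 sqrtr0. Qed.

(** Up to the factor 2 |a|, the projection of C^2 onto the spinor pointing in
the direction a: the matrix |a| + a . sigma, where sigma are the Pauli
matrices.  It has rank one, and the trace of a product of such matrices has as
argument half the area of the spherical polygon of the directions. *)
Definition spin a : 'M[R[i]]_2 := \matrix_(i, j)
  if i == 0 then (if j == 0 then ((nrm a + cz a) +i* 0)%C else (cx a +i* - cy a)%C)
  else (if j == 0 then (cx a +i* cy a)%C else ((nrm a - cz a) +i* 0)%C).

Lemma ord2P (P : 'I_2 -> Prop) : P 0 -> P 1 -> forall i, P i.
Proof.
move=> P0 P1 [[|[|//]] i2].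
- by have -> : Ordinal i2 = 0; [apply/val_inj|].
- by have -> : Ordinal i2 = 1; [apply/val_inj|].
Qed.

Lemma mx2P (T : nzRingType) (A B : 'M[T]_2) : A 0 0 = B 0 0 -> A 0 1 = B 0 1 ->
  A 1 0 = B 1 0 -> A 1 1 = B 1 1 -> A = B.
Proof. by move=> h00 h01 h10 h11; apply/matrixP; apply: ord2P; apply: ord2P. Qed.

Lemma mul2E (T : nzRingType) (A B : 'M[T]_2) i j :
  (A * B) i j = A i 0 * B 0 j + A i 1 * B 1 j.
Proof.
rewrite mxE !big_ord_recl big_ord0 addr0.
by have -> : lift ord0 ord0 = 1 :> 'I_2 by apply/val_inj.
Qed.

Lemma tr2E (T : nzRingType) (A : 'M[T]_2) : \tr A = A 0 0 + A 1 1.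
Proof.
rewrite /mxtrace !big_ord_recl big_ord0 addr0.
by have -> : lift ord0 ord0 = 1 :> 'I_2 by apply/val_inj.
Qed.

(** If A is the column u times the row v, then A B A is u (v B u) v, and v B u is
the trace of A B. *)
Lemma rank1_sandwich (T : comNzRingType) (A B : 'M[T]_2) :
  A 0 0 * A 1 1 = A 0 1 * A 1 0 -> A * B * A = \tr (A * B) *: A.
Proof.
move=> /eqP; rewrite -subr_eq0 => /eqP d0.
apply: mx2P; rewrite [RHS]mxE !mul2E tr2E !mul2E.
- transitivity ((A 0 0 * B 0 0 + A 0 1 * B 1 0 + (A 1 0 * B 0 1 + A 1 1 * B 1 1)) * A 0 0
    - B 1 1 * (A 0 0 * A 1 1 - A 0 1 * A 1 0)); first by ring.
  by rewrite d0 mulr0 subr0.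
- transitivity ((A 0 0 * B 0 0 + A 0 1 * B 1 0 + (A 1 0 * B 0 1 + A 1 1 * B 1 1)) * A 0 1
    + B 0 1 * (A 0 0 * A 1 1 - A 0 1 * A 1 0)); first by ring.
  by rewrite d0 mulr0 addr0.
- transitivity ((A 0 0 * B 0 0 + A 0 1 * B 1 0 + (A 1 0 * B 0 1 + A 1 1 * B 1 1)) * A 1 0
    + B 1 0 * (A 0 0 * A 1 1 - A 0 1 * A 1 0)); first by ring.
  by rewrite d0 mulr0 addr0.
- transitivity ((A 0 0 * B 0 0 + A 0 1 * B 1 0 + (A 1 0 * B 0 1 + A 1 1 * B 1 1)) * A 1 1
    - B 0 0 * (A 0 0 * A 1 1 - A 0 1 * A 1 0)); first by ring.
  by rewrite d0 mulr0 subr0.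
Qed.

Lemma spin_det a : spin a 0 0 * spin a 1 1 = spin a 0 1 * spin a 1 0.
Proof.
rewrite !mxE /=; apply/eqP; rewrite eq_complex /=; apply/andP; split; apply/eqP; last by ring.
have := nrm_sqr a; rewrite /dot => H.
transitivity (nrm a * nrm a - cz a * cz a); first by ring.
by rewrite H; ring.
Qed.

Lemma spin_sandwich a B : spin a * B * spin a = \tr (spin a * B) *: spin a.
Proof. exact: rank1_sandwich (spin_det a). Qed.

Lemma spin_tr2 a b : \tr (spin a * spin b) = (2 * (nrm a * nrm b + dot a b))%:C%C.
Proof.
rewrite tr2E !mul2E !mxE /= /dot; apply/eqP; rewrite eq_complex /=.
by apply/andP; split; apply/eqP; ring.
Qed.

(** The directions a and b are not opposite; equivalently the spinors are not
orthogonal. *)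
Definition visible a b : bool := 0 < nrm a * nrm b + dot a b.

Lemma visible_nrm a b : visible a b -> 0 < nrm b.
Proof.
move=> ab; rewrite lt_neqAle nrm_ge0 andbT eq_sym; apply: contraTneq ab => /nrm_eq0 ->.
by rewrite /visible nrm0 /dot !cE !mulr0 !addr0 ltxx.
Qed.

Lemma spin_neq0 a : 0 < nrm a -> spin a != 0.
Proof.
move=> a0; apply/eqP => /matrixP E.
have := E 0 0; have := E 1 1; rewrite !mxE /= => /eqP; rewrite eq_complex /= => /andP[/eqP e1 _].
move=> /eqP; rewrite eq_complex /= => /andP[/eqP e2 _].
by lra.
Qed.

(** Multiplying by the second factor on the left turns the first two factors
into a nonzero multiple of the second one, because the trace of their product
is positive. *)
Lemma spin_path_neq0 a s : 0 < nrm a -> path visible a s ->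
  spin a * \prod_(v <- s) spin v != 0.
Proof.
elim: s a => [|b s IHs] a a0; first by rewrite big_nil mulr1 spin_neq0.
rewrite /= big_cons => /andP[ab sp].
have := IHs b (visible_nrm ab) sp; apply: contra => /eqP H.
have : spin b * (spin a * (spin b * \prod_(v <- s) spin v)) = 0 by rewrite H mulr0.
rewrite !mulrA spin_sandwich -scalerAl => /eqP; rewrite scaler_eq0 => /orP[|//].
rewrite spin_tr2 eq_complex /= => /andP[/eqP]; move: ab; rewrite /visible mulrC /dot.
by rewrite (mulrC (cx a)) (mulrC (cy a)) (mulrC (cz a)); lra.
Qed.

Lemma spin_cycle_neq0 (s : seq (space R)) : s != [::] -> path.cycle visible s ->
  \tr (\prod_(v <- s) spin v) != 0.
Proof.
case: s => [//|a s] _ /= sp.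
have a0 : 0 < nrm a.
  by move: sp; rewrite rcons_path => /andP[_ /visible_nrm].
have := spin_path_neq0 a0 sp; rewrite -cats1 big_cat big_seq1 big_cons /=.
set B := \prod_(v <- s) spin v; rewrite mulrA spin_sandwich.
by rewrite scaler_eq0 negb_or => /andP[].
Qed.

(** This is the equality case of the Cauchy-Schwarz inequality: opposite
vectors have 0 between them. *)
Lemma visibleP a b : visible a b \/
  exists2 t : R, 0 <= t <= 1 & (1 - t) *: a + t *: b = 0.
Proof.
have [|] := boolP (visible a b); [by left|rewrite /visible -leNgt => H; right].
have := nrm_sqr a; have := nrm_sqr b; have := nrm_ge0 a; have := nrm_ge0 b => b0 a0 nb na.
have D : nrm a *: b + nrm b *: a = 0.
  apply: dot_eq0; apply/eqP; rewrite eq_le dot_ge0 andbT.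
  have -> : dot (nrm a *: b + nrm b *: a) (nrm a *: b + nrm b *: a)
     = nrm a * nrm a * dot b b + nrm b * nrm b * dot a a + 2 * (nrm a * nrm b) * dot a b.
    by rewrite /dot !cE; ring.
  rewrite -na -nb.
  have -> : nrm a * nrm a * (nrm b * nrm b) + nrm b * nrm b * (nrm a * nrm a) +
    2 * (nrm a * nrm b) * dot a b = 2 * (nrm a * nrm b) * (nrm a * nrm b + dot a b) by ring.
  by rewrite mulr_ge0_le0 // !mulr_ge0.
have [S|S] := eqVneq (nrm a + nrm b) 0.
  exists 0; first by rewrite lexx ler01.
  have /nrm_eq0 -> : nrm a = 0 by lra.
  by rewrite scaler0 scale0r addr0.
have S0 : 0 < nrm a + nrm b by rewrite lt_neqAle eq_sym S addr_ge0.
exists (nrm a / (nrm a + nrm b)).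
  by rewrite divr_ge0 ?(ltW S0) //= ler_pdivrMr // mul1r lerDl.
have -> : 1 - nrm a / (nrm a + nrm b) = (nrm a + nrm b)^-1 * nrm b by field.
by rewrite [_ / (_ + _)]mulrC -!scalerA -scalerDr [_ + _ *: b]addrC D scaler0.
Qed.

(** A point v between a and b satisfies spin v = (1 - t) spin a + t spin b + c
for a real number c, and the square of spin a is 2 |a| spin a. *)
Lemma spin_insert a b (t : R) :
  spin a * spin ((1 - t) *: a + t *: b) * spin b
  = ((1 - t) * nrm a + t * nrm b + nrm ((1 - t) *: a + t *: b))%:C%C *: (spin a * spin b).
Proof.
set v := (1 - t) *: a + t *: b.
have -> : spin v = ((1 - t)%:C)%C *: spin a + (t%:C)%C *: spin b
    + ((nrm v - (1 - t) * nrm a - t * nrm b)%:C)%C *: 1.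
  apply: mx2P; rewrite !mxE /= /v !cE; apply/eqP; rewrite eq_complex /=;
    by apply/andP; split; apply/eqP; ring.
have sq c : spin c * spin c = (2 * nrm c)%:C%C *: spin c.
  have := spin_sandwich c 1; rewrite mulr1 => ->; congr (_ *: _).
  by rewrite tr2E !mxE /=; apply/eqP; rewrite eq_complex /=; apply/andP; split; apply/eqP; ring.
rewrite !mulrDr !mulrDl -!scalerAr mulr1 -!scalerAl sq -scalerAl -mulrA sq -!scalerAr.
rewrite !scalerA -!scalerDl; congr (_ *: _).
have sc (k y : R) : k *: (y : R^o) = k * y by [].
rewrite !sc; apply/eqP; rewrite eq_complex /=; apply/andP; split; apply/eqP; ring.
Qed.

(** Its argument is half the solid angle of the polygon P seen from x. *)
Definition solid (P : polygon R) x : R[i] := \tr (\prod_(v <- P) spin (v - x)).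

Lemma spin_tr a : (spin a)^T = map_mx (fun z => z^*%C) (spin a).
Proof.
apply: mx2P; rewrite !mxE /=; apply/eqP; rewrite eq_complex /=;
  by apply/andP; split; apply/eqP; ring.
Qed.

Lemma solid_rev P x : solid (rev P) x = (solid P x)^*%C.
Proof.
rewrite /solid -trace_map_mx -mxtrace_tr; congr (\tr _).
elim: P => [|v P IHP]; first by rewrite /rev /= !big_nil map_mx1 trmx1.
rewrite rev_cons -cats1 big_cat big_seq1 big_cons /= [LHS]trmx_mul IHP.
by rewrite spin_tr map_mxM.
Qed.

Lemma solid_rot k P x : solid (rot k P) x = solid P x.
Proof.
rewrite /solid /rot big_cat -{3}(cat_take_drop k P) big_cat /=.
by rewrite mxtrace_mulC.
Qed.

End Spin.

(** * Linking numbers of closed polygons *)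

Section Curves.
Variable R : realType.
Local Notation Re := (@complex.Re R).
Local Notation Im := (@complex.Im R).
Implicit Types (P Q : polygon R) (x : space R).

(** Loops whose values can be joined by segments avoiding 0 are homotopic. *)
Lemma winding_lerp (f g : R -> R[i]) : is_loop f -> is_loop g ->
  (forall s t, 0 <= s <= 1 -> 0 <= t <= 1 -> lerp (f s) (g s) t != 0) ->
  winding f = winding g.
Proof.
move=> [cf f0 fc] [cg g0 gc] H.
have := @winding_homotopy R (fun p => lerp (f p.2) (g p.2) p.1).
have -> : (fun s => lerp (f s) (g s) 0) = f by apply/funext => s; rewrite lerp0.
have -> : (fun s => lerp (f s) (g s) 1) = g by apply/funext => s; rewrite lerp1.
apply.
- have c2 : continuous (@snd R R) by move=> p; exact: cvg_snd.
  by apply: ccont_lerp; [exact: (ccont_comp c2 cf)|exact: (ccont_comp c2 cg)|move=> p; exact: cvg_fst].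
- by move=> [t s] [/unit_itvP /= t01 /unit_itvP /= s01]; apply: H.
- by move=> t _; rewrite fc gc.
Qed.

Lemma winding_pos_eq (f g : R -> R[i]) : is_loop f -> is_loop g ->
  (forall s, 0 <= s <= 1 -> exists2 l : R, 0 < l & g s = l%:C%C * f s) ->
  winding f = winding g.
Proof.
move=> lf lg H; apply: winding_lerp => // s t s01 /andP[t0 t1].
have [_ /(_ s s01) f0 _] := lf; have [l l0 ->] := H s s01.
have -> : lerp (f s) (l%:C%C * f s) t = ((1 - t) + t * l)%:C%C * f s.
  by case: (f s) => a b; apply/eqP; rewrite eq_complex /=; apply/andP; split; apply/eqP; ring.
rewrite mulf_neq0 // eq_complex0 /= negb_and; apply/orP; left.
have [->|tn] := eqVneq t 1; first by rewrite subrr add0r mul1r gt_eqF.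
have : 0 < 1 - t by rewrite subr_gt0 lt_neqAle tn.
have : 0 <= t * l by rewrite mulr_ge0 // ltW.
by move=> h1 h2; rewrite gt_eqF // ltr_pwDl.
Qed.

Section Continuity.
Variable T : topologicalType.

Lemma coord_cont (f : T -> space R) (j : 'I_3) : continuous f ->
  continuous (fun t => f t ord0 j).
Proof.
move=> cf t; apply: (@continuous_comp _ _ _ f (fun v : 'rV[R]_3 => v ord0 j)); first exact: cf.
exact: coord_continuous.
Qed.

Lemma nrm_cont (f : T -> space R) : continuous f -> continuous (fun t => nrm (f t)).
Proof.
move=> cf; apply: (cf_comp (h := fun t => dot (f t) (f t)) (f := @Num.sqrt R));
  last exact: sqrt_continuous.
by apply: cfD; first apply: cfD; apply: cfM; exact: coord_cont.
Qed.

Lemma dot_cont (f g : T -> space R) : continuous f -> continuous g ->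
  continuous (fun t => dot (f t) (g t)).
Proof.
by move=> cf cg; apply: cfD; first apply: cfD; apply: cfM; exact: coord_cont.
Qed.

Lemma subv_cont (f g : T -> space R) : continuous f -> continuous g ->
  continuous (fun t => f t - g t).
Proof. by move=> cf cg t; apply: continuousB; [exact: cf|exact: cg]. Qed.

Lemma addv_cont (f g : T -> space R) : continuous f -> continuous g ->
  continuous (fun t => f t + g t).
Proof. by move=> cf cg t; apply: continuousD; [exact: cf|exact: cg]. Qed.

Lemma scalev_cont (k : T -> R) (f : T -> space R) : continuous k -> continuous f ->
  continuous (fun t => k t *: f t).
Proof. by move=> ck cf t; apply: continuousZ; [exact: ck|exact: cf]. Qed.

Definition mcont (A : T -> 'M[R[i]]_2) : Prop := forall i j, ccont (fun t => A t i j).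

Lemma mcontM (A B : T -> 'M[R[i]]_2) : mcont A -> mcont B -> mcont (fun t => A t * B t).
Proof.
move=> cA cB i j.
have -> : (fun t => (A t * B t) i j)
    = (fun t => A t i 0 * B t 0 j + A t i 1 * B t 1 j).
  by apply/funext => t; rewrite mul2E.
by apply: ccontD; apply: ccontM; by [apply: cA|apply: cB].
Qed.

Lemma mcont_spin (f : T -> space R) : continuous f -> mcont (fun t => spin (f t)).
Proof.
move=> cf i j.
have cc k : continuous (fun t => f t ord0 k) by exact: coord_cont.
have cn := nrm_cont cf.
pattern i; apply: ord2P; pattern j; apply: ord2P.
all: split; [set F := Re \o _|set F := Im \o _].
- have -> : F = (fun t => nrm (f t) + cz (f t)) by apply/funext => t; rewrite /F /= mxE.
  by apply: cfD => //; exact: cc.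
- have -> : F = (fun=> 0) by apply/funext => t; rewrite /F /= mxE.
  exact: cf_cst.
- have -> : F = (fun t => cx (f t)) by apply/funext => t; rewrite /F /= mxE.
  exact: cc.
- have -> : F = (fun t => - cy (f t)) by apply/funext => t; rewrite /F /= mxE.
  by apply: cfN; exact: cc.
- have -> : F = (fun t => cx (f t)) by apply/funext => t; rewrite /F /= mxE.
  exact: cc.
- have -> : F = (fun t => cy (f t)) by apply/funext => t; rewrite /F /= mxE.
  exact: cc.
- have -> : F = (fun t => nrm (f t) - cz (f t)) by apply/funext => t; rewrite /F /= mxE.
  by apply: cfB => //; exact: cc.
- have -> : F = (fun=> 0) by apply/funext => t; rewrite /F /= mxE.
  exact: cf_cst.
Qed.

Lemma solid_cont (I : Type) (s : seq I) (v : I -> T -> space R) (x : T -> space R) :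
  (forall i, continuous (v i)) -> continuous x ->
  ccont (fun t => solid [seq v i t | i <- s] (x t)).
Proof.
move=> cv cx.
have cp : mcont (fun t => \prod_(i <- s) spin (v i t - x t)).
  elim: s => [|i s IHs].
    have -> : (fun t => \prod_(i <- [::]) spin (v i t - x t)) = (fun=> 1).
      by apply/funext => t; rewrite big_nil.
    by move=> i j; exact: ccont_cst.
  have -> : (fun t => \prod_(i <- i :: s) spin (v i t - x t))
     = (fun t => spin (v i t - x t) * \prod_(i <- s) spin (v i t - x t)).
    by apply/funext => t; rewrite big_cons.
  by apply: mcontM => //; apply: mcont_spin; apply: subv_cont.
have -> : (fun t => solid [seq v i t | i <- s] (x t))
    = (fun t => (\prod_(i <- s) spin (v i t - x t)) 0 0 + (\prod_(i <- s) spin (v i t - x t)) 1 1).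
  by apply/funext => t; rewrite /solid big_map tr2E.
exact: ccontD.
Qed.

End Continuity.

Lemma cycle_nth (e : rel (space R)) (s : seq (space R)) : (0 < size s)%N ->
  (forall k, (k < size s)%N -> e s`_k s`_(k.+1 %% size s)) -> path.cycle e s.
Proof.
case: s => [//|a s] _ H; apply/(pathP 0) => i; rewrite size_rcons ltnS => iN.
have := H i; rewrite /= ltnS => /(_ iN).
rewrite nth_rcons -rcons_cons nth_rcons /= ltnS iN.
case: ltnP => [lt|ge]; first by rewrite modn_small.
have -> : i = size s by apply/eqP; rewrite eqn_leq iN ge.
by rewrite modnn eqxx.
Qed.

Lemma edge_point0 P k : edge_point P k 0 = vertex P k.
Proof. by rewrite /edge_point subr0 scale1r scale0r addr0. Qed.

Lemma edge_point1 P k : edge_point P k 1 = vertex P k.+1.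
Proof. by rewrite /edge_point subrr scale1r scale0r add0r. Qed.

Lemma vertex_mod P k : vertex P (k %% size P) = vertex P k.
Proof. by rewrite /vertex modn_mod. Qed.

Lemma edge_carrier P k (t : R) : (k < size P)%N -> 0 <= t <= 1 ->
  carrier P (edge_point P k t).
Proof.
move=> kP /andP[t0]; rewrite le_eqVlt => /predU1P[->|t1]; last first.
  by exists k, t; rewrite t0 t1.
exists (k.+1 %% size P)%N, 0; rewrite ltn_pmod ?lexx ?ltr01 //; last by case: size kP.
split=> //; rewrite edge_point1 edge_point0 vertex_mod //.
Qed.

(** Otherwise x would lie on the edge. *)
Lemma edge_visible P k x : (k < size P)%N -> ~ carrier P x ->
  visible (vertex P k - x) (vertex P k.+1 - x).
Proof.
move=> kP nx; have [//|[t t01 E]] := visibleP (vertex P k - x) (vertex P k.+1 - x).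
case: nx; have -> : x = edge_point P k t; last exact: edge_carrier.
apply/esym/eqP; rewrite -subr_eq0 -E /edge_point; apply/eqP.
by apply: space_eqP; rewrite !cE; ring.
Qed.

Lemma solid_neq0 P x : (0 < size P)%N -> ~ carrier P x -> solid P x != 0.
Proof.
move=> P0 nx; rewrite /solid -(big_map (fun v => v - x) xpredT (@spin R)).
apply: spin_cycle_neq0; first by rewrite -size_eq0 size_map -lt0n.
apply: cycle_nth; rewrite size_map // => k kP.
rewrite (nth_map 0) // (nth_map 0) ?ltn_pmod //.
by have := edge_visible kP nx; rewrite /vertex modn_small.
Qed.

Definition clamp (y : R) : R := Num.max 0 (Num.min y 1).

Lemma clamp_cont : continuous clamp.
Proof.
move=> y; apply: (continuous_max (f := fun=> 0) (g := fun y : R => Num.min y 1)); first exact: cvg_cst.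
by apply: (continuous_min (f := id) (g := fun=> 1)); [exact: cvg_id|exact: cvg_cst].
Qed.

Lemma clamp_id y : 0 <= y <= 1 -> clamp y = y.
Proof. by move=> /andP[y0 y1]; rewrite /clamp min_l // max_r. Qed.

Lemma clamp_le0 y : y <= 0 -> clamp y = 0.
Proof. by move=> y0; rewrite /clamp min_l ?max_l // (le_trans y0). Qed.

Lemma clamp_ge1 y : 1 <= y -> clamp y = 1.
Proof. by move=> y1; rewrite /clamp min_r // max_r. Qed.

Lemma clamp_itv y : 0 <= clamp y <= 1.
Proof. by rewrite /clamp le_max lexx /= ge_max ler01 ge_min lexx orbT. Qed.

(** The clamped parameters of all edges before s are 1 and those of all edges
after s are 0, so that the sum is the broken line through the vertices of P; in
this form continuity requires no gluing. *)
Definition curve P (s : R) : space R :=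
  vertex P 0 + \sum_(0 <= k < size P) clamp (s - k%:R) *: (vertex P k.+1 - vertex P k).

Lemma curve_cont P : continuous (curve P).
Proof.
apply: addv_cont; first by move=> x; exact: cvg_cst.
elim: (index_iota 0 (size P)) => [|k r IHr].
  have -> : (fun s : R => \sum_(k <- [::]) clamp (s - k%:R) *: (vertex P k.+1 - vertex P k)) = (fun=> 0).
    by apply/funext => s; rewrite big_nil.
  by move=> s; exact: cvg_cst.
have -> : (fun s : R => \sum_(k <- k :: r) clamp (s - k%:R) *: (vertex P k.+1 - vertex P k))
   = (fun s : R => clamp (s - k%:R) *: (vertex P k.+1 - vertex P k)
       + \sum_(k <- r) clamp (s - k%:R) *: (vertex P k.+1 - vertex P k)).
  by apply/funext => s; rewrite big_cons.
apply: addv_cont => //; apply: scalev_cont; last by move=> s; exact: cvg_cst.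
apply: cf_comp; last exact: clamp_cont.
by apply: cfB; [move=> s; exact: cvg_id|exact: cf_cst].
Qed.

Lemma curveE P k (t : R) : (k < size P)%N -> 0 <= t <= 1 ->
  curve P (k%:R + t) = edge_point P k t.
Proof.
move=> kP t01; have /andP[t0 t1] := t01.
rewrite /curve (big_cat_nat _ (n := k)) //=; last exact: ltnW.
rewrite (eq_big_nat _ _ (F2 := fun i => vertex P i.+1 - vertex P i)); last first.
  move=> i /andP[_ ik]; rewrite clamp_ge1 ?scale1r //.
  have : i.+1%:R <= k%:R :> R by rewrite ler_nat.
  by rewrite -natr1; lra.
rewrite telescope_sumr // big_ltn // (_ : k%:R + t - k%:R = t); last by ring.
rewrite clamp_id // big1_seq ?addr0; last first.
  move=> i; rewrite mem_index_iota => /andP[_ /andP[ki _]].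
  rewrite clamp_le0 ?scale0r //.
  have : k.+1%:R <= i%:R :> R by rewrite ler_nat.
  by rewrite -natr1; lra.
by rewrite /edge_point; apply: space_eqP; rewrite !cE; ring.
Qed.

Definition loop P (s : R) : space R := curve P ((size P)%:R * s).

Lemma loop_cont P : continuous (loop P).
Proof.
have c : continuous (fun s : R => (size P)%:R * s).
  by apply: cfM; [exact: cf_cst|move=> s; exact: cvg_id].
by move=> s; apply: (@continuous_comp _ _ _ (fun s : R => (size P)%:R * s) (curve P)); [exact: c|exact: curve_cont].
Qed.

Lemma loopE P k (t : R) : (k < size P)%N -> 0 <= t <= 1 ->
  loop P ((k%:R + t) / (size P)%:R) = edge_point P k t.
Proof.
move=> kP t01; rewrite /loop mulrC divfK ?curveE // pnatr_eq0.
by case: size kP.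
Qed.

Lemma loop_param (n : nat) (s : R) : (0 < n)%N -> 0 <= s < 1 ->
  exists k (t : R), [/\ (k < n)%N, 0 <= t < 1 & s = (k%:R + t) / n%:R].
Proof.
move=> n0 /andP[s0 s1]; have n0' : 0 < n%:R :> R by rewrite ltr0n.
have ns : 0 <= n%:R * s by rewrite mulr_ge0 // ltW.
have /andP[h1 h2] := truncn_itv ns.
exists (Num.truncn (n%:R * s)), (n%:R * s - (Num.truncn (n%:R * s))%:R); split.
- rewrite -(ltr_nat R); apply: (le_lt_trans h1).
  by rewrite gtr_pMr.
- by rewrite subr_ge0 h1 /= ltrBlDl natr1.
- by rewrite addrCA subrr addr0 mulrC mulKf // gt_eqF.
Qed.

Lemma loop_closed P : (0 < size P)%N -> loop P 0 = loop P 1.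
Proof.
move=> P0; have -> : 0 = (0%:R + 0) / (size P)%:R :> R by rewrite addr0 mul0r.
rewrite loopE // ?lexx ?ler01 //.
have -> : 1 = ((size P).-1%:R + 1) / (size P)%:R :> R.
  by rewrite natr1 prednK // divff // pnatr_eq0 -lt0n.
rewrite loopE ?prednK // ?lexx ?ler01 //.
by rewrite edge_point0 edge_point1 prednK // /vertex modnn mod0n.
Qed.

Lemma loop_carrier P s : (0 < size P)%N -> 0 <= s <= 1 -> carrier P (loop P s).
Proof.
move=> P0 /andP[s0]; rewrite le_eqVlt => /predU1P[->|s1].
  rewrite -loop_closed //; have -> : 0 = (0%:R + 0) / (size P)%:R :> R by rewrite addr0 mul0r.
  by rewrite loopE // ?lexx ?ler01 //; apply: edge_carrier; rewrite ?lexx ?ler01.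
have [|k [t [kP t01 ->]]] := @loop_param (size P) s P0; first by rewrite s0 s1.
have t01' : 0 <= t <= 1 by case/andP: t01 => -> /ltW.
by rewrite loopE //; apply: edge_carrier.
Qed.

Lemma carrier_loop P x : carrier P x -> exists2 s, 0 <= s < 1 & x = loop P s.
Proof.
move=> [k [t [kP /andP[t0 t1] ->]]]; have P0 : (0 < size P)%N by case: size kP.
exists ((k%:R + t) / (size P)%:R); last by rewrite loopE // t0 ltW.
rewrite divr_ge0 ?addr_ge0 //= ltr_pdivrMr ?ltr0n // mul1r.
apply: (@lt_le_trans _ _ (k%:R + 1)); first by rewrite ltrD2l.
by rewrite natr1 ler_nat.
Qed.

Definition apart P Q : Prop := forall x, carrier P x -> ~ carrier Q x.

Lemma apartC P Q : apart P Q -> apart Q P.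
Proof. by move=> PQ x Qx Px; apply: (PQ x). Qed.

(** Gauss: the number of times the solid angle of P grows by 4 pi along Q. *)
Definition lk P Q : int := winding (fun s => solid P (loop Q s)).

Lemma solid_loop_cont (T : topologicalType) P (x : T -> space R) : continuous x ->
  ccont (fun t => solid P (x t)).
Proof.
move=> cx; have := @solid_cont T nat (iota 0 (size P)) (fun i _ => P`_i) x.
rewrite -/(mkseq _ _) mkseq_nth; apply => // i t; exact: cvg_cst.
Qed.

Lemma is_loop_solid P (b : R -> space R) : (0 < size P)%N -> continuous b ->
  b 0 = b 1 -> (forall s, 0 <= s <= 1 -> ~ carrier P (b s)) ->
  is_loop (fun s => solid P (b s)).
Proof.
move=> P0 cb bc nb; split; [exact: solid_loop_cont| |by rewrite bc].
by move=> s s01; apply: solid_neq0 => //; exact: nb.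
Qed.

Definition inscribed (N : nat) (a : R -> space R) : polygon R :=
  [seq a (k%:R / N%:R) | k <- iota 0 N].

Definition unit_cube : set ((R * R) * R) := @unit_sq R `*` @unit_itv R.

(** By compactness the moving curves A and B have positive distance, and a mesh
so fine that neighbouring points of A are not opposite as seen from B serves
for all times at once. *)
Lemma inscribed_visible (A B : R * R -> space R) : continuous A -> continuous B ->
  (forall t, 0 <= t <= 1 -> A (t, 0) = A (t, 1)) ->
  (forall t s s', 0 <= t <= 1 -> 0 <= s <= 1 -> 0 <= s' <= 1 -> A (t, s) <> B (t, s')) ->
  \forall N \near \oo, forall t s', 0 <= t <= 1 -> 0 <= s' <= 1 ->
    solid (inscribed N (fun s => A (t, s))) (B (t, s')) != 0.
Proof.
move=> cA cB Ac AB.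
pose d (p : (R * R) * R) := A p.1 - B (p.1.1, p.2).
have cd : continuous d.
  apply: subv_cont.
    by move=> p; apply: (@continuous_comp _ _ _ fst A); [exact: cvg_fst|exact: cA].
  move=> p; apply: (@continuous_comp _ _ _ (fun p : (R * R) * R => (p.1.1, p.2)) B); last exact: cB.
  apply: (@cvg_pair _ _ _ (nbhs p) (nbhs p.1.1) (nbhs p.2) _ _ _ (fun p => p.1.1) snd); last exact: cvg_snd.
  by apply: (@continuous_comp _ _ _ fst fst); exact: cvg_fst.
have cc : compact unit_cube by apply: compact_setX; [exact: compact_unit_sq|exact: segment_compact].
have [||e e0 H] := @compact_diag_pos R _ unit_cube
   (fun pq => nrm (d pq.1) * nrm (d pq.2) + dot (d pq.1) (d pq.2)) cc.
- have c1 : continuous (fun pq : ((R * R) * R) * ((R * R) * R) => d pq.1).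
    by move=> p; apply: (@continuous_comp _ _ _ fst d); [exact: cvg_fst|exact: cd].
  have c2 : continuous (fun pq : ((R * R) * R) * ((R * R) * R) => d pq.2).
    by move=> p; apply: (@continuous_comp _ _ _ snd d); [exact: cvg_snd|exact: cd].
  exact: (cfD (cfM (nrm_cont c1) (nrm_cont c2)) (dot_cont c1 c2)).
- move=> [[t s] s'] [[/unit_itvP /= t01 /unit_itvP /= s01] /unit_itvP /= s'01].
  rewrite /= nrm_sqr; have := dot_ge0 (d (t, s, s')).
  rewrite le_eqVlt => /predU1P[/esym/dot_eq0/eqP|]; last by lra.
  by rewrite /d subr_eq0 => /eqP /AB; case.
near=> N => t s' t01 s'01.
have N0 : (0 < N)%N by near: N; exists 1%N.
have Ne : N%:R^-1 < e.
  rewrite invf_plt ?posrE // ?ltr0n //.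
  by near: N; apply: nbhs_infty_gtr.
rewrite /solid /inscribed big_map.
rewrite -(big_map (fun k => A (t, k%:R / N%:R) - B (t, s')) xpredT (@spin R)).
apply: spin_cycle_neq0; first by rewrite -size_eq0 size_map size_iota -lt0n.
apply: cycle_nth; rewrite size_map size_iota // => k kN.
rewrite !(nth_map 0%N) ?size_iota ?ltn_pmod // !nth_iota ?ltn_pmod // !add0n.
have -> : A (t, (k.+1 %% N)%:R / N%:R) = A (t, k.+1%:R / N%:R).
  move: kN; rewrite leq_eqVlt => /predU1P[->|kN]; last by rewrite modn_small.
  by rewrite modnn mul0r divff ?Ac // pnatr_eq0 -lt0n.
have k01 := @grid_itv R N k (ltnW kN).
apply: (H (t, k%:R / N%:R, s') (t, k.+1%:R / N%:R, s')).
  by split; [split|]; apply/unit_itvP.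
split; [split|] => /=; rewrite /ball /= ?subrr ?normr0 //.
exact: le_lt_trans (grid_step _ _ _) Ne.
Unshelve. all: by end_near. Qed.

(** The inscribed polygon with a fixed number of vertices moves continuously with
the time, even when the moving curve is not a polygon. *)
Lemma inscribed_homotopy (A B : R * R -> space R) : continuous A -> continuous B ->
  (forall t, 0 <= t <= 1 -> A (t, 0) = A (t, 1)) ->
  (forall t, 0 <= t <= 1 -> B (t, 0) = B (t, 1)) ->
  (forall t s s', 0 <= t <= 1 -> 0 <= s <= 1 -> 0 <= s' <= 1 -> A (t, s) <> B (t, s')) ->
  \forall N \near \oo,
    winding (fun s' => solid (inscribed N (fun s => A (0, s))) (B (0, s')))
    = winding (fun s' => solid (inscribed N (fun s => A (1, s))) (B (1, s'))).
Proof.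
move=> cA cB Ac Bc AB; near=> N.
have V : forall t s', 0 <= t <= 1 -> 0 <= s' <= 1 ->
    solid (inscribed N (fun s => A (t, s))) (B (t, s')) != 0.
  by near: N; exact: inscribed_visible.
have cAk k : continuous (fun p : R * R => A (p.1, k%:R / N%:R)).
  have c : continuous (fun p : R * R => (p.1, k%:R / N%:R : R)).
    by apply: cf_pair; [exact: cf_fst|move=> p; exact: cvg_cst].
  by apply: (cf_comp c).
apply: (@winding_homotopy R (fun p => solid (inscribed N (fun s => A (p.1, s))) (B p))).
- by apply: (@solid_cont _ nat (iota 0 N) (fun k p => A (p.1, k%:R / N%:R)) B).
- by move=> [t s] [/unit_itvP /= t01 /unit_itvP /= s01]; apply: V.
- by move=> t t01 /=; rewrite Bc.
Unshelve. all: by end_near. Qed.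

End Curves.

(** * Subdivision of polygons *)

Section Subdivision.
Variable R : realType.
Implicit Types (P Q : polygon R) (a b x : space R).

Lemma spin_subdivide a b (M j : nat) : (j < M)%N ->
  (forall m, (m < M)%N -> 0 < nrm ((1 - m%:R / M%:R) *: a + (m%:R / M%:R) *: b)) ->
  exists2 l : R, 0 < l &
    \prod_(j <= m < M) spin ((1 - m%:R / M%:R) *: a + (m%:R / M%:R) *: b) * spin b
    = l%:C%C *: (spin ((1 - j%:R / M%:R) *: a + (j%:R / M%:R) *: b) * spin b).
Proof.
move=> + E0; set E := fun m : nat => (1 - m%:R / M%:R) *: a + (m%:R / M%:R) *: b.
have [d] := ubnP (M - j)%N; elim: d j => // d IHd j jd jM.
have [jM1|jM1] := eqVneq j.+1 M.
  by exists 1 => //; rewrite -jM1 big_nat1 scale1r.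
have j1M : (j.+1 < M)%N by rewrite ltn_neqAle jM1.
have [|l l0 IH] := IHd j.+1 _ j1M; first by lia.
rewrite big_ltn // -mulrA IH -scalerAr mulrA.
have M0 : M%:R != 0 :> R by rewrite pnatr_eq0 -lt0n; lia.
have Mj0 : M%:R - j%:R != 0 :> R by rewrite subr_eq0 eqr_nat; lia.
have Mj : 0 < M%:R - j%:R :> R by rewrite subr_gt0 ltr_nat.
pose t : R := (M%:R - j%:R)^-1.
have t01 : 0 <= t <= 1.
  by rewrite invr_ge0 ltW //= invf_le1 // lerBrDr -[1]/(1%:R) -natrD ler_nat.
have -> : (1 - j.+1%:R / M%:R) *: a + (j.+1%:R / M%:R) *: b = (1 - t) *: E j + t *: b.
  by apply: space_eqP; rewrite !cE -natr1 /t; field; rewrite M0 Mj0.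
rewrite spin_insert scalerA; set c : R := (1 - t) * _ + t * nrm b + _.
exists (l * c); last by rewrite rmorphM.
rewrite mulr_gt0 //; apply: ltr_wpDl.
  by case/andP: t01 => t0 t1; rewrite addr_ge0 // mulr_ge0 ?nrm_ge0 ?subr_ge0.
have := E0 j.+1 j1M; congr (0 < nrm _).
by apply: space_eqP; rewrite !cE -natr1 /t; field; rewrite M0 Mj0.
Qed.

Lemma nrm_gt0 a : a != 0 -> 0 < nrm a.
Proof. by move=> a0; rewrite lt_neqAle nrm_ge0 andbT eq_sym; apply: contra_neq a0 => /nrm_eq0. Qed.

(** The product of the spin matrices along a subdivided edge, followed by the
matrix of its end point, is a positive multiple of the product for the edge
itself, by repeated insertion.  Since the polygon is closed, the end point of
the last edge is supplied by the first vertex. *)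
Lemma solid_subdivide P (M : nat) x : (0 < size P)%N -> (0 < M)%N -> ~ carrier P x ->
  exists2 l : R, 0 < l & solid (inscribed (size P * M) (loop P)) x = l%:C%C * solid P x.
Proof.
move=> P0 M0 nx; set n := size P.
pose v k := vertex P k - x.
pose B k := \prod_(0 <= m < M) spin ((1 - m%:R / M%:R) *: v k + (m%:R / M%:R) *: v k.+1).
have ME m : (m < M)%N -> 0 <= (m%:R / M%:R : R) <= 1 by move=> mM; apply: grid_itv; exact: ltnW.
have nz k m : (k < n)%N -> (m < M)%N ->
    0 < nrm ((1 - m%:R / M%:R) *: v k + (m%:R / M%:R) *: v k.+1).
  move=> kn mM; apply: nrm_gt0; apply/eqP => E; apply: nx.
  have -> : x = edge_point P k (m%:R / M%:R); last by apply: edge_carrier => //; exact: ME.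
  apply/esym/eqP; rewrite -subr_eq0 -E /edge_point /v; apply/eqP.
  by apply: space_eqP; rewrite !cE; ring.
have Bk k : (k < n)%N -> exists2 l : R, 0 < l & B k * spin (v k.+1) = l%:C%C *: (spin (v k) * spin (v k.+1)).
  move=> kn; have [l l0 H] := spin_subdivide M0 (nz k ^~ kn).
  by exists l => //; rewrite /B H mul0r subr0 scale1r scale0r addr0.
have W k : (k <= n)%N -> exists2 l : R, 0 < l &
    \prod_(k <= i < n) B i * spin (v n) = l%:C%C *: (\prod_(k <= i < n) spin (v i) * spin (v n)).
  have [d] := ubnP (n - k)%N; elim: d k => // d IHd k kd.
  rewrite leq_eqVlt => /predU1P[->|kn].
    by exists 1 => //; rewrite !big_geq // scale1r.
  have [|l l0 IH] := IHd k.+1 _ kn; first by lia.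
  have [l' l'0 Bk'] := Bk k kn.
  have [r rE] : exists r, \prod_(k.+1 <= i < n) spin (v i) * spin (v n) = spin (v k.+1) * r.
    move: kn; rewrite leq_eqVlt => /predU1P[->|kn].
      by exists 1; rewrite big_geq // mul1r mulr1.
    by rewrite big_ltn // -mulrA; eexists.
  exists (l * l'); first exact: mulr_gt0.
  have e : B k * (spin (v k.+1) * r) = l'%:C%C *: (spin (v k) * (spin (v k.+1) * r)).
    by rewrite mulrA Bk' -scalerAl mulrA.
  rewrite [in LHS]big_ltn // [in RHS]big_ltn // -mulrA IH -[in RHS]mulrA rE -scalerAr e scalerA.
  by rewrite rmorphM.
have [l l0 H] := W 0%N (leq0n n).
exists l => //.
have vn : v n = v 0%N by rewrite /v -vertex_mod modnn.
have v0 : 0 < nrm (v 0%N).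
  by have := nz 0%N 0%N P0 M0; rewrite mul0r subr0 scale1r scale0r addr0.
(* the nonzero rank-one factor [spin (v 0)] can be split off from both ends of the product *)
have trE (X Y : 'M[R[i]]_2) : spin (v 0%N) * X * spin (v 0%N) = l%:C%C *: (spin (v 0%N) * Y * spin (v 0%N)) ->
    \tr (spin (v 0%N) * X) = l%:C%C * \tr (spin (v 0%N) * Y).
  rewrite !spin_sandwich scalerA => /eqP; rewrite -subr_eq0 -scalerBl scaler_eq0.
  by rewrite (negPf (spin_neq0 v0)) orbF subr_eq0 => /eqP.
have -> : solid (inscribed (n * M) (loop P)) x = \tr (\prod_(0 <= k < n) B k).
  rewrite /solid /inscribed big_map (_ : iota 0 (n * M) = index_iota 0 (n * M)); last by rewrite /index_iota subn0.
  rewrite big_nat_mul; congr (\tr _); apply: eq_big_nat => k /andP[_ kn].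
  rewrite -{1}[(k * M)%N]add0n big_addn mulSn addnK; apply: eq_big_nat => m /andP[_ mM].
  congr spin; rewrite /v.
  have -> : (m + k * M)%:R / (n * M)%:R = (k%:R + m%:R / M%:R) / n%:R :> R.
    rewrite natrD !natrM; field.
    by rewrite !pnatr_eq0 -!lt0n M0 P0.
  rewrite loopE ?ME // /edge_point.
  by apply: space_eqP; rewrite !cE; ring.
have -> : solid P x = \tr (\prod_(0 <= k < n) spin (v k)).
  rewrite /solid (big_nth 0); congr (\tr _); apply: eq_big_nat => k /andP[_ kn].
  by rewrite /v /vertex modn_small.
have eB : \prod_(0 <= k < n) B k = spin (v 0%N) * (\prod_(1 <= m < M)
    spin ((1 - m%:R / M%:R) *: v 0%N + (m%:R / M%:R) *: v 1%N) * \prod_(1 <= k < n) B k).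
  by rewrite big_ltn // {1}/B big_ltn // mul0r subr0 scale1r scale0r addr0 mulrA.
have eV : \prod_(0 <= k < n) spin (v k) = spin (v 0%N) * \prod_(1 <= k < n) spin (v k).
  by rewrite big_ltn.
by move: H; rewrite vn eB eV; exact: trE.
Qed.

End Subdivision.

(** * Reparametrisation of simple closed curves *)

Section Reparam.
Variable R : realType.
Implicit Types (P Q : polygon R).

Lemma within_comp (T U V : topologicalType) (A : set U) (f : U -> V) (g : T -> U) :
  {within A, continuous f} -> continuous g -> (forall x, A (g x)) ->
  continuous (fun x => f (g x)).
Proof.
move=> /subspace_continuousP cf cg Ag x V0 fV.
have W : nbhs (g x) [set y | A y -> V0 (f y)] := cf (g x) (Ag x) V0 fV.
change (nbhs x ((fun y => f (g y)) @^-1` V0)).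
by apply: (@filterS T (nbhs x) _ (g @^-1` [set y | A y -> V0 (f y)]) _ _ (cg x _ W)) => y h; exact: (h (Ag y)).
Qed.

Definition orient (b : bool) (s : R) : R := if b then s else 1 - s.

Lemma orient_itv b s : 0 <= s <= 1 -> 0 <= orient b s <= 1.
Proof. by rewrite /orient; case: b => // /andP[s0 s1]; rewrite subr_ge0 s1 gerBl. Qed.

Lemma orient_cont b : continuous (orient b).
Proof.
case: b; first exact: cf_id.
by apply: cfB; [exact: cf_cst|exact: cf_id].
Qed.

(** A closed curve run twice, so that a full period starting at any parameter
in [0, 1] is an interval. *)
Definition twice (g : R -> space R) (x : R) : space R :=
  g (clamp x) + g (clamp (x - 1)) - g 0.

Lemma twice_cont g : continuous g -> continuous (twice g).
Proof.
move=> cg; have c1 : continuous (fun x : R => clamp (x - 1)).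
  apply: cf_comp; last exact: clamp_cont.
  by apply: cfB; [exact: cf_id|exact: cf_cst].
apply: subv_cont; last by move=> x; exact: cvg_cst.
by apply: addv_cont; [apply: (cf_comp (@clamp_cont R))|apply: (cf_comp c1)].
Qed.

Lemma twice_lo g x : 0 <= x <= 1 -> twice g x = g x.
Proof.
move=> x01; rewrite /twice clamp_id // clamp_le0 ?addrK //.
by case/andP: x01 => _; rewrite subr_le0.
Qed.

Lemma twice_hi g x : g 0 = g 1 -> 0 <= x <= 1 -> twice g (x + 1) = g x.
Proof.
move=> gc x01; rewrite /twice clamp_ge1; last by case/andP: x01 => x0 _; rewrite lerDr.
by rewrite addrK clamp_id // -gc [g 0 + _]addrC addrK.
Qed.

(** Let t0 be the parameter at which g passes through the base point of a, and
let h s be the parameter in the period from t0 to t0 + 1 at which g passes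
through a s.  By compactness h is continuous inside the unit interval, and it
is injective, hence monotone, and extends to the end points.  An increasing h
can be deformed linearly to the identity, a decreasing h to the reversal, and g
carries this deformation over to the curve. *)
Lemma reparam (a g : R -> space R) : continuous a -> continuous g ->
  a 0 = a 1 -> g 0 = g 1 ->
  (forall s s', 0 <= s < 1 -> 0 <= s' < 1 -> a s = a s' -> s = s') ->
  (forall s s', 0 <= s < 1 -> 0 <= s' < 1 -> g s = g s' -> s = s') ->
  (forall s, 0 <= s < 1 -> exists2 s', 0 <= s' < 1 & a s = g s') ->
  (forall s, 0 <= s < 1 -> exists2 s', 0 <= s' < 1 & g s = a s') ->
  exists b (A : R * R -> space R), [/\ continuous A,
    forall t, 0 <= t <= 1 -> A (t, 0) = A (t, 1),
    forall s, 0 <= s <= 1 -> A (0, s) = a s,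
    forall s, 0 <= s <= 1 -> A (1, s) = g (orient b s) &
    forall t s, 0 <= t <= 1 -> 0 <= s <= 1 -> exists2 s', 0 <= s' <= 1 & A (t, s) = g s'].
Proof.
move=> ca cg ac gc ainj ginj ag ga.
have [|t0 t001 at0] := ag 0; first by rewrite lexx ltr01.
have /andP[t00 t01] := t001.
set G := twice g.
have cG : continuous G by exact: twice_cont.
have Ginj x y : t0 <= x < t0 + 1 -> t0 <= y < t0 + 1 -> G x = G y -> x = y.
  have aux z : t0 <= z < t0 + 1 -> exists2 z', 0 <= z' < 1 & G z = g z' /\
      (z = z' \/ (z = z' + 1 /\ z' < t0)).
    move=> /andP[z0 z1]; have [zl|zl] := ltP z 1.
      exists z; first by rewrite zl (le_trans t00).
      by split; [apply: twice_lo; rewrite (le_trans t00) // ltW|left].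
    exists (z - 1); first by apply/andP; split; lra.
    split; last by right; split; lra.
    by rewrite -{1}[z](subrK 1) /G twice_hi //; apply/andP; split; lra.
  move=> xI yI; have [x' x'I [-> hx]] := aux x xI; have [y' y'I [-> hy]] := aux y yI.
  move=> /(ginj _ _ x'I y'I) xy; move: hx hy xI yI; rewrite xy.
  by move=> [->|[-> h]] [->|[-> h']] // /andP[h1 h2] /andP[h3 h4]; lra.
have Gsurj s : 0 <= s < 1 -> exists2 x, t0 <= x < t0 + 1 & G x = a s.
  move=> /ag[s' /andP[s'0 s'1] ->]; have [h|h] := leP t0 s'.
    exists s'; first by rewrite h (lt_le_trans s'1) // lerDr.
    by rewrite /G twice_lo // s'0 ltW.
  exists (s' + 1); first by apply/andP; split; lra.
  by rewrite /G twice_hi // s'0 ltW.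
have Gt0 : G t0 = a 0 by rewrite at0 /G twice_lo // t00 ltW.
have Gt1 : G (t0 + 1) = a 0 by rewrite at0 /G twice_hi // t00 ltW.
have hex s : exists x, 0 < s < 1 -> t0 < x < t0 + 1 /\ G x = a s.
  have [s01|] := boolP (0 < s < 1); last by exists 0.
  have /andP[s0 s1] := s01.
  have [|x /andP[x0 x1] Gx] := Gsurj s; first by rewrite ltW.
  exists x => _; split=> //; rewrite x1 andbT lt_neqAle x0 andbT.
  apply/eqP => xt; have := s0; rewrite (ainj s 0) ?ltxx // ?lexx ?ltr01 ?(ltW s0) //.
  by rewrite -Gx -xt Gt0.
pose h s := projT1 (cid (hex s)).
have hP s : 0 < s < 1 -> t0 < h s < t0 + 1 /\ G (h s) = a s.
  by rewrite /h; case: cid.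
have hinj x y : 0 < x < 1 -> 0 < y < 1 -> h x = h y -> x = y.
  move=> xI yI hxy; have [_ hx] := hP x xI; have [_ hy] := hP y yI.
  case/andP: xI => x0 x1; case/andP: yI => y0 y1.
  by apply: ainj; rewrite ?(ltW x0) ?(ltW y0) // -hx -hy hxy.
have hcont : {within [set` `]0, 1[], continuous h}.
  apply: continuous_in_subspaceT => s; rewrite inE /= in_itv /= => s01.
  have [/andP[hs0 hs1] Ghs] := hP s s01; have /andP[s0 s1] := s01.
  apply/cvgrPdist_lt => e e0.
  (* away from h s the curve g keeps a positive distance from a s *)
  pose C := `[t0, t0 + 1]%classic `&` ~` ball (h s) e.
  have cC : compact C.
    apply: (subclosed_compact _ (@segment_compact R t0 (t0 + 1))) => //.
      apply: closedI; first exact: itv_closed.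
      exact/open_closedC/ball_open.
    by move=> x [].
  have [||d d0 H] := @compact_pos_lb R _ C (fun x => nrm (G x - a s)) cC.
  - by apply: (nrm_cont (subv_cont cG _)) => x; exact: cvg_cst.
  - move=> x [/=]; rewrite in_itv /= => /andP[x0 x1] xe; apply: nrm_gt0.
    rewrite subr_eq0; apply/eqP => E; move: x1; rewrite le_eqVlt => /predU1P[xt|x1].
      have := s0; rewrite (ainj s 0) ?ltxx ?lexx ?ltr01 ?(ltW s0) //.
      by rewrite -E xt Gt1.
    by apply: xe; rewrite (Ginj x (h s)) ?x0 ?(ltW hs0) ?E //; exact: ballxx.
  near=> s'.
  have s'01 : 0 < s' < 1.
    by apply/andP; split; near: s'; [exact: lt_nbhsr|exact: lt_nbhsl].
  have [/andP[h0 h1] Gh] := hP s' s'01.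
  apply: contrapT => ns.
  have : d < nrm (G (h s') - a s).
    by apply: H; split; rewrite /= ?in_itv /= ?(ltW h0) ?(ltW h1).
  apply/negP; rewrite -leNgt Gh ltW //.
  near: s'; apply: (cvgr_lt (nrm (a s - a s))); last by rewrite subrr nrm0.
  have cn : continuous (fun t => nrm (a t - a s)).
    by apply: (nrm_cont (subv_cont ca _)) => x; exact: cvg_cst.
  exact: (cn s).
have hsurj y : t0 < y < t0 + 1 -> exists2 s, 0 < s < 1 & h s = y.
  move=> /andP[y0 y1].
  have [y' y'I Gy] : exists2 y', 0 <= y' < 1 & G y = g y'.
    have [yl|yl] := ltP y 1.
      exists y; first by rewrite yl (le_trans t00) // ltW.
      by apply: twice_lo; rewrite (le_trans t00) ltW.
    exists (y - 1); first by apply/andP; split; lra.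
    by rewrite -{1}[y](subrK 1) /G twice_hi //; apply/andP; split; lra.
  have [s /andP[s0 s1] gs] := ga y' y'I.
  have s0' : 0 < s.
    rewrite lt_neqAle s0 andbT; apply/eqP => s00; have := y0.
    by rewrite (Ginj y t0) ?ltxx ?lexx ?ltrDl ?ltr01 ?(ltW y0) // Gt0 s00 Gy.
  exists s; first by rewrite s0'.
  have [|/andP[h0 h1] Gh] := hP s; first by rewrite s0'.
  by apply: Ginj; rewrite ?(ltW h0) ?(ltW y0) // Gh Gy gs.
(* the values at 0 and 1 depend on whether h increases *)
pose hh b s := if s <= 0 then t0 + orient b 0 else if 1 <= s then t0 + orient b 1 else h s.
have hh0 b : hh b 0 = t0 + orient b 0 by rewrite /hh lexx.
have hh1 b : hh b 1 = t0 + orient b 1 by rewrite /hh lexx ler10.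
have hhI b s : 0 < s < 1 -> hh b s = h s.
  by rewrite /hh => /andP[s0 s1]; rewrite leNgt s0 leNgt s1.
have hhsurj b y : t0 <= y <= t0 + 1 -> exists2 s, 0 <= s <= 1 & hh b s = y.
  move=> /andP[y0 y1]; have [e0|n0] := eqVneq y t0.
    case: b; first by exists 0; rewrite ?lexx ?ler01 // hh0 /orient addr0.
    by exists 1; rewrite ?lexx ?ler01 // hh1 /orient subrr addr0.
  have [e1|n1] := eqVneq y (t0 + 1).
    case: b; first by exists 1; rewrite ?lexx ?ler01 // hh1 /orient.
    by exists 0; rewrite ?lexx ?ler01 // hh0 /orient subr0.
  have [|s sI hs] := hsurj y; first by rewrite !lt_neqAle eq_sym n0 n1 y0 y1.
  by exists s; [case/andP: sI => s0 s1; rewrite !ltW|rewrite hhI].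
have [b hhc] : exists b, {within `[0, 1], continuous (hh b)}.
  have := itv_continuous_inj_mono hcont.
  case=> [x y|mono|mono]; first by rewrite !in_itv /= => xI yI; exact: hinj.
    exists true; apply: segment_inc_surj_continuous.
      apply: le_mono_in => x y; rewrite !in_itv /= => /andP[x0 x1] /andP[y0 y1] xy.
      move: x0 y1 xy; rewrite le_eqVlt => /predU1P[<-|x0]; rewrite le_eqVlt => /predU1P[->|y1] xy.
      - by rewrite hh0 hh1 /orient ltrD2l ltr01.
      - have yI : 0 < y < 1 by rewrite y1 andbT; lra.
        by rewrite hh0 hhI // /orient addr0; have [/andP[]] := hP y yI.
      - have xI : 0 < x < 1 by rewrite x0 /=; lra.
        by rewrite hh1 hhI // /orient; have [/andP[]] := hP x xI.
      - have xI : 0 < x < 1 by rewrite x0 /=; lra.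
        have yI : 0 < y < 1 by rewrite y1 andbT; lra.
        by rewrite !hhI //; apply: mono; rewrite ?in_itv.
    move=> y /=; rewrite in_itv hh0 hh1 /orient addr0 => yI.
    by have [s sI hs] := hhsurj true y yI; exists s; rewrite //= in_itv.
  exists false; apply: segment_dec_surj_continuous.
    apply: le_nmono_in => x y; rewrite !in_itv /= => /andP[x0 x1] /andP[y0 y1] xy.
    move: x1 y0 xy; rewrite le_eqVlt => /predU1P[->|x1]; rewrite le_eqVlt => /predU1P[<-|y0] xy.
    - by rewrite hh0 hh1 /orient ltrD2l subr0 subrr ltr01.
    - have yI : 0 < y < 1 by rewrite y0 /=; lra.
      by rewrite hh1 hhI // /orient subrr addr0; have [/andP[]] := hP y yI.
    - have xI : 0 < x < 1 by rewrite x1 andbT; lra.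
      by rewrite hh0 hhI // /orient subr0; have [/andP[]] := hP x xI.
    - have xI : 0 < x < 1 by rewrite x1 andbT; lra.
      have yI : 0 < y < 1 by rewrite y0 /=; lra.
      by rewrite !hhI //; apply: mono; rewrite ?in_itv.
  move=> y /=; rewrite in_itv hh0 hh1 /orient subrr addr0 subr0 => yI.
  by have [s sI hs] := hhsurj false y yI; exists s; rewrite //= in_itv.
have hcc : continuous (fun s => hh b (clamp s)).
  apply: (within_comp hhc); first exact: clamp_cont.
  by move=> s /=; rewrite in_itv /=; exact: clamp_itv.
have o01 : orient b 0 = 0 /\ orient b 1 = 1 \/ orient b 0 = 1 /\ orient b 1 = 0.
  by rewrite /orient; case: b {hhc hcc}; [left|right]; rewrite ?subr0 ?subrr.
have hhR s : 0 <= s <= 1 -> t0 <= hh b s <= t0 + 1.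
  move=> /andP[]; rewrite le_eqVlt => /predU1P[<- _|s0].
    by rewrite hh0; case: o01 => -[-> _]; rewrite ?addr0 lexx ?lerDl ?ler01.
  rewrite le_eqVlt => /predU1P[->|s1].
    by rewrite hh1; case: o01 => -[_ ->]; rewrite ?addr0 lexx ?lerDl ?ler01.
  have sI : 0 < s < 1 by rewrite s0.
  by rewrite hhI //; have [/andP[h0 h1] _] := hP s sI; rewrite !ltW.
exists b, (fun p => G ((1 - p.1) * hh b (clamp p.2) + p.1 * orient b p.2)); split.
- apply: cf_comp => //; apply: cfD; apply: cfM.
  + by apply: cfB; [exact: cf_cst|exact: cf_fst].
  + exact: (cf_comp (@cf_snd _ _) hcc).
  + exact: cf_fst.
  + exact: (cf_comp (@cf_snd _ _) (@orient_cont b)).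
- move=> t /andP[tl tr] /=; rewrite !clamp_id ?lexx ?ler01 // hh0 hh1.
  have x01 : 0 <= (1 - t) * t0 <= 1.
    by apply/andP; split; [rewrite mulr_ge0 ?subr_ge0|rewrite mulr_ile1 ?subr_ge0 ?gerBl // ltW].
  have e0 : (1 - t) * (t0 + 0) + t * 0 = (1 - t) * t0 by ring.
  have e1 : (1 - t) * (t0 + 1) + t * 1 = (1 - t) * t0 + 1 by ring.
  by case: o01 => -[-> ->]; rewrite e0 e1 /G twice_hi // twice_lo.
- move=> s sI /=; rewrite subr0 mul1r mul0r addr0 clamp_id //.
  case/andP: sI; rewrite le_eqVlt => /predU1P[<- _|s0].
    by rewrite hh0; case: o01 => -[-> _]; rewrite ?addr0.
  rewrite le_eqVlt => /predU1P[->|s1].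
    by rewrite hh1 -ac; case: o01 => -[_ ->]; rewrite ?addr0.
  have sI : 0 < s < 1 by rewrite s0.
  by rewrite hhI //; case: (hP s sI).
- move=> s sI /=; rewrite subrr mul0r mul1r add0r /G twice_lo //.
  exact: orient_itv.
- move=> t s /andP[tl tr] sI /=; rewrite clamp_id //.
  have /andP[h0 h1] := hhR s sI; have /andP[q0 q1] := orient_itv b sI.
  set x := _ + _.
  have x0 : 0 <= x by rewrite /x addr_ge0 // mulr_ge0 // ?subr_ge0 // (le_trans t00).
  have x2 : x <= 2 by rewrite /x; nra.
  have [xl|xl] := leP x 1; first by exists x; rewrite ?x0 ?xl // /G twice_lo ?x0.
  exists (x - 1); first by apply/andP; split; lra.
  by rewrite -{1}[x](subrK 1) /G twice_hi //; apply/andP; split; lra.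
Unshelve. all: by end_near. Qed.

End Reparam.

(** * Isotopy invariance of the linking number *)

Section Isotopy.
Variable R : realType.
Implicit Types (P Q : polygon R).

Definition simple P : Prop := (2 < size P)%N /\
  forall k t k' t', (k < size P)%N -> (k' < size P)%N -> 0 <= t < 1 -> 0 <= t' < 1 ->
    edge_point P k t = edge_point P k' t' -> k = k' /\ t = t' :> R.

Lemma simple_loop P s s' : simple P -> 0 <= s < 1 -> 0 <= s' < 1 ->
  loop P s = loop P s' -> s = s'.
Proof.
move=> [P2 inj] sI s'I; have P0 : (0 < size P)%N by exact: ltn_trans P2.
have [k [t [kP tI ->]]] := loop_param P0 sI.
have [k' [t' [k'P t'I ->]]] := loop_param P0 s'I.
have tI' : 0 <= t <= 1 by case/andP: tI => -> /ltW.
have t'I' : 0 <= t' <= 1 by case/andP: t'I => -> /ltW.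
by rewrite !loopE // => /inj[] // -> ->.
Qed.

(** The linking number of a curve a, replaced by a polygon with N vertices, and
a curve b. *)
Definition lk_fine (N : nat) (a b : R -> space R) : int :=
  winding (fun s => solid (inscribed N a) (b s)).

Lemma lk_fineE P Q M : (0 < size P)%N -> (0 < size Q)%N -> (0 < M)%N -> apart P Q ->
  lk_fine (size P * M) (loop P) (loop Q) = lk P Q.
Proof.
move=> P0 Q0 M0 PQ.
have off s : 0 <= s <= 1 -> ~ carrier P (loop Q s).
  by move=> sI; apply: (apartC PQ); exact: loop_carrier.
have lPQ : is_loop (fun s => solid P (loop Q s)).
  by apply: is_loop_solid => //; [exact: loop_cont|exact: loop_closed].
apply/esym/winding_pos_eq => //; last first.
  by move=> s sI; apply: solid_subdivide => //; exact: off.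
split; last by rewrite loop_closed.
  by apply: solid_loop_cont; exact: loop_cont.
move=> s sI; have [l l0 ->] := solid_subdivide P0 M0 (off s sI).
rewrite mulf_neq0 ?solid_neq0 //; last exact: off.
by rewrite eq_complex0 /= gt_eqF.
Qed.

Lemma lk_fine_rev_l N a b : a 0 = a 1 -> is_loop (fun s => solid (inscribed N a) (b s)) ->
  lk_fine N (fun s => a (1 - s)) b = - lk_fine N a b.
Proof.
move=> ac lp; rewrite /lk_fine -winding_conj //; congr winding; apply/funext => s.
rewrite -solid_rev -(solid_rot 1 (inscribed N (fun s => a (1 - s)))); congr solid.
case: N {lp} => [//|N].
have nz : N.+1%:R != 0 :> R by rewrite pnatr_eq0.
apply: (@eq_from_nth _ 0); first by rewrite size_rot size_rev !size_map.
move=> i; rewrite size_rot size_map size_iota => iN.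
rewrite nth_rev ?size_map ?size_iota // (nth_map 0%N) ?size_iota; last by lia.
rewrite nth_iota; last by lia.
rewrite add0n /rot nth_cat size_drop size_map size_iota subn1 /=.
have [iN'|iN'] := ltnP i N.
  rewrite drop0 (nth_map 0%N) ?size_iota // nth_iota // add1n.
  by congr a; rewrite natrB // mulrBl divff.
have -> : i = N by lia.
by rewrite subnn take0 /= mul0r subr0 subnn mul0r ac.
Qed.

Lemma lk_fine_rev_r N a b : is_loop (fun s => solid (inscribed N a) (b s)) ->
  lk_fine N a (fun s => b (1 - s)) = - lk_fine N a b.
Proof. by move=> lp; rewrite /lk_fine -winding_rev. Qed.

Lemma eq_lk_fine N a a' b b' : (0 < N)%N ->
  (forall s, 0 <= s <= 1 -> a s = a' s) -> (forall s, 0 <= s <= 1 -> b s = b' s) ->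
  lk_fine N a b = lk_fine N a' b'.
Proof.
move=> N0 ea eb.
have ei : inscribed N a = inscribed N a'.
  rewrite /inscribed; apply/eq_in_map => k; rewrite mem_iota => /andP[_ kN].
  by apply: ea; apply: grid_itv; exact: ltnW.
rewrite /lk_fine ei.
have tE M : turns M (fun s => solid (inscribed N a') (b s)) = turns M (fun s => solid (inscribed N a') (b' s)).
  rewrite /turns; apply: eq_big_nat => k /andP[_ kM].
  by rewrite !eb //; apply: grid_itv; rewrite // ltnW.
pose F (u : nat -> int) := xget 0 [set z | \forall M \near \oo, u M = z].
rewrite -[LHS]/(F (fun M => turns M (fun s => solid (inscribed N a') (b s)))).
by congr F; apply/funext.
Qed.

(** Two homotopies are composed: the isotopy itself, which ends in curves whose
traces are the polygons P' and Q', and then the reparametrisations of these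
curves as the loops of P' and Q' with some orientation.  During each of them
the two curves stay disjoint.  The number N of inscribed vertices is a common
multiple of the sizes of P and P', so that at both ends the inscribed polygons
are subdivisions. *)
Lemma isotopy_lk P Q P' Q' (H : R -> space R -> space R) :
  simple P -> simple Q -> simple P' -> simple Q' -> apart P Q -> apart P' Q' ->
  {within `[0, 1] `*` setT, continuous (fun u : R * space R => H u.1 u.2)} ->
  (forall t, 0 <= t <= 1 -> injective (H t)) -> (forall v, H 0 v = v) ->
  H 1 @` carrier P = carrier P' -> H 1 @` carrier Q = carrier Q' ->
  `|lk P Q| = `|lk P' Q'|.
Proof.
move=> sP sQ sP' sQ' PQ PQ' cH Hinj H0 HP HQ.
have P0 : (0 < size P)%N by case: sP => h _; exact: ltn_trans h.
have Q0 : (0 < size Q)%N by case: sQ => h _; exact: ltn_trans h.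
have P'0 : (0 < size P')%N by case: sP' => h _; exact: ltn_trans h.
have Q'0 : (0 < size Q')%N by case: sQ' => h _; exact: ltn_trans h.
have z01 : 0 <= (0 : R) <= 1 by rewrite lexx ler01.
have o01 : 0 <= (1 : R) <= 1 by rewrite lexx ler01.
pose A0 (X : polygon R) := fun p : R * R => H (clamp p.1) (loop X p.2).
have cA0 X : continuous (A0 X).
  have cc : continuous (fun p : R * R => (clamp p.1, loop X p.2)).
    apply: cf_pair; first exact: (cf_comp (@cf_fst _ _) (@clamp_cont R)).
    exact: (cf_comp (@cf_snd _ _) (@loop_cont R X)).
  have Ain (p : R * R) : (`[0, 1] `*` [set: space R])%classic (clamp p.1, loop X p.2).
    by split => //=; rewrite in_itv /=; exact: clamp_itv.
  exact: (@within_comp _ _ _ _ _ _ cH cc Ain).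
have cE (t : R) : 0 <= t <= 1 -> clamp t = t by exact: clamp_id.
have rep (X X' : polygon R) : simple X -> simple X' -> H 1 @` carrier X = carrier X' ->
  exists b (A : R * R -> space R), [/\ continuous A,
    forall t, 0 <= t <= 1 -> A (t, 0) = A (t, 1),
    forall s, 0 <= s <= 1 -> A (0, s) = H 1 (loop X s),
    forall s, 0 <= s <= 1 -> A (1, s) = loop X' (orient b s) &
    forall t s, 0 <= t <= 1 -> 0 <= s <= 1 -> carrier X' (A (t, s))].
  move=> sX sX' HX.
  have X0 : (0 < size X)%N by case: sX => h _; exact: ltn_trans h.
  have X'0 : (0 < size X')%N by case: sX' => h _; exact: ltn_trans h.
  have lt01 s : 0 <= s < 1 -> 0 <= s <= (1 : R) by case/andP => -> /ltW.
  have [||||||||b [A [cA Ac A0E A1 Ag]]] := @reparam R (fun s => H 1 (loop X s)) (loop X').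
  - have := cA0 X; rewrite /A0 => c.
    have c1 : continuous (fun s : R => (1 : R, s)) by apply: cf_pair; [move=> x; exact: cvg_cst|exact: cf_id].
    have -> : (fun s => H 1 (loop X s)) = (fun s : R => A0 X (1, s)).
      by apply/funext => s; rewrite /A0 /= cE.
    exact: (cf_comp c1 c).
  - exact: loop_cont.
  - by rewrite loop_closed.
  - exact: loop_closed.
  - by move=> s s' sI s'I /(Hinj 1 o01)/simple_loop; apply.
  - by move=> s s' sI s'I /simple_loop; apply.
  - move=> s sI; have : carrier X' (H 1 (loop X s)).
      by rewrite -HX; exists (loop X s) => //; apply: loop_carrier => //; exact: lt01.
    by move=> /carrier_loop.
  - move=> s sI; have : carrier X' (loop X' s) by apply: loop_carrier => //; exact: lt01.
    rewrite -HX => -[v /carrier_loop[s' s'I ->] <-].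
    by exists s'.
  exists b, A; split => // t s tI sI.
  by have [s' s'I ->] := Ag t s tI sI; exact: loop_carrier.
have [b [A [cA Ac A0E A1 AX]]] := rep P P' sP sP' HP.
have [b' [B [cB Bc B0E B1 BX]]] := rep Q Q' sQ sQ' HQ.
have lor (X : polygon R) c : (0 < size X)%N -> loop X (orient c 0) = loop X (orient c 1).
  by move=> X0; rewrite /orient; case: c; rewrite ?subr0 ?subrr loop_closed.
have [K1 _ HK1] : \forall M \near \oo,
     lk_fine M (fun s => A0 P (0, s)) (fun s => A0 Q (0, s))
    = lk_fine M (fun s => A0 P (1, s)) (fun s => A0 Q (1, s)).
  apply: inscribed_homotopy => //.
  + by move=> t _; rewrite /A0 /= loop_closed.
  + by move=> t _; rewrite /A0 /= loop_closed.
  + move=> t s s' tI sI s'I; rewrite /A0 /= cE // => /(Hinj t tI) e.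
    by apply: (PQ (loop P s)); [exact: loop_carrier|rewrite e; exact: loop_carrier].
have [K2 _ HK2] : \forall M \near \oo,
     lk_fine M (fun s => A (0, s)) (fun s => B (0, s))
    = lk_fine M (fun s => A (1, s)) (fun s => B (1, s)).
  apply: inscribed_homotopy => //.
  by move=> t s s' tI sI s'I e; apply: (PQ' _ (AX t s tI sI)); rewrite e; exact: BX.
have [N0 [N0p KN1 KN2]] : exists N0 : nat, [/\ (0 < N0)%N, (K1 <= N0)%N & (K2 <= N0)%N].
  by exists (maxn 1 (maxn K1 K2)); rewrite !leq_max !leqnn !orbT.
have [N NE] : exists N : nat, N = (size P * (size P' * N0))%N by eexists.
have NE' : N = (size P' * (size P * N0))%N by rewrite NE mulnCA.
have Np : (0 < N)%N by rewrite NE !muln_gt0 P0 P'0.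
have NN0 : (N0 <= N)%N by rewrite NE mulnA leq_pmull // muln_gt0 P0.
have E1 := HK1 N (leq_trans KN1 NN0).
have E2 := HK2 N (leq_trans KN2 NN0).
have M'0 : (0 < size P' * N0)%N by rewrite muln_gt0 P'0.
have M0 : (0 < size P * N0)%N by rewrite muln_gt0 P0.
have A0z X s : A0 X (0, s) = loop X s.
  by rewrite /A0 /= cE ?z01 // H0.
have A0o X s : A0 X (1, s) = H 1 (loop X s).
  by rewrite /A0 /= cE ?o01.
have e1 : lk P Q = lk_fine N (fun s => A (1, s)) (fun s => B (1, s)).
  rewrite -E2 -(lk_fineE P0 Q0 M'0 PQ) -NE.
  transitivity (lk_fine N (fun s => A0 P (0, s)) (fun s => A0 Q (0, s))).
    by apply: eq_lk_fine; [exact: Np|move=> s _; rewrite A0z|move=> s _; rewrite A0z].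
  rewrite E1; apply: eq_lk_fine; first exact: Np.
    by move=> s sI; rewrite A0o A0E.
  by move=> s sI; rewrite A0o B0E.
rewrite e1 (@eq_lk_fine N _ (fun s => loop P' (orient b s)) _ (fun s => loop Q' (orient b' s)) Np A1 B1).
clear E1 E2 e1 HK1 HK2.
have lP'Q' c : is_loop (fun s => solid (inscribed N (loop P')) (loop Q' (orient c s))).
  split; last by rewrite lor.
    by apply: solid_loop_cont; apply: cf_comp; [exact: orient_cont|exact: loop_cont].
  move=> s sI; rewrite NE'.
  have off : ~ carrier P' (loop Q' (orient c s)).
    exact: (apartC PQ' (loop_carrier Q'0 (orient_itv c sI))).
  have [l l0 ->] := solid_subdivide P'0 M0 off.
  apply: mulf_neq0; last exact: solid_neq0 off.
  by rewrite eq_complex0 /= gt_eqF.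
have base : lk_fine N (loop P') (loop Q') = lk P' Q'.
  by rewrite NE'; exact: lk_fineE.
have lr c : lk_fine N (loop P') (fun s => loop Q' (orient c s)) = (if c then 1 else -1) * lk P' Q'.
  case: c; first by rewrite mul1r -base.
  by rewrite mulN1r -base; apply: lk_fine_rev_r; exact: (lP'Q' true).
have ll c u : is_loop (fun s => solid (inscribed N (loop P')) (u s)) ->
    lk_fine N (fun s => loop P' (orient c s)) u = (if c then 1 else -1) * lk_fine N (loop P') u.
  move=> lu; case: c; first exact: (esym (mul1r _)).
  by rewrite mulN1r; exact: (lk_fine_rev_l (loop_closed P'0) lu).
rewrite (ll b _ (lP'Q' b')) lr; move: (lk P' Q') => z.
by case: (b); case: (b'); rewrite ?mul1r ?mulN1r ?normrN ?opprK.
Qed.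

End Isotopy.

(** * The solid angle edge by edge *)

Section Gauge.
Variable R : realType.
Local Notation Re := (@complex.Re R).
Local Notation Im := (@complex.Im R).
Implicit Types (a b : space R) (P : polygon R).

(** This is the top left entry of [spin a].  It is positive unless a points
straight downwards. *)
Definition gauge a : R := nrm a + cz a.

(** The value to which an edge contributes when the projection onto the vertical
direction is inserted between all factors of [solid].  Its argument is half the
area of the spherical triangle spanned by a, b and the north pole. *)
Definition link_arg a b : R[i] := (spin a * spin b) 0 0.

Lemma link_argE a b : link_arg a b =
  ((gauge a * gauge b + (cx a * cx b + cy a * cy b))%R +i* (cx a * cy b - cy a * cx b)%R)%C.
Proof.
rewrite /link_arg mul2E !mxE /= /gauge; apply/eqP; rewrite eq_complex /=.
by apply/andP; split; apply/eqP; ring.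
Qed.

Definition pole : 'M[R[i]]_2 := \matrix_(i, j) ((i == 0) && (j == 0))%:R.

Lemma pole_sandwich (X : 'M[R[i]]_2) : pole * X * pole = X 0 0 *: pole.
Proof.
by apply: mx2P; rewrite [RHS]mxE !mul2E !mxE /= ?mul1r ?mul0r ?mulr0 ?mulr1 ?addr0 ?add0r ?mul0r.
Qed.

Lemma tr_pole (X : 'M[R[i]]_2) : \tr (pole * X) = X 0 0.
Proof. by rewrite tr2E !mul2E !mxE /= !mul1r !mul0r !addr0. Qed.

Lemma tr_pole_r (X : 'M[R[i]]_2) : \tr (X * pole) = X 0 0.
Proof. by rewrite tr2E !mul2E !mxE /= !mulr1 !mulr0 !addr0. Qed.

Lemma spin_pole a : spin a * pole * spin a = (gauge a)%:C%C *: spin a.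
Proof.
rewrite spin_sandwich mxtrace_mulC tr_pole mxE /=; congr (_ *: _).
Qed.

(** The sandwich spin a * pole * spin a is a positive multiple of spin a, which
allows to insert [pole] at every vertex; and pole * X * pole is a multiple of
[pole], which cuts the product into scalars. *)
Lemma gauge_product (a : nat -> space R) m :
  (\prod_(0 <= k < m.+1) (gauge (a k))%:C%C) *: \prod_(0 <= k < m.+1) spin (a k)
  = (\prod_(0 <= k < m) link_arg (a k) (a k.+1)) *: (spin (a 0%N) * pole * spin (a m)).
Proof.
elim: m => [|m IHm]; first by rewrite !big_nat1 big_geq // spin_pole scale1r.
rewrite big_nat_recr // [in LHS](@big_nat_recr _ _ _ m.+1 0) //= [in RHS]big_nat_recr //=.
set g := (gauge (a m.+1))%:C%C; set Pg := \prod_(0 <= i < m.+1) _ in IHm *.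
set Ps := \prod_(0 <= i < m.+1) spin (a i) in IHm *.
set PG := \prod_(0 <= i < m) _ in IHm *.
have -> : (Pg * g) *: (Ps * spin (a m.+1)) = (Pg *: Ps) * (g *: spin (a m.+1)).
  by rewrite -scalerAr -[in RHS]scalerAl scalerA mulrC.
rewrite IHm -spin_pole -scalerAl; rewrite -[in RHS]scalerA; congr (_ *: _).
transitivity (spin (a 0%N) * (pole * (spin (a m) * spin (a m.+1)) * pole) * spin (a m.+1)).
  by rewrite !mulrA.
by rewrite pole_sandwich -scalerAr -scalerAl.
Qed.

Lemma vertex_size P : vertex P (size P) = vertex P 0.
Proof. by rewrite /vertex modnn mod0n. Qed.

Lemma solid_link_arg P x : (0 < size P)%N ->
  (\prod_(0 <= k < size P) (gauge (vertex P k - x))%:C%C) * solid P x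
  = \prod_(0 <= k < size P) link_arg (vertex P k - x) (vertex P k.+1 - x).
Proof.
move=> P0; have [m mE] : exists m, size P = m.+1 by exists (size P).-1; rewrite prednK.
have -> : solid P x = \tr (\prod_(0 <= k < size P) spin (vertex P k - x)).
  rewrite /solid (big_nth 0); congr (\tr _); apply: eq_big_nat => k /andP[_ kn].
  by rewrite /vertex modn_small.
rewrite -mxtraceZ mE gauge_product mxtraceZ [in RHS]big_nat_recr //=; congr (_ * _).
by rewrite mxtrace_mulC -[_ *m _]/(_ * _) mulrA tr_pole_r -mE vertex_size.
Qed.

Lemma gauge_gt0 a : (cx a != 0) || (cy a != 0) -> 0 < gauge a.
Proof.
move=> ha; have := nrm_sqr a; rewrite /dot /gauge => E; have := nrm_ge0 a => n0.
have s0 : 0 < cx a * cx a + cy a * cy a.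
  case/orP: ha => h.
    by rewrite ltr_pwDl // -expr2 ?sqr_ge0 // lt_neqAle eq_sym sqrf_eq0 h sqr_ge0.
  by rewrite ltr_wpDl // -expr2 ?sqr_ge0 // lt_neqAle eq_sym sqrf_eq0 h sqr_ge0.
rewrite ltNge; apply/negP => h.
have : nrm a * nrm a <= cz a * cz a.
  have -> : cz a * cz a = (- cz a) * (- cz a) by rewrite mulrNN.
  by apply: ler_pM => //; lra.
by rewrite E; lra.
Qed.

(** Here the point (1 - t) a + t b of the edge is on the vertical axis; it is
above or below the origin according to the sign of the real part. *)
Lemma link_arg_sign a b (t : R) : 0 < t < 1 ->
  (1 - t) * cx a + t * cx b = 0 -> (1 - t) * cy a + t * cy b = 0 ->
  (cx a != 0) || (cy a != 0) -> (cx b != 0) || (cy b != 0) ->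
  exists2 l : R, 0 < l & Re (link_arg a b) = l * ((1 - t) * cz a + t * cz b).
Proof.
move=> /andP[t0 t1] hx hy /gauge_gt0 A0 /gauge_gt0 B0; rewrite link_argE /=.
have ea := nrm_sqr a; have eb := nrm_sqr b; move: A0 B0 ea eb; rewrite /gauge /dot.
set na := nrm a; set nb := nrm b => A0 B0 ea eb.
set d := cx a * cx b + cy a * cy b.
have d1 : (1 - t) * d = - t * (cx b * cx b + cy b * cy b).
  have : (1 - t) * d = (1 - t) * cx a * cx b + (1 - t) * cy a * cy b by rewrite /d; ring.
  have -> : (1 - t) * cx a = - (t * cx b) by lra.
  have -> : (1 - t) * cy a = - (t * cy b) by lra.
  by move=> ->; ring.
have d2 : t * d = - (1 - t) * (cx a * cx a + cy a * cy a).
  have : t * d = (t * cx b) * cx a + (t * cy b) * cy a by rewrite /d; ring.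
  have -> : t * cx b = - ((1 - t) * cx a) by lra.
  have -> : t * cy b = - ((1 - t) * cy a) by lra.
  by move=> ->; ring.
set A := na + cz a in A0 *; set B := nb + cz b in B0 *.
have S0 : 0 < (1 - t) * A + t * B by rewrite addr_gt0 // mulr_gt0 // subr_gt0.
exists (2 * A * B / ((1 - t) * A + t * B)); first by rewrite divr_gt0 // !mulr_gt0.
rewrite mulrAC; apply: (canRL (mulfK _)); first by rewrite gt_eqF.
apply/esym.
have aA : A * (na - cz a) = cx a * cx a + cy a * cy a.
  by rewrite /A; transitivity (na * na - cz a * cz a); [ring|rewrite ea; ring].
have bB : B * (nb - cz b) = cx b * cx b + cy b * cy b.
  by rewrite /B; transitivity (nb * nb - cz b * cz b); [ring|rewrite eb; ring].
transitivity ((1 - t) * A * A * B - (1 - t) * (A * (na - cz a)) * B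
    + t * A * B * B - t * A * (B * (nb - cz b))).
  by rewrite /A /B; ring.
rewrite aA bB.
have -> : (1 - t) * (cx a * cx a + cy a * cy a) = - (t * d) by rewrite d2; ring.
have -> : t * A * (cx b * cx b + cy b * cy b) = A * - ((1 - t) * d) by rewrite d1; ring.
by ring.
Qed.

Lemma link_arg_Re_gt0 a b : (cx a != 0) || (cy a != 0) -> (cx b != 0) || (cy b != 0) ->
  0 <= cx a * cx b + cy a * cy b -> 0 < Re (link_arg a b).
Proof.
by move=> /gauge_gt0 a0 /gauge_gt0 b0 d; rewrite link_argE /= ltr_pwDl // mulr_gt0.
Qed.

(** The horizontal parts of a and b are then parallel and opposite. *)
Lemma link_arg_between a b : (cx b != 0) || (cy b != 0) ->
  Im (link_arg a b) = 0 -> cx a * cx b + cy a * cy b < 0 ->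
  exists2 t : R, 0 < t < 1 & (1 - t) * cx a + t * cx b = 0 /\ (1 - t) * cy a + t * cy b = 0.
Proof.
move=> hb; rewrite link_argE /= => I0 d0.
have s0 : 0 < cx b * cx b + cy b * cy b.
  case/orP: hb => h.
    by rewrite ltr_pwDl // -expr2 ?sqr_ge0 // lt_neqAle eq_sym sqrf_eq0 h sqr_ge0.
  by rewrite ltr_wpDl // -expr2 ?sqr_ge0 // lt_neqAle eq_sym sqrf_eq0 h sqr_ge0.
set d := cx a * cx b + cy a * cy b in d0; set s := cx b * cx b + cy b * cy b in s0.
have sd : 0 < s - d by lra.
exists (- d / (s - d)).
  by rewrite divr_gt0 ?oppr_gt0 //= ltr_pdivrMr // mul1r; lra.
have n0 : s - d != 0 by rewrite gt_eqF.
have -> : 1 - - d / (s - d) = s / (s - d) by field.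
have ex : s * cx a = d * cx b.
  transitivity (d * cx b - (cx a * cy b - cy a * cx b) * - cy b); last by rewrite I0 mul0r subr0.
  by rewrite /s /d; ring.
have ey : s * cy a = d * cy b.
  transitivity (d * cy b - (cx a * cy b - cy a * cx b) * cx b); last by rewrite I0 mul0r subr0.
  by rewrite /s /d; ring.
split.
  by rewrite mulrAC ex; field.
by rewrite mulrAC ey; field.
Qed.

End Gauge.

(** * Jumps of winding numbers *)

Section Jump.
Variable R : realType.
Local Notation Re := (@complex.Re R).
Local Notation Im := (@complex.Im R).
Implicit Types (z w c : R[i]).

Lemma cut_same z w : upper z = upper w -> cut z w = 0.
Proof. by rewrite /cut => ->; case: upper. Qed.

Lemma cut_neg z w : Re z < 0 -> Re w < 0 -> cut z w = (upper z : nat)%:Z - (upper w : nat)%:Z.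
Proof.
move=> z0 w0; rewrite /cut /crossc.
case uz: (upper z); case uw: (upper w) => //=; move: uz uw; rewrite /upper.
  move=> uz /negbT; rewrite -ltNge => uw.
  have -> // : 0 < Re z * Im w - Im z * Re w.
  have : 0 < Re z * Im w by rewrite nmulr_rgt0.
  have : Im z * Re w <= 0 by rewrite mulr_ge0_le0 // ltW.
  by lra.
move=> /negbT; rewrite -ltNge => uz uw.
have -> // : Re z * Im w - Im z * Re w < 0.
have : 0 < Im z * Re w by rewrite nmulr_rgt0.
have : Re z * Im w <= 0 by rewrite mulr_le0_ge0 // ltW.
by lra.
Qed.

Lemma cut_pos z w : 0 < Re z -> 0 < Re w -> cut z w = 0.
Proof.
move=> z0 w0; rewrite /cut /crossc.
case uz: (upper z); case uw: (upper w) => //=; move: uz uw; rewrite /upper.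
  move=> uz /negbT; rewrite -ltNge => uw.
  rewrite ltNge (_ : _ <= _) //.
  have : Re z * Im w < 0 by rewrite pmulr_rlt0.
  have : 0 <= Im z * Re w by rewrite mulr_ge0 // ltW.
  by lra.
move=> /negbT; rewrite -ltNge => uz uw.
rewrite ltNge (_ : 0 <= _) //.
have : Im z * Re w < 0 by rewrite pmulr_llt0.
have : 0 <= Re z * Im w by rewrite mulr_ge0 // ltW.
by lra.
Qed.

Lemma real_dot c z : Im c = 0 -> 0 < dotc c z -> 0 < Re c * Re z.
Proof. by rewrite /dotc => ->; rewrite mul0r addr0. Qed.

(** When a cell of the mesh contains a real value c, the crossing count of the
cell is decided by the sign of c. *)
Lemma cut_near_real c z w : Im c = 0 -> 0 < dotc c z -> 0 < dotc c w ->
  cut z w = if Re c < 0 then (upper z : nat)%:Z - (upper w : nat)%:Z else 0.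
Proof.
move=> c0 /(real_dot c0) cz /(real_dot c0) cw; case: ltP => hc.
  by apply: cut_neg; rewrite -(nmulr_rgt0 _ hc).
have hc' : 0 < Re c.
  by rewrite lt_neqAle hc andbT; apply: contraTneq cz => <-; rewrite mul0r ltxx.
by apply: cut_pos; rewrite -(pmulr_rgt0 _ hc').
Qed.

Lemma zero_between (h : R -> R) (a b : R) : continuous h -> a <= b ->
  (0 <= h a) != (0 <= h b) -> exists2 s, a <= s <= b & h s = 0.
Proof.
move=> ch ab hab; have [||s] := @IVT R h a b 0 ab.
- exact: continuous_subspaceT.
- rewrite ge_min le_max; move: hab.
  by case: (leP 0 (h a)); case: (leP 0 (h b)) => // h1 h2 _; rewrite ?(ltW h1) ?(ltW h2) ?orbT.
- by rewrite in_itv /= => sI hs; exists s.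
Qed.

(** Since f and g have the same imaginary part, they cross the real axis
simultaneously, and on the same side except at s0.  There both go upwards, f
through the positive half and g through the negative half, which is a clockwise
crossing that counts -1 for g only. *)
Lemma winding_jump (f g : R -> R[i]) (s0 d : R) : is_loop f -> is_loop g ->
  0 < s0 < 1 -> 0 < d ->
  (forall s, 0 <= s <= 1 -> Im (f s) = Im (g s)) ->
  (forall s, 0 <= s <= 1 -> s != s0 -> Im (f s) = 0 -> 0 < Re (f s) * Re (g s)) ->
  Im (f s0) = 0 -> Re (g s0) < 0 < Re (f s0) ->
  (forall s, 0 <= s < s0 -> s0 - s < d -> Im (f s) < 0) ->
  (forall s, s0 < s <= 1 -> s - s0 < d -> 0 < Im (f s)) ->
  winding g = winding f - 1.
Proof.
move=> lf lg /andP[s00 s01] d0 eI eR I0 /andP[g0 f0] Ilo Ihi.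
near \oo => N.
have <- : turns N f = winding f by near: N; apply: turns_winding.
have <- : turns N g = winding g by near: N; apply: turns_winding.
have N0 : (0 < N)%N by near: N; exists 1%N.
have mf : forall s s', 0 <= s <= 1 -> `|s - s'| <= N%:R^-1 -> 0 < dotc (f s) (f s').
  by near: N; apply: is_loop_mesh.
have mg : forall s s', 0 <= s <= 1 -> `|s - s'| <= N%:R^-1 -> 0 < dotc (g s) (g s').
  by near: N; apply: is_loop_mesh.
have Nd : N%:R^-1 < d.
  rewrite invf_plt ?posrE // ?ltr0n //.
  by near: N; apply: nbhs_infty_gtr.
have Ninv : 0 < N%:R^-1 :> R by rewrite invr_gt0 ltr0n.
suff D : turns N g - turns N f = -1 by rewrite -D addrC subrK.
pose x k : R := k%:R / N%:R.
have xS k : x k.+1 = x k + N%:R^-1 by rewrite /x -natr1 mulrDl mul1r.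
have x01 k : (k <= N)%N -> 0 <= x k <= 1 by exact: grid_itv.
have up h k : upper (h k : R[i]) = (0 <= Im (h k)) by [].
(* the right-hand side is -1 for the cell containing s0, and 0 for all others *)
have cell k : (k < N)%N -> cut (g (x k)) (g (x k.+1)) - cut (f (x k)) (f (x k.+1))
    = ((x k.+1 < s0)%R : nat)%:Z - ((x k < s0)%R : nat)%:Z.
  move=> kN; have k01 := x01 k (ltnW kN); have k101 := x01 k.+1 kN.
  have ufg j : (j <= N)%N -> upper (g (x j)) = upper (f (x j)).
    by move=> jN; rewrite /upper -eI ?x01.
  have near_real s : 0 <= s <= 1 -> x k <= s <= x k.+1 -> Im (f s) = 0 ->
      (cut (f (x k)) (f (x k.+1)) = if Re (f s) < 0 then (upper (f (x k)) : nat)%:Z - (upper (f (x k.+1)) : nat)%:Z else 0) /\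
      (cut (g (x k)) (g (x k.+1)) = if Re (g s) < 0 then (upper (f (x k)) : nat)%:Z - (upper (f (x k.+1)) : nat)%:Z else 0).
    move=> sI /andP[ks sk] Is.
    have h1 : `|s - x k| <= N%:R^-1 by rewrite ger0_norm ?subr_ge0 //; rewrite xS in sk; lra.
    have h2 : `|s - x k.+1| <= N%:R^-1.
      by rewrite distrC ger0_norm ?subr_ge0 //; rewrite xS in sk *; lra.
    split; first by apply: cut_near_real => //; apply: mf.
    rewrite -(ufg k) 1?ltnW // -(ufg k.+1) //.
    by apply: cut_near_real; rewrite -?eI //; apply: mg.
  have [klo|khi] := ltP (x k) s0; have [k1lo|k1hi] := ltP (x k.+1) s0; rewrite ?subrr /=.
  - have [/eqP uE|uN] := boolP (upper (f (x k)) == upper (f (x k.+1))).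
      by rewrite !cut_same // ?ufg // ltnW.
    have [s sI Is] : exists2 s, x k <= s <= x k.+1 & Im (f s) = 0.
      by apply: zero_between; [have [[]] := lf|rewrite xS lerDl ltW|].
    have s01' : 0 <= s <= 1 by case/andP: sI => a b; case/andP: k01 => c _; case/andP: k101 => _ e; rewrite (le_trans c) ?(le_trans b).
    have ns : s != s0 by case/andP: sI => _ b; rewrite lt_eqF // (le_lt_trans b).
    have [-> ->] := near_real s s01' sI Is.
    have := eR s s01' ns Is; case: (ltP (Re (f s))) => hf; first by rewrite nmulr_rgt0 // => ->; rewrite subrr.
    case: (ltP (Re (g s))) => hg; last by rewrite subrr.
    by move=> hh; have := mulr_ge0_le0 hf (ltW hg); rewrite leNgt hh.
  - have sI : x k <= s0 <= x k.+1 by rewrite (ltW klo).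
    have s01' : 0 <= s0 <= 1 by rewrite !ltW.
    have [-> ->] := near_real s0 s01' sI I0.
    rewrite g0 ltNge (ltW f0) /= subr0.
    have -> : upper (f (x k)) = false.
      apply/negbTE; rewrite /upper -ltNge; apply: Ilo; first by rewrite klo; case/andP: k01 => ->.
      by rewrite xS in k1hi; lra.
    have -> // : upper (f (x k.+1)) = true.
    rewrite /upper; move: k1hi; rewrite le_eqVlt => /predU1P[<-|k1hi]; first by rewrite I0 lexx.
    apply/ltW/Ihi; first by rewrite k1hi; case/andP: k101 => _ ->.
    by rewrite xS; lra.
  - by exfalso; have := lt_le_trans k1lo khi; rewrite xS; lra.
  - have [/eqP uE|uN] := boolP (upper (f (x k)) == upper (f (x k.+1))).
      by rewrite !cut_same // ?ufg // ltnW.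
    have [s sI Is] : exists2 s, x k <= s <= x k.+1 & Im (f s) = 0.
      by apply: zero_between; [have [[]] := lf|rewrite xS lerDl ltW|].
    have s01' : 0 <= s <= 1 by case/andP: sI => a b; case/andP: k01 => c _; case/andP: k101 => _ e; rewrite (le_trans c) ?(le_trans b).
    have ns : s != s0.
      apply: contraNneq uN => ss; rewrite /upper.
      have ks : x k = s0 by apply/le_anti; rewrite khi -ss; case/andP: sI => ->.
      rewrite ks I0 lexx eq_sym eqb_id; apply/ltW/Ihi; last by rewrite xS ks addrAC subrr add0r.
      by rewrite xS ks ltrDl Ninv -ks -xS; case/andP: k101 => _ ->.
    have [-> ->] := near_real s s01' sI Is.
    have := eR s s01' ns Is; case: (ltP (Re (f s))) => hf; first by rewrite nmulr_rgt0 // => ->; rewrite subrr.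
    case: (ltP (Re (g s))) => hg; last by rewrite subrr.
    by move=> hh; have := mulr_ge0_le0 hf (ltW hg); rewrite leNgt hh.
rewrite /turns -sumrB.
transitivity (\sum_(0 <= k < N) (((x k.+1 < s0)%R : nat)%:Z - ((x k < s0)%R : nat)%:Z)).
  by apply: eq_big_nat => k /andP[_ kN]; exact: cell.
rewrite telescope_sumr // /x mul0r s00 divff ?pnatr_eq0 -?lt0n //.
by rewrite ltNge (ltW s01).
Unshelve. all: by end_near. Qed.

End Jump.

(** * Linking numbers and shadows *)

Section CrossingChange.
Variable R : realType.
Local Notation Re := (@complex.Re R).
Local Notation Im := (@complex.Im R).

Lemma winding_same (f g : R -> R[i]) : is_loop f -> is_loop g ->
  (forall s, 0 <= s <= 1 -> Im (f s) = Im (g s)) ->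
  (forall s, 0 <= s < 1 -> Im (f s) = 0 -> 0 < Re (f s) * Re (g s)) ->
  winding f = winding g.
Proof.
move=> lf lg eI eR; apply: winding_lerp => // s t sI /andP[t0 t1].
rewrite eq_complex0 negb_and /= -eI //.
have -> : (1 - t) * Im (f s) + t * Im (f s) = Im (f s) by ring.
have [I0|hI] := eqVneq (Im (f s)) 0; last by rewrite orbT.
rewrite orbF.
have H : 0 < Re (f s) * Re (g s).
  case/andP: sI => s0; rewrite le_eqVlt => /predU1P[s1|s1]; last by apply: eR; rewrite ?s0.
  have [_ _ fc] := lf; have [_ _ gc] := lg.
  by rewrite s1 -fc -gc; apply: eR; rewrite ?lexx ?ltr01 // fc -s1.
have [f0|f0|f0] := ltrgtP (Re (f s)) 0; last by move: H; rewrite f0 mul0r ltxx.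
  have g0 : Re (g s) < 0 by move: H; rewrite nmulr_rgt0.
  rewrite lt_eqF //; have [->|tn] := eqVneq t 0; first by rewrite subr0 mul1r mul0r addr0.
  have : t * Re (g s) < 0 by rewrite pmulr_rlt0 // lt_neqAle eq_sym tn.
  have : (1 - t) * Re (f s) <= 0 by rewrite mulr_ge0_le0 ?subr_ge0 // ltW.
  by lra.
have g0 : 0 < Re (g s) by move: H; rewrite pmulr_rgt0.
rewrite gt_eqF //; have [->|tn] := eqVneq t 0; first by rewrite subr0 mul1r mul0r addr0.
have : 0 < t * Re (g s) by rewrite mulr_gt0 // lt_neqAle eq_sym tn.
have : 0 <= (1 - t) * Re (f s) by rewrite mulr_ge0 ?subr_ge0 // ltW.
by lra.
Qed.

Lemma is_loop_rev (f : R -> R[i]) : is_loop f -> is_loop (fun s => f (1 - s)).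
Proof.
move=> [cf f0 fc]; split; last by rewrite subr0 subrr.
  apply: (@ccont_comp _ _ _ (fun s : R => 1 - s) f) => //.
  by apply: cfB; [exact: cf_cst|exact: cf_id].
by move=> s /andP[s0 s1]; apply: f0; rewrite subr_ge0 s1 gerBl s0.
Qed.

(** A crossing in the downward direction is one in the upward direction for
the reversed loops. *)
Lemma winding_jump_slope (f g : R -> R[i]) (s0 d c : R) : is_loop f -> is_loop g ->
  0 < s0 < 1 -> 0 < d -> c != 0 ->
  (forall s, 0 <= s <= 1 -> Im (f s) = Im (g s)) ->
  (forall s, 0 <= s < 1 -> s != s0 -> Im (f s) = 0 -> 0 < Re (f s) * Re (g s)) ->
  Re (g s0) < 0 < Re (f s0) ->
  (forall s, 0 <= s <= 1 -> `|s - s0| < d -> Im (f s) = c * (s - s0)) ->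
  winding g = winding f - (if 0 < c then 1 else -1).
Proof.
move=> lf lg s0I d0 c0 eI eR gf slope.
have [s00 s01] := andP s0I.
have eR' s : 0 <= s <= 1 -> s != s0 -> Im (f s) = 0 -> 0 < Re (f s) * Re (g s).
  move=> /andP[sl]; rewrite le_eqVlt => /predU1P[-> _ I0|sr]; last by apply: eR; rewrite sl.
  have [_ _ fc] := lf; have [_ _ gc] := lg.
  by rewrite -fc -gc; apply: eR; rewrite ?lexx ?ltr01 // ?lt_eqF // fc.
have I0 : Im (f s0) = 0.
  by rewrite slope ?subrr ?normr0 ?mulr0 // !ltW.
have [cp|cn] := ltP 0 c.
  apply: (winding_jump lf lg s0I d0) => //.
    move=> s /andP[sl sr] sd; rewrite slope ?pmulr_rlt0 ?subr_lt0 //; first by rewrite sl ltW // (lt_trans sr).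
    by rewrite distrC gtr0_norm ?subr_gt0.
  move=> s /andP[sl sr] sd; rewrite slope ?mulr_gt0 ?subr_gt0 //; first by rewrite sr ltW // (lt_trans s00).
  by rewrite gtr0_norm ?subr_gt0.
have cn' : c < 0 by rewrite lt_neqAle c0.
have rI (s : R) : 0 <= s <= 1 -> 0 <= 1 - s <= 1 by move=> /andP[a b]; rewrite subr_ge0 b gerBl a.
have := @winding_jump R (fun s => f (1 - s)) (fun s => g (1 - s)) (1 - s0) d
  (is_loop_rev lf) (is_loop_rev lg).
rewrite !winding_rev // subKr => H.
have {}H : - winding g = - winding f - 1.
  apply: H => //.
  - by rewrite subr_gt0 s01 gtrBl.
  - by move=> s sI; apply: eI; exact: rI.
  - move=> s sI sn; apply: eR'; first exact: rI.
    by apply: contraNneq sn => <-; rewrite subKr.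
  - move=> s /andP[sl sr] sd.
    rewrite slope; first by rewrite nmulr_rlt0 //; lra.
      by apply: rI; rewrite sl; lra.
    by rewrite gtr0_norm; lra.
  - move=> s /andP[sl sr] sd.
    rewrite slope; first by rewrite nmulr_rgt0 //; lra.
      by apply: rI; rewrite sr andbT; lra.
    by rewrite ltr0_norm; lra.
by move: (winding f) (winding g) H => u v; lia.
Qed.

Lemma winding_prod (r : seq nat) (f : nat -> R -> R[i]) :
  (forall k, k \in r -> is_loop (f k)) ->
  is_loop (fun s => \prod_(k <- r) f k s) /\
  winding (fun s => \prod_(k <- r) f k s) = \sum_(k <- r) winding (f k).
Proof.
elim: r => [|k r IHr] H.
  have -> : (fun s => \prod_(k <- [::]) f k s) = (fun=> 1) by apply/funext => s; rewrite big_nil.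
  rewrite big_nil winding_cst ?oner_neq0 //; split=> //.
  by apply: is_loop_cst; rewrite oner_neq0.
have [|lr wr] := IHr; first by move=> i ir; apply: H; rewrite inE ir orbT.
have -> : (fun s => \prod_(k <- k :: r) f k s) = (fun s => f k s * \prod_(k <- r) f k s).
  by apply/funext => s; rewrite big_cons.
have lk : is_loop (f k) by apply: H; rewrite inE eqxx.
by split; [exact: is_loopM|rewrite windingM // wr big_cons].
Qed.

Lemma cxB (a b : space R) : cx (a - b) = cx a - cx b. Proof. by rewrite !cE. Qed.
Lemma cyB (a b : space R) : cy (a - b) = cy a - cy b. Proof. by rewrite !cE. Qed.
Definition cB := (cxB, cyB).

Definition planar_neq0 (a : space R) : bool := (cx a != 0) || (cy a != 0).

Section Pair.
Variables (P : polygon R) (x : R -> space R).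
Hypotheses (P0 : (0 < size P)%N) (cx_ : continuous x) (xc : x 0 = x 1).
Hypothesis off : forall s, 0 <= s <= 1 -> ~ carrier P (x s).
Hypothesis offv : forall s k, 0 <= s <= 1 -> (k < size P)%N -> planar_neq0 (vertex P k - x s).

(** The factor of [solid P] that belongs to edge k, up to a positive number. *)
Definition edge_arg k s := link_arg (vertex P k - x s) (vertex P k.+1 - x s).

Lemma edge_arg_loop k : (k < size P)%N -> is_loop (edge_arg k).
Proof.
move=> kP; split; last by rewrite /edge_arg xc.
  have cs j : mcont (fun s => spin (vertex P j - x s)).
    apply: mcont_spin; apply: subv_cont => //; by move=> ?; exact: cvg_cst.
  exact: mcontM (cs k) (cs k.+1) 0 0.
move=> s sI; have := solid_link_arg (x s) P0.
have nz : (\prod_(0 <= k < size P) (gauge (vertex P k - x s))%:C%C) * solid P (x s) != 0.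
  apply: mulf_neq0; last exact: solid_neq0 (off sI).
  rewrite prodf_seq_neq0; apply/allP => j; rewrite mem_index_iota /= => jP.
  by rewrite eq_complex0 /= gt_eqF //; apply/gauge_gt0/offv.
move=> E; move: nz; rewrite E prodf_seq_neq0 => /allP/(_ k).
by rewrite mem_index_iota /=; apply.
Qed.

Lemma winding_edge_args :
  winding (fun s => solid P (x s)) = \sum_(0 <= k < size P) winding (edge_arg k).
Proof.
have [|lG <-] := @winding_prod (index_iota 0 (size P)) edge_arg.
- by move=> k; rewrite mem_index_iota => /andP[_]; exact: edge_arg_loop.
- apply: winding_pos_eq => //; first exact: is_loop_solid.
  move=> s sI; exists (\prod_(0 <= k < size P) gauge (vertex P k - x s)).
    rewrite big_seq; apply: prodr_gt0 => k; rewrite mem_index_iota /= => kP.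
    by apply/gauge_gt0/offv.
  by rewrite -(solid_link_arg (x s) P0) rmorph_prod.
Qed.

End Pair.

Definition cross2 (u v : space R) : R := cx u * cy v - cy u * cx v.

Section Links.
Variable I : finType.
Implicit Types (L M : polygons R I) (a b c d : place R I) (i j : I).

Definition edge_dir L a : space R :=
  vertex (L a.1.1) a.1.2.+1 - vertex (L a.1.1) a.1.2.

Definition level L a : R := cz (at_place L a).

Lemma shadow_eq (v w : space R) : shadow v = shadow w <-> cx v = cx w /\ cy v = cy w.
Proof. by split => [[h0 h1]|[h0 h1]]; [split|rewrite /shadow -/(cx v) -/(cy v) h0 h1]. Qed.

Lemma double_pointC L a b : double_point L a b -> double_point L b a.
Proof. by case=> ha hb ab e; split => //; move=> e'; apply: ab. Qed.

Lemma link_size L i : is_link L -> (0 < size (L i))%N.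
Proof. by case=> h _; exact: ltn_trans (h i). Qed.

Lemma link_simple L i : is_link L -> simple (L i).
Proof.
case=> h inj; split=> // k t k' t' kP k'P tI t'I e.
by have [-> ->] := inj (i, k, t) (i, k', t') (conj kP tI) (conj k'P t'I) e.
Qed.

Lemma link_apart L i j : is_link L -> i != j -> apart (L i) (L j).
Proof.
case=> _ inj ij x [k [t [kP tI ->]]] [k' [t' [k'P t'I e]]].
have [/eqP] := inj (i, k, t) (j, k', t') (conj kP tI) (conj k'P t'I) e.
by rewrite (negPf ij).
Qed.

Lemma level_neq L a b : is_link L -> double_point L a b -> level L a != level L b.
Proof.
case=> _ inj [ha hb ab /shadow_eq[h0 h1]]; apply/eqP => h2.
by apply: ab; apply: inj => //; exact: space_eqP.
Qed.

Section SameShadow.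
Variables L M : polygons R I.
Hypothesis sh : same_shadow L M.

Lemma same_size i : size (L i) = size (M i).
Proof. by rewrite -(size_map (@shadow R)) sh size_map. Qed.

Lemma same_vertex i k : (0 < size (L i))%N ->
  shadow (vertex (L i) k) = shadow (vertex (M i) k).
Proof.
move=> L0; rewrite /vertex -same_size.
have kL : (k %% size (L i) < size (L i))%N by rewrite ltn_pmod.
by rewrite -!(nth_map 0 0) ?sh -?same_size.
Qed.

Lemma same_edge_point i k (t : R) : (0 < size (L i))%N ->
  shadow (edge_point (L i) k t) = shadow (edge_point (M i) k t).
Proof.
move=> L0; have /shadow_eq[a0 a1] := same_vertex k L0.
have /shadow_eq[b0 b1] := same_vertex k.+1 L0.
by apply/shadow_eq; rewrite /edge_point !cE a0 a1 b0 b1.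
Qed.

Lemma same_loop i (s : R) : (0 < size (L i))%N -> 0 <= s <= 1 ->
  shadow (loop (L i) s) = shadow (loop (M i) s).
Proof.
move=> L0 /andP[s0]; rewrite le_eqVlt => /predU1P[->|s1].
  have M0 : (0 < size (M i))%N by rewrite -same_size.
  rewrite -!loop_closed //.
  have -> : 0 = (0%:R + 0) / (size (L i))%:R :> R by rewrite addr0 mul0r.
  rewrite {2}same_size !loopE ?lexx ?ler01 //; exact: same_edge_point.
have [|k [t [kP tI ->]]] := @loop_param R _ s L0; first by rewrite s0.
have tI' : 0 <= t <= 1 by case/andP: tI => -> /ltW.
by rewrite {2}same_size !loopE -?same_size //; exact: same_edge_point.
Qed.

Lemma same_double_point a b : double_point L a b -> double_point M a b.
Proof.
case=> -[ha1 ha2] [hb1 hb2] ab e; split => //; try by split; rewrite -?same_size.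
have L0 a' : (a'.1.2 < size (L a'.1.1))%N -> (0 < size (L a'.1.1))%N by case: size.
by rewrite /at_place -!same_edge_point ?L0.
Qed.

End SameShadow.

Section CrossingPair.
Variables L M : polygons R I.
Hypotheses (lL : is_link L) (lM : is_link M) (rL : regular L) (sh : same_shadow L M).

Let EL i j k s := edge_arg (L i) (loop (L j)) k s.
Let EM i j k s := edge_arg (M i) (loop (M j)) k s.

(** A point of the j-th component directly below or above a vertex of the i-th
one would be a double point at a vertex, which regularity excludes. *)
Lemma planar_vertex i j k (s : R) : i != j -> (k < size (L i))%N -> 0 <= s <= 1 ->
  planar_neq0 (vertex (L i) k - loop (L j) s).
Proof.
move=> ij kL sI.
have key s' : 0 <= s' < 1 -> planar_neq0 (vertex (L i) k - loop (L j) s').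
  move=> s'I; rewrite /planar_neq0 !cB !subr_eq0 -negb_and; apply/negP => /andP[/eqP e0 /eqP e1].
  have [l [u [lP uI sE]]] := loop_param (link_size j lL) s'I.
  have uI' : 0 <= u <= 1 by case/andP: uI => -> /ltW.
  have [_ _ r3] := rL.
  have : double_point L (i, k, 0) (j, l, u).
    split; [by split; rewrite //= lexx ltr01|by split| |].
      by case=> /eqP; rewrite (negPf ij).
    by apply/shadow_eq; rewrite /at_place /= edge_point0 -loopE // -sE.
  by move=> /r3 /=; rewrite eqxx.
case/andP: sI => s0; rewrite le_eqVlt => /predU1P[->|s1]; last by apply: key; rewrite s0.
by rewrite -loop_closed ?link_size //; apply: key; rewrite lexx ltr01.
Qed.

Lemma planar_vertex' i j k (s : R) : i != j -> (k < size (M i))%N -> 0 <= s <= 1 ->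
  planar_neq0 (vertex (M i) k - loop (M j) s).
Proof.
move=> ij kL sI; have := @planar_vertex i j k s ij.
rewrite (same_size sh) => /(_ kL sI); rewrite /planar_neq0 !cB.
have /shadow_eq[-> ->] := same_vertex sh k (link_size i lL).
by have /shadow_eq[-> ->] := same_loop sh (link_size j lL) sI.
Qed.

Lemma off_loop N i j (s : R) : is_link N -> i != j -> 0 <= s <= 1 ->
  ~ carrier (N i) (loop (N j) s).
Proof.
move=> lN ij sI; apply: (apartC (link_apart lN ij)).
exact: (loop_carrier (link_size j lN) sI).
Qed.

Lemma lk_edges_L i j : i != j ->
  lk (L i) (L j) = \sum_(0 <= k < size (L i)) winding (EL i j k).
Proof.
move=> ij; apply: winding_edge_args.
- exact: link_size.
- exact: loop_cont.
- exact: (loop_closed (link_size j lL)).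
- by move=> s sI; exact: off_loop.
- by move=> s k sI kP; exact: planar_vertex.
Qed.

Lemma lk_edges_M i j : i != j ->
  lk (M i) (M j) = \sum_(0 <= k < size (L i)) winding (EM i j k).
Proof.
move=> ij; rewrite (same_size sh); apply: winding_edge_args.
- exact: link_size.
- exact: loop_cont.
- exact: (loop_closed (link_size j lM)).
- by move=> s sI; exact: off_loop.
- by move=> s k sI kP; exact: planar_vertex'.
Qed.

Lemma EL_loop i j k : i != j -> (k < size (L i))%N -> is_loop (EL i j k).
Proof.
move=> ij kP; apply: edge_arg_loop => //.
- exact: link_size.
- exact: loop_cont.
- exact: (loop_closed (link_size j lL)).
- by move=> s sI; exact: off_loop.
- by move=> s k' sI k'P; exact: planar_vertex.
Qed.

Lemma EM_loop i j k : i != j -> (k < size (L i))%N -> is_loop (EM i j k).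
Proof.
rewrite (same_size sh) => ij kP; apply: edge_arg_loop => //.
- exact: link_size.
- exact: loop_cont.
- exact: (loop_closed (link_size j lM)).
- by move=> s sI; exact: off_loop.
- by move=> s k' sI k'P; exact: planar_vertex'.
Qed.

Lemma EL_EM i j k (s : R) : 0 <= s <= 1 -> Im (EL i j k s) = Im (EM i j k s).
Proof.
move=> sI; rewrite /EL /EM /edge_arg !link_argE /= !cB.
have /shadow_eq[-> ->] := same_vertex sh k (link_size i lL).
have /shadow_eq[-> ->] := same_vertex sh k.+1 (link_size i lL).
by have /shadow_eq[-> ->] := same_loop sh (link_size j lL) sI.
Qed.

Lemma edge_arg_level N i j k t l u : is_link N -> (k < size (N i))%N -> (l < size (N j))%N ->
  0 < t < 1 -> 0 <= u < 1 ->
  planar_neq0 (vertex (N i) k - edge_point (N j) l u) ->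
  planar_neq0 (vertex (N i) k.+1 - edge_point (N j) l u) ->
  shadow (edge_point (N i) k t) = shadow (edge_point (N j) l u) ->
  exists2 lam : R, 0 < lam &
    Re (edge_arg (N i) (loop (N j)) k ((l%:R + u) / (size (N j))%:R))
    = lam * (level N (i, k, t) - level N (j, l, u)).
Proof.
move=> lN kP lP tI uI p0 p1 /shadow_eq[h0 h1].
have uI' : 0 <= u <= 1 by case/andP: uI => -> /ltW.
rewrite /edge_arg loopE //.
have [||lam lam0 ->] := link_arg_sign tI _ _ p0 p1.
- rewrite !cE; transitivity (cx (edge_point (N i) k t) - cx (edge_point (N j) l u)).
    by rewrite [in X in _ = X - _]/edge_point !cE; ring.
  by rewrite h0 subrr.
- rewrite !cE; transitivity (cy (edge_point (N i) k t) - cy (edge_point (N j) l u)).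
    by rewrite [in X in _ = X - _]/edge_point !cE; ring.
  by rewrite h1 subrr.
exists lam => //; congr (_ * _).
by rewrite /level /at_place /= {3}/edge_point !cE; ring.
Qed.

Lemma vertex_succ N i k (v : space R) : (k < size (N i))%N ->
  (forall k', (k' < size (N i))%N -> planar_neq0 (vertex (N i) k' - v)) ->
  planar_neq0 (vertex (N i) k.+1 - v).
Proof.
move=> kP H; rewrite -(vertex_mod (N i) k.+1); apply: H; rewrite ltn_pmod //.
by case: size kP.
Qed.

(** The imaginary part vanishes if the horizontal directions to the end points
of the edge agree, which makes the real part positive for both links, or if
they are opposite, which means that the edge is crossed.  In the second case the
product of the real parts has a positive sign if and only if the two links have
the same strand on top. *)
Lemma edge_arg_zero i j k (s : R) : i != j -> (k < size (L i))%N -> 0 <= s < 1 ->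
  Im (EL i j k s) = 0 ->
  0 < Re (EL i j k s) * Re (EM i j k s) \/
  exists t l u, [/\ double_point L (i, k, t) (j, l, u), s = (l%:R + u) / (size (L j))%:R &
    exists2 lam : R, 0 < lam & Re (EL i j k s) * Re (EM i j k s)
      = lam * ((level L (i, k, t) - level L (j, l, u)) * (level M (i, k, t) - level M (j, l, u)))].
Proof.
move=> ij kP sI I0.
have sI' : 0 <= s <= 1 by case/andP: sI => -> /ltW.
have kPM : (k < size (M i))%N by rewrite -(same_size sh).
have pL := planar_vertex ij kP sI'.
have pM := planar_vertex' ij kPM sI'.
have pL1 : planar_neq0 (vertex (L i) k.+1 - loop (L j) s).
  by apply: vertex_succ => // k' k'P; exact: planar_vertex.
have pM1 : planar_neq0 (vertex (M i) k.+1 - loop (M j) s).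
  by apply: vertex_succ => // k' k'P; exact: planar_vertex'.
have [d0|d0] := leP 0 (cx (vertex (L i) k - loop (L j) s) * cx (vertex (L i) k.+1 - loop (L j) s)
    + cy (vertex (L i) k - loop (L j) s) * cy (vertex (L i) k.+1 - loop (L j) s)).
  left; apply: mulr_gt0; first exact: (link_arg_Re_gt0 pL pL1 d0).
  apply: (link_arg_Re_gt0 pM pM1); move: d0; rewrite !cB.
  have /shadow_eq[-> ->] := same_vertex sh k (link_size i lL).
  have /shadow_eq[-> ->] := same_vertex sh k.+1 (link_size i lL).
  by have /shadow_eq[-> ->] := same_loop sh (link_size j lL) sI'.
right; have [t tI [tx ty]] := link_arg_between pL1 I0 d0.
have [l [u [lP uI sE]]] := loop_param (link_size j lL) sI.
have uI' : 0 <= u <= 1 by case/andP: uI => -> /ltW.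
have lPM : (l < size (M j))%N by rewrite -(same_size sh).
have lE : loop (L j) s = edge_point (L j) l u by rewrite sE loopE.
have lEM : loop (M j) s = edge_point (M j) l u by rewrite sE (same_size sh) loopE.
have shE : shadow (edge_point (L i) k t) = shadow (edge_point (L j) l u).
  apply/shadow_eq; split; apply/eqP; rewrite -subr_eq0 -lE; apply/eqP.
    by rewrite -tx /edge_point !cE; ring.
  by rewrite -ty /edge_point !cE; ring.
exists t, l, u; split => //.
  split => //; [by split => //=; case/andP: tI => /ltW -> ->|].
  by case=> /eqP; rewrite (negPf ij).
have shM : shadow (edge_point (M i) k t) = shadow (edge_point (M j) l u).
  by rewrite -!(same_edge_point sh) ?link_size.
have [||lam lam0 e] := edge_arg_level lL kP lP tI uI _ _ shE; rewrite -?lE //.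
have [||lam' lam'0 e'] := edge_arg_level lM kPM lPM tI uI _ _ shM; rewrite -?lEM //.
exists (lam * lam'); first exact: mulr_gt0.
rewrite -sE in e; rewrite -(same_size sh) -sE in e'.
by rewrite -[RHS]mulrACA; exact: (congr2 *%R e e').
Qed.

End CrossingPair.
End Links.
End CrossingChange.

(** * The effect of a crossing change *)

Lemma sum_bump (n k0 : nat) (F G : nat -> int) (z : int) : (k0 < n)%N ->
  (forall k, (k < n)%N -> F k = G k + (if k == k0 then z else 0)) ->
  \sum_(0 <= k < n) F k = \sum_(0 <= k < n) G k + z.
Proof.
move=> k0n H.
rewrite (eq_big_nat _ _ (F2 := fun k => G k + (if k == k0 then z else 0))); last first.
  by move=> k /andP[_]; exact: H.
rewrite big_split /=; congr (_ + _).
rewrite (bigD1_seq k0) ?mem_index_iota ?iota_uniq //= eqxx big1 ?addr0 //.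
by move=> k /negbTE ->.
Qed.

Section CrossingFormula.
Variable R : realType.
Local Notation Re := (@complex.Re R).
Local Notation Im := (@complex.Im R).
Variable I : finType.
Implicit Types (a b c d : place R I) (i j : I).

Lemma dist_itv (y l u : R) : `|y - (l + u)| < Num.min u (1 - u) -> 0 <= y - l <= 1.
Proof.
rewrite lt_min !ltr_norml => /andP[/andP[h1 h2] /andP[h3 h4]].
by apply/andP; split; lra.
Qed.

Section TwoLinks.
Variables L M : polygons R I.
Hypotheses (lL : is_link L) (lM : is_link M) (rL : regular L) (sh : same_shadow L M).

Lemma double_point_itv a b : double_point L a b -> 0 < a.2 < 1 /\ 0 < b.2 < 1.
Proof.
move=> dab; have [_ _ r3] := rL.
have a0 := r3 _ _ dab; have b0 := r3 _ _ (double_pointC dab).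
have [[_ /andP[h1 h2]] [_ /andP[h3 h4]] _ _] := dab.
by rewrite !lt_neqAle ![0 == _]eq_sym a0 b0 h1 h3 -!lt_neqAle h2 h4.
Qed.

(** Twice the oriented area of the triangle formed by the edge and the point is
an affine function of the point. *)
Lemma edge_arg_slope i j k t l u (v : R) : (k < size (L i))%N -> (l < size (L j))%N ->
  0 <= u <= 1 -> 0 <= v <= 1 ->
  shadow (edge_point (L i) k t) = shadow (edge_point (L j) l u) ->
  Im (edge_arg (L i) (loop (L j)) k ((l%:R + v) / (size (L j))%:R))
  = cross2 (edge_dir L (i, k, t)) (edge_dir L (j, l, u)) * (v - u).
Proof.
move=> kP lP uI vI /shadow_eq[h0 h1].
rewrite /edge_arg loopE // link_argE /= !cB.
have ex : cx (edge_point (L j) l v) = cx (edge_point (L j) l u) + (v - u) * cx (edge_dir L (j, l, u)).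
  by rewrite /edge_dir /edge_point !cE /=; ring.
have ey : cy (edge_point (L j) l v) = cy (edge_point (L j) l u) + (v - u) * cy (edge_dir L (j, l, u)).
  by rewrite /edge_dir /edge_point !cE /=; ring.
rewrite ex ey -h0 -h1 /cross2 /edge_dir /edge_point !cE /=; ring.
Qed.

Section OneEdge.
Variables (i j : I) (k l : nat) (t u : R).
Hypotheses (ij : i != j) (dcd : double_point L (i, k, t) (j, l, u)).
Let c : place R I := (i, k, t).
Let d : place R I := (j, l, u).
Hypothesis others : forall t' l' u', double_point L (i, k, t') (j, l', u') ->
  (l', u') != (l, u) ->
  0 < (level L (i, k, t') - level L (j, l', u')) * (level M (i, k, t') - level M (j, l', u')).
Hypothesis transverse : cross2 (edge_dir L c) (edge_dir L d) != 0.

Let n : R := (size (L j))%:R.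
Let s0 : R := (l%:R + u) / n.
Let EL s := edge_arg (L i) (loop (L j)) k s.
Let EM s := edge_arg (M i) (loop (M j)) k s.

(** Alternatives for an edge that is crossed at only one double point where
L and M may differ: c is above d in L only, or in M only, or the order is the
same. *)
Lemma one_edge_jump :
  [/\ level L d < level L c, level M c < level M d &
     winding EM = winding EL - (if 0 < cross2 (edge_dir L c) (edge_dir L d) then 1 else -1)] \/
  [/\ level L c < level L d, level M d < level M c &
     winding EL = winding EM - (if 0 < cross2 (edge_dir L c) (edge_dir L d) then 1 else -1)] \/
  0 < (level L c - level L d) * (level M c - level M d).
Proof.
have [/= tI uI] := double_point_itv dcd.
have [[/= kP _] [/= lP uI'] _ shE] := dcd; rewrite /at_place /= in shE.
have /andP[u0 u1] := uI.
have kPM : (k < size (M i))%N by rewrite -(same_size sh).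
have lPM : (l < size (M j))%N by rewrite -(same_size sh).
have n0 : 0 < n by rewrite /n ltr0n link_size.
have s0I : 0 < s0 < 1.
  rewrite /s0 divr_gt0 ?ltr_wpDl //= ltr_pdivrMr // mul1r.
  by apply: (@lt_le_trans _ _ (l%:R + 1)); rewrite ?ltrD2l // natr1 ler_nat.
have s0I' : 0 <= s0 <= 1 by case/andP: s0I => a b; rewrite !ltW.
have lE : loop (L j) s0 = edge_point (L j) l u by rewrite /s0 loopE ?lP // !ltW.
have lEM : loop (M j) s0 = edge_point (M j) l u.
  by rewrite /s0 /n (same_size sh) loopE ?lPM // !ltW.
have [||lam lam0 eL] := edge_arg_level lL kP lP tI uI' _ _ shE.
- by rewrite -lE; apply: planar_vertex.
- by rewrite -lE; apply: vertex_succ => // k' k'P; apply: planar_vertex.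
have shM : shadow (edge_point (M i) k t) = shadow (edge_point (M j) l u).
  by rewrite -!(same_edge_point sh) ?link_size.
have [||lam' lam'0 eM] := edge_arg_level lM kPM lPM tI uI' _ _ shM.
- by rewrite -lEM; apply: (planar_vertex' lL rL sh).
- by rewrite -lEM; apply: vertex_succ => // k' k'P; apply: (planar_vertex' lL rL sh).
rewrite -(same_size sh) -/n -/s0 -/(EM s0) in eM; rewrite -/n -/s0 -/(EL s0) in eL.
have lpL : is_loop EL by apply: EL_loop.
have lpM : is_loop EM by apply: (EM_loop lL lM rL sh).
have eI s : 0 <= s <= 1 -> Im (EL s) = Im (EM s) by exact: EL_EM.
have eR s : 0 <= s < 1 -> s != s0 -> Im (EL s) = 0 -> 0 < Re (EL s) * Re (EM s).
  move=> sI sn I0.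
  have [pos|[t' [l' [u' [dp sE [x x0 eLM]]]]]] := edge_arg_zero lL lM rL sh ij kP sI I0.
    exact: pos.
  rewrite /EL /EM eLM; apply: (mulr_gt0 x0).
  by apply: others => //; apply: contraNneq sn => -[e1 e2]; rewrite sE /s0 /n e1 e2.
have eR' s : 0 <= s < 1 -> s != s0 -> Im (EM s) = 0 -> 0 < Re (EM s) * Re (EL s).
  move=> sI sn; rewrite -eI; last by case/andP: sI => -> /ltW.
  by rewrite mulrC; exact: eR.
pose C := cross2 (edge_dir L c) (edge_dir L d).
(* so close to s0 the second loop stays on its edge l *)
pose dl := Num.min u (1 - u) / n.
have dl0 : 0 < dl by rewrite /dl divr_gt0 // lt_min u0 subr_gt0.
have slope s : 0 <= s <= 1 -> `|s - s0| < dl -> Im (EL s) = (n * C) * (s - s0).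
  move=> sI sd.
  have nn : n != 0 by rewrite gt_eqF.
  have nd : `|n * s - (l%:R + u)| < Num.min u (1 - u).
    have -> : n * s - (l%:R + u) = n * (s - s0) by rewrite /s0; field.
    by rewrite normrM (ger0_norm (ltW n0)) mulrC -ltr_pdivlMr.
  have vI : 0 <= n * s - l%:R <= 1.
    exact: dist_itv nd.
  have uI2 : 0 <= u <= 1 by rewrite !ltW.
  have := edge_arg_slope kP lP uI2 vI shE.
  rewrite addrCA subrr addr0 [n * s]mulrC mulfK // => ->; rewrite -/c -/d -/C /s0.
  by field.
have slope' s : 0 <= s <= 1 -> `|s - s0| < dl -> Im (EM s) = (n * C) * (s - s0).
  by move=> sI sd; rewrite -(slope s sI sd); exact: (esym (eI s sI)).
have C0 : n * C != 0 by rewrite mulf_neq0 // gt_eqF.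
have Cs : (0 < n * C) = (0 < C) by rewrite pmulr_rgt0.
have nL := level_neq lL dcd.
have nM := level_neq lM (same_double_point sh dcd).
have [h|h|h] := ltrgtP (level L d) (level L c); last by move: nL; rewrite h eqxx.
  have [h'|h'|h'] := ltrgtP (level M c) (level M d); last by move: nM; rewrite h' eqxx.
    left; split => //; rewrite -/C -Cs.
    apply: (winding_jump_slope lpL lpM s0I dl0 C0 eI eR _ slope).
    by apply/andP; split; [rewrite eM pmulr_rlt0 // subr_lt0|rewrite eL pmulr_rgt0 // subr_gt0].
  by right; right; rewrite mulr_gt0 // subr_gt0.
have [h'|h'|h'] := ltrgtP (level M d) (level M c); last by move: nM; rewrite h' eqxx.
  right; left; split => //; rewrite -/C -Cs.
  apply: (winding_jump_slope lpM lpL s0I dl0 C0 _ eR' _ slope').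
    by move=> s sI; exact: (esym (eI s sI)).
  by apply/andP; split; [rewrite eL pmulr_rlt0 // subr_lt0|rewrite eM pmulr_rgt0 // subr_gt0].
by right; right; rewrite nmulr_rgt0 ?subr_lt0.
Qed.

End OneEdge.

Lemma in_crossing i k (t : R) j l (u : R) a b :
  ((i, k, t), (j, l, u)) \in [:: (a, b); (b, a)] ->
  (a = (i, k, t) /\ b = (j, l, u)) \/ (b = (i, k, t) /\ a = (j, l, u)).
Proof. by rewrite !inE => /orP[] /eqP[-> ->]; [left|right]. Qed.

Section Formula.
Variables a b : place R I.
Hypotheses (dab : double_point L a b) (ab : a.1.1 != b.1.1) (ab_up : above L a b).
Hypothesis change : forall c d, double_point L c d ->
  above M c d = ((c, d) \in [:: (a, b); (b, a)]) (+) above L c d.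

Lemma unchanged c d : double_point L c d -> (c, d) \notin [:: (a, b); (b, a)] ->
  0 < (level L c - level L d) * (level M c - level M d).
Proof.
move=> dcd ncd; have := change dcd; rewrite (negbTE ncd) addFb /above.
rewrite -[height (at_place M c)]/(level M c) -[height (at_place M d)]/(level M d).
rewrite -[height (at_place L c)]/(level L c) -[height (at_place L d)]/(level L d).
have nL := level_neq lL dcd; have nM := level_neq lM (same_double_point sh dcd).
have [h|h|h] := ltrgtP (level L d) (level L c); last by move: nL; rewrite h eqxx.
  by move=> h'; rewrite mulr_gt0 // subr_gt0.
move=> /negbT; rewrite -leNgt le_eqVlt (negPf nM) /= => h'.
by rewrite nmulr_rgt0 subr_lt0.
Qed.

Lemma changed : level L b < level L a /\ level M a < level M b.
Proof.
split; first exact: ab_up.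
have := change dab; rewrite inE eqxx /= ab_up /above.
rewrite -[height (at_place M a)]/(level M a) -[height (at_place M b)]/(level M b) /=.
move=> /negbT; rewrite -leNgt le_eqVlt (negPf (level_neq lM (same_double_point sh dab))).
by [].
Qed.

Definition turn : R := cross2 (edge_dir L b) (edge_dir L a).

(** For a passing over b this is minus the sign of the crossing: turning a
positive crossing into a negative one lowers the linking number. *)
Definition turn_sign : int := if 0 < turn then 1 else -1.

Hypothesis transverse : turn != 0.

(** Only the factor of one edge is affected: that of the edge of a if i is the
component of a, and that of the edge of b if i is the component of b.  In
the second case the edge passes from below to above the other strand instead of
the reverse, but the two directions are multiplied in the opposite order as well;
so the signs agree. *)
Lemma crossing_lk i j : i != j ->
  lk (M i) (M j) = lk (L i) (L j)
    + (if ((i, j) == (a.1.1, b.1.1)) || ((i, j) == (b.1.1, a.1.1)) then turn_sign else 0).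
Proof.
move=> ij; rewrite (lk_edges_M lL lM rL sh ij) (lk_edges_L lL rL ij).
have same k : (k < size (L i))%N ->
    (forall t l u, double_point L (i, k, t) (j, l, u) ->
      ((i, k, t), (j, l, u)) \notin [:: (a, b); (b, a)]) ->
    winding (edge_arg (M i) (loop (M j)) k) = winding (edge_arg (L i) (loop (L j)) k).
  move=> kP H; apply/esym/winding_same.
  - exact: EL_loop.
  - exact: (EM_loop lL lM rL sh).
  - by move=> s sI; exact: EL_EM.
  move=> s sI I0.
  have [pos|[t' [l' [u' [dp sE [x x0 eLM]]]]]] := edge_arg_zero lL lM rL sh ij kP sI I0.
    exact: pos.
  rewrite eLM; apply: (mulr_gt0 x0).
  by apply: (unchanged dp); apply: H.
have [chL chM] := changed.
have nt : 0 < cross2 (edge_dir L a) (edge_dir L b) = (turn < 0).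
  have -> : cross2 (edge_dir L a) (edge_dir L b) = - turn by rewrite /turn /cross2; ring.
  by rewrite oppr_gt0.
have [/andP[/eqP ia /eqP jb]|nab] := boolP ((i == a.1.1) && (j == b.1.1)).
  rewrite ia jb eqxx /= -ia -jb.
  have aE : a = (i, a.1.2, a.2) by rewrite ia; case: (a) => [[]].
  have bE : b = (j, b.1.2, b.2) by rewrite jb; case: (b) => [[]].
  have [[kP _] _ _ _] := dab; rewrite -ia in kP.
  apply: (sum_bump kP) => k kP'; case: eqVneq => [->|kn].
    have dab' := dab; rewrite aE bE in dab'.
    have [||[]|[]] := @one_edge_jump i j a.1.2 b.1.2 a.2 b.2 ij dab'.
    - move=> t l u dp ne; apply: (unchanged dp); apply/negP => /in_crossing[[ea eb]|[eb ea]].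
        by move: ne; rewrite eb eqxx.
      by move: ij; rewrite jb eb eqxx.
    - rewrite -aE -bE; move: transverse; apply: contra_neq => e.
      have -> : turn = - cross2 (edge_dir L a) (edge_dir L b) by rewrite /turn /cross2; ring.
      by rewrite e oppr0.
    - move=> _ _ e; rewrite [LHS]e -aE -bE nt; congr (_ + _); rewrite /turn_sign.
      by move: transverse; case: ltrgtP.
    - by move=> []; rewrite -aE -bE => h; have := lt_trans h chL; rewrite ltxx.
    - rewrite -aE -bE nmulr_lgt0 ?subr_lt0 // => h.
      by have := lt_trans h chL; rewrite ltxx.
  rewrite addr0; apply: (same _ kP') => t l u dp; apply/negP => /in_crossing[[ea eb]|[eb ea]].
    by move: kn; rewrite ea eqxx.
  by move: ij; rewrite jb eb eqxx.
have [/andP[/eqP ib /eqP ja]|nba] := boolP ((i == b.1.1) && (j == a.1.1)).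
  rewrite ib ja eqxx orbT /= -ib -ja.
  have aE : a = (j, a.1.2, a.2) by rewrite ja; case: (a) => [[]].
  have bE : b = (i, b.1.2, b.2) by rewrite ib; case: (b) => [[]].
  have [_ [kP _] _ _] := dab; rewrite -ib in kP.
  apply: (sum_bump kP) => k kP'; case: eqVneq => [->|kn].
    have dab' := double_pointC dab; rewrite aE bE in dab'.
    have [||[]|[]] := @one_edge_jump i j b.1.2 a.1.2 b.2 a.2 ij dab'.
    - move=> t l u dp ne; apply: (unchanged dp); apply/negP => /in_crossing[[ea eb]|[eb ea]].
        by move: ij; rewrite ja ea eqxx.
      by move: ne; rewrite ea eqxx.
    - by rewrite -aE -bE; exact: transverse.
    - by rewrite -aE -bE => h; have := lt_trans h chL; rewrite ltxx.
    - move=> [_ _ e]; rewrite -aE -bE -/turn -/turn_sign in e.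
      by apply/esym; rewrite [X in X + _]e subrK.
    - rewrite -aE -bE pmulr_lgt0 ?subr_gt0 // => h.
      by have := lt_trans h chL; rewrite ltxx.
  rewrite addr0; apply: (same _ kP') => t l u dp; apply/negP => /in_crossing[[ea eb]|[eb ea]].
    by move: ij; rewrite ja ea eqxx.
  by move: kn; rewrite eb eqxx.
have -> : ((i, j) == (a.1.1, b.1.1)) || ((i, j) == (b.1.1, a.1.1)) = false.
  by rewrite -!pair_eqE /= (negPf nab) (negPf nba).
rewrite addr0; apply: eq_big_nat => k /andP[_ kP]; apply: (same _ kP) => t l u dp; apply/negP => /in_crossing[[ea eb]|[eb ea]].
  by move: nab; rewrite ea eb /= !eqxx.
by move: nba; rewrite ea eb /= !eqxx.
Qed.

End Formula.
End TwoLinks.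

(** Parallel edges through a common shadow point share a whole segment of
shadow points, hence infinitely many double points. *)
Lemma regular_transverse (L : polygons R I) a b : regular L -> double_point L a b ->
  turn L a b != 0.
Proof.
move=> rL dab; have [rf r2 _] := rL; apply/eqP => T0.
have [aI bI] := double_point_itv rL dab.
have [[ha1 _] [hb1 _] nab] := dab; rewrite /at_place => /shadow_eq[h0 h1].
have /andP[a0 a1] := aI; have /andP[b0 b1] := bI.
pose at_ c (t : R) : place R I := (c.1, t).
have move_ c t : is_place L c -> 0 < t < 1 -> is_place L (at_ c t).
  by move=> [hc _] /andP[t0 t1]; split => //=; rewrite (ltW t0).
have cxat c t : cx (at_place L (at_ c t)) = cx (at_place L c) + (t - c.2) * cx (edge_dir L c).
  by rewrite /at_place /edge_point /edge_dir !cE /=; ring.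
have cyat c t : cy (at_place L (at_ c t)) = cy (at_place L c) + (t - c.2) * cy (edge_dir L c).
  by rewrite /at_place /edge_point /edge_dir !cE /=; ring.
have [pa pb _ _] := dab.
(* all points of a vertical edge have the same shadow, which gives a triple point *)
have const c d : double_point L c d -> planar_neq0 (edge_dir L c).
  move=> dcd; have [cI _] := double_point_itv rL dcd; have /andP[c0 c1] := cI.
  have [pc pd ncd /shadow_eq[e0 e1]] := dcd.
  apply/negPn/negP; rewrite /planar_neq0 negb_or !negbK => /andP[/eqP z0 /eqP z1].
  have [neq|eqd] := eqVneq (at_ c (c.2 / 2)) d.
    have : double_point L d (at_ c (c.2 / 4)).
      split => //; first by apply: move_ => //; apply/andP; split; lra.
        rewrite -neq => -[] e; have : c.2 = 0 by lra.
        by move=> h; rewrite h ltxx in c0.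
      by apply/shadow_eq; rewrite cxat cyat z0 z1 !mulr0 !addr0.
    move=> h; have := r2 _ _ _ (double_pointC dcd) h.
    move=> /(congr1 snd) /= h'; lra.
  have : double_point L d (at_ c (c.2 / 2)).
    split => //; first by apply: move_ => //; apply/andP; split; lra.
      by move=> e; rewrite e eqxx in eqd.
    by apply/shadow_eq; rewrite cxat cyat z0 z1 !mulr0 !addr0.
  move=> h; have := r2 _ _ _ (double_pointC dcd) h.
  by move=> /(congr1 snd) /= h'; lra.
have na := const _ _ dab.
have [lam lx ly] : exists2 lam : R, cx (edge_dir L b) = lam * cx (edge_dir L a) & cy (edge_dir L b) = lam * cy (edge_dir L a).
  move: T0; rewrite /turn /cross2 => T0.
  case/orP: na => z.
    exists (cx (edge_dir L b) / cx (edge_dir L a)); first by field.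
    rewrite mulrAC; apply: (canRL (mulfK z)).
    by apply/eqP; rewrite -subr_eq0 -oppr_eq0 -T0; apply/eqP; ring.
  exists (cy (edge_dir L b) / cy (edge_dir L a)); last by field.
  rewrite mulrAC; apply: (canRL (mulfK z)).
  by apply/eqP; rewrite -subr_eq0 -T0; apply/eqP; ring.
(* steps so small that both points stay inside their edges *)
pose eta : R := Num.min (1 - b.2) (Num.min a.2 (1 - a.2) / (1 + `|lam|)).
have l1 : 0 < 1 + `|lam| by rewrite ltr_pwDl.
have eta0 : 0 < eta.
  by rewrite /eta lt_min subr_gt0 b1 divr_gt0 // lt_min a0 subr_gt0.
pose e (m : nat) : R := eta / m.+2%:R.
have eI m : 0 < e m < eta.
  rewrite /e divr_gt0 //= ltr_pdivrMr // -{1}[eta]mulr1 ltr_pM2l // ltr1n //.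
have einj : injective e.
  have en : eta != 0 by rewrite gt_eqF.
  move=> m m' /(mulfI en)/invr_inj/eqP; rewrite eqr_nat.
  by move=> /eqP[].
pose f m := (at_ a (a.2 + lam * e m), at_ b (b.2 + e m)).
have fD m : double_point L (f m).1 (f m).2.
  have /andP[em0 em1] := eI m.
  have e1 : e m < 1 - b.2 by apply: (lt_le_trans em1); rewrite /eta ge_min lexx.
  have e2 : e m * (1 + `|lam|) < Num.min a.2 (1 - a.2).
    by rewrite -ltr_pdivlMr //; apply: (lt_le_trans em1); rewrite /eta ge_min lexx orbT.
  have e3 : `|lam * e m| < Num.min a.2 (1 - a.2).
    apply: le_lt_trans e2; rewrite normrM (gtr0_norm em0) mulrC.
    by rewrite ler_pM2l // lerDr.
  move: e3; rewrite lt_min !ltr_norml => /andP[/andP[h2 h3] /andP[h4 h5]].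
  split => /=; try by apply: move_ => //; apply/andP; split; lra.
    move=> /= E; move: nab.
    have E1 : a.1 = b.1 by case: E.
    have E2 : a.2 + lam * e m = b.2 + e m by case: E.
    have lam1 : lam = 1.
      have dE : edge_dir L a = edge_dir L b by rewrite /edge_dir E1.
      case/orP: na => z.
        by apply: (mulIf z); rewrite -lx dE mul1r.
      by apply: (mulIf z); rewrite -ly dE mul1r.
    move=> nab'; apply: nab'; move: E1 E2; rewrite lam1 mul1r; case: (a) => x1 x2; case: (b) => y1 y2 /= -> E2.
    by congr pair; apply: (addIr (e m)).
  have r (y x : R) : y + x - y = x by rewrite addrAC subrr add0r.
  apply/shadow_eq; rewrite (cxat a) (cxat b) (cyat a) (cyat b) !r lx ly.
  by split; rewrite -[in LHS]mulrA [in RHS]mulrCA; congr (_ + _); [exact: h0|exact: h1].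
have finj : injective f.
  by move=> m m' /(congr1 (fun p => p.2.2)) /= /addrI/einj.
apply: infinite_nat.
have := @finite_preimage _ _ [set ab : place R I * place R I | double_point L ab.1 ab.2] f.
move=> /(_ _ rf) H; apply: (sub_finite_set _ (H _)); first by move=> m _ /=; exact: fD.
by move=> m m' _ _ /finj.
Qed.

End CrossingFormula.

(** * A lower bound for the splitting number *)

Lemma sum_bump_at (T : finType) (D : pred T) (F G : T -> int) (p0 : T) (z : int) :
  D p0 -> (forall p, D p -> F p = G p + (if p == p0 then z else 0)) ->
  \sum_(p | D p) F p = \sum_(p | D p) G p + z.
Proof.
move=> D0 H; rewrite (eq_bigr _ H) big_split /=; congr (_ + _).
by rewrite (bigD1 p0) //= eqxx big1 ?addr0 // => p /andP[_ /negbTE ->].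
Qed.

Lemma sum_norm_bump_at (T : finType) (D : pred T) (F G : T -> int) (p0 : T) (z : int) :
  D p0 -> `|z| <= 1 -> (forall p, D p -> F p = G p + (if p == p0 then z else 0)) ->
  \sum_(p | D p) `|G p| <= \sum_(p | D p) `|F p| + 1.
Proof.
move=> D0 z1 H; rewrite (bigD1 p0) //= [X in _ <= X + 1](bigD1 p0) //=.
rewrite [X in _ <= _ + X + 1](eq_bigr (fun p => `|G p|)); last first.
  by move=> p /andP[Dp /negbTE np]; rewrite H // np addr0.
by rewrite addrAC lerD2r H // eqxx; lia.
Qed.

Section LowerBound.
Variable R : realType.
Variable I : finType.
Implicit Types (L M : polygons R I) (a b c d : place R I) (i j : I).

(** Each pair of components is counted once. *)
Definition ordered (p : I * I) : bool := (enum_rank p.1 < enum_rank p.2)%N.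

Definition lk_sum L : int := \sum_(p | ordered p) lk (L p.1) (L p.2).
Definition lk_abs L : int := \sum_(p | ordered p) `|lk (L p.1) (L p.2)|.

Lemma ordered_neq p : ordered p -> p.1 != p.2.
Proof. by rewrite /ordered; apply: contraTneq => ->; rewrite ltnn. Qed.

Lemma isotopic_lk_abs L M : is_link L -> is_link M -> link_isotopic L M ->
  lk_abs L = lk_abs M.
Proof.
move=> lL lM [H [cH hH H0 H1]]; apply: eq_bigr => p /ordered_neq pn.
have Hinj t : 0 <= t <= 1 -> injective (H t).
  by move=> tI; have [_ [g [_ gK _]]] := hH t tI; exact: can_inj gK.
by apply: (isotopy_lk _ _ _ _ _ _ cH Hinj H0 (H1 p.1) (H1 p.2));
  [exact: link_simple|exact: link_simple|exact: link_simple|exact: link_simple|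
   exact: link_apart|exact: link_apart].
Qed.

Lemma ball_convex (c x y : space R) (r t : R) : 0 <= t <= 1 ->
  ball c r x -> ball c r y -> ball c r ((1 - t) *: x + t *: y).
Proof.
rewrite -!ball_normE /ball_ /= => /andP[t0 t1] hx hy.
have -> : c - ((1 - t) *: x + t *: y) = (1 - t) *: (c - x) + t *: (c - y).
  by apply/rowP => k; rewrite !mxE; ring.
apply: (le_lt_trans (ler_normD _ _)); rewrite !normrZ (ger0_norm t0) ger0_norm ?subr_ge0 //.
have [->|tn] := eqVneq t 0; first by rewrite subr0 mul1r mul0r addr0.
have : t * `|c - y| < t * r by rewrite ltr_pM2l // lt_neqAle eq_sym tn.
have : (1 - t) * `|c - x| <= (1 - t) * r by rewrite ler_wpM2l ?subr_ge0 // ltW.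
by move=> h1 h2; apply: (lt_le_trans (ler_ltD h1 h2)); rewrite -mulrDl subrK mul1r.
Qed.

(** The second polygon is contracted to a point within its ball. *)
Lemma split_lk0 (P Q : polygon R) (c c' : space R) (r r' : R) :
  (0 < size P)%N -> (0 < size Q)%N ->
  carrier P `<=` ball c r -> carrier Q `<=` ball c' r' ->
  (forall x, ball c r x -> ~ ball c' r' x) -> lk P Q = 0.
Proof.
move=> P0 Q0 Pc Qc' cc'.
have z01 : 0 <= (0 : R) <= 1 by rewrite lexx ler01.
pose B (p : R * R) := (1 - p.1) *: loop Q p.2 + p.1 *: loop Q 0.
have cB : continuous B.
  apply: addv_cont; apply: scalev_cont.
  - by apply: cfB; [exact: cf_cst|exact: cf_fst].
  - exact: (cf_comp (@cf_snd _ _) (@loop_cont R Q)).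
  - exact: cf_fst.
  - by move=> ?; exact: cvg_cst.
have off p : unit_sq p -> ~ carrier P (B p).
  case: p => t s [/unit_itvP tI /unit_itvP sI] /Pc h; apply: (cc' _ h).
  by apply: ball_convex => //; apply: Qc'; apply: loop_carrier.
have := @winding_homotopy R (fun p => solid P (B p)).
have -> : (fun s => solid P (B (0, s))) = (fun s => solid P (loop Q s)).
  by apply/funext => s; rewrite /B /= subr0 scale1r scale0r addr0.
have -> : (fun s => solid P (B (1, s))) = (fun=> solid P (loop Q 0)).
  by apply/funext => s; rewrite /B /= subrr scale1r scale0r add0r.
rewrite -/(lk P Q) winding_cst; last first.
  apply: solid_neq0 => // /Pc h; apply: (cc' _ h); apply: Qc'.
  exact: (loop_carrier Q0 z01).
apply; first exact: solid_loop_cont.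
  by move=> p pI; apply: solid_neq0 => //; exact: off.
by move=> t tI; rewrite /B /= loop_closed.
Qed.

Lemma split_lk L M i j : is_link M -> split_union_of L M -> i != j ->
  lk (M i) (M j) = 0.
Proof.
move=> lM [_ [c [r [Mc tr]]]] /eqP ij.
rewrite (@split_lk0 _ _ (c i) (c j) (r i) (r j)) ?link_size //.
move=> x x1 x2; apply: ij; apply: tr => //; by exists x.
Qed.

Lemma split_lk_abs L M : is_link M -> split_union_of L M -> lk_abs M = 0.
Proof.
by move=> lM s; rewrite /lk_abs big1 // => p /ordered_neq /(split_lk lM s) ->.
Qed.

Lemma split_lk_sum L M : is_link M -> split_union_of L M -> lk_sum M = 0.
Proof.
by move=> lM s; rewrite /lk_sum big1 // => p /ordered_neq /(split_lk lM s) ->.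
Qed.

Definition crossing_change_at L M a b : Prop :=
  [/\ regular L, same_shadow L M, double_point L a b, a.1.1 != b.1.1 &
   above L a b /\ forall c d, double_point L c d ->
     above M c d = ((c, d) \in [:: (a, b); (b, a)]) (+) above L c d].

(** Of the two places of the crossing, the first is chosen to be the upper one. *)
Lemma crossing_change_above L M : is_link L -> crossing_change L M ->
  exists a b, crossing_change_at L M a b.
Proof.
move=> lL [rL sh [a [b [dab ab ch]]]].
have := level_neq lL dab; case: ltrgtP => // h _; last first.
  by exists a, b; split.
exists b, a; split => //; first exact: double_pointC; first by rewrite eq_sym.
by split=> // c d dcd; rewrite ch // !inE orbC.
Qed.

Lemma crossing_lk_ordered L M a b : is_link L -> is_link M -> crossing_change_at L M a b ->
  exists2 p0, ordered p0 & forall p, ordered p ->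
    lk (M p.1) (M p.2) = lk (L p.1) (L p.2) + (if p == p0 then turn_sign L a b else 0).
Proof.
move=> lL lM [rL sh dab ab [up ch]].
have key p := crossing_lk lL lM rL sh dab up ch (regular_transverse rL dab) (i := p.1) (j := p.2).
have rn : enum_rank a.1.1 != enum_rank b.1.1 by apply: contra_neq ab; exact: enum_rank_inj.
have [h|h] := ltnP (enum_rank a.1.1) (enum_rank b.1.1).
  exists (a.1.1, b.1.1) => // p po; rewrite key ?ordered_neq // -surjective_pairing.
  have -> // : (p == (b.1.1, a.1.1)) = false; last by rewrite orbF.
  by apply: contraTF po => /eqP ->; rewrite /ordered /= -leqNgt ltnW.
exists (b.1.1, a.1.1).
  by rewrite /ordered /= ltn_neqAle h andbT eq_sym; apply: contra_neq rn => /val_inj.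
move=> p po; rewrite key ?ordered_neq // -surjective_pairing.
have -> // : (p == (a.1.1, b.1.1)) = false.
by apply: contraTF po => /eqP ->; rewrite /ordered /= -leqNgt.
Qed.

Lemma crossing_lk_sum L M a b : is_link L -> is_link M -> crossing_change_at L M a b ->
  lk_sum M = lk_sum L + turn_sign L a b.
Proof.
move=> lL lM /(crossing_lk_ordered lL lM)[p0 p0o H].
exact: (sum_bump_at p0o H).
Qed.

Lemma crossing_lk_abs L M a b : is_link L -> is_link M -> crossing_change_at L M a b ->
  lk_abs L <= lk_abs M + 1.
Proof.
move=> lL lM /(crossing_lk_ordered lL lM)[p0 p0o H].
apply: (sum_norm_bump_at p0o _ H).
by rewrite /turn_sign; case: ifP; rewrite ?normrN normr1.
Qed.

Lemma reachable_link L n M : reachable L n M -> is_link M.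
Proof. by case. Qed.

Lemma reachable_lk_abs L n M : reachable L n M -> lk_abs L <= lk_abs M + n%:Z.
Proof.
elim=> [l0|m M' N' r IH lN iso|m M' N' r IH lN cc]; first by rewrite addr0.
  by rewrite -(isotopic_lk_abs (reachable_link r) lN iso).
have [a [b cab]] := crossing_change_above (reachable_link r) cc.
have := crossing_lk_abs (reachable_link r) lN cab; lia.
Qed.

(** Each crossing change lowers the sum of the absolute linking numbers by at
most one, and this sum ends at zero. *)
Lemma splits_lower_bound L m : splits_in L m -> `|lk_sum L| <= m%:Z.
Proof.
move=> [M [r s]]; have := reachable_lk_abs r.
rewrite (split_lk_abs (reachable_link r) s) add0r; apply: le_trans.
exact: ler_norm_sum.
Qed.

End LowerBound.

(** * Shadows of closed braids *)

Section BraidModel.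
Variable R : realType.
Variables (n : nat) (ix : seq nat).
Hypothesis ixn : all (fun i => (i < n)%N) ix.
Local Notation m := (size ix).
Implicit Types (s r j : nat) (t : R).

Definition swapn (i x : nat) : nat :=
  if x == i then i.+1 else if x == i.+1 then i else x.

Lemma swapnK i : involutive (swapn i).
Proof.
move=> x; rewrite /swapn; case: (eqVneq x i) => [->|xi]; first by rewrite eqxx; case: eqP => //; lia.
case: (eqVneq x i.+1) => [->|xi']; first by rewrite eqxx.
by rewrite (negPf xi) (negPf xi').
Qed.

Definition slot_index j : nat := nth 0%N ix j.

(** The slot reached by strand s before letter j.  All slots are plain natural
numbers in this part; ix is the list of slot indices of the letters. *)
Definition pos j s : nat := foldl (fun x i => swapn i x) s (take j ix).

Lemma slot_index_lt j : (j < m)%N -> (slot_index j < n)%N.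
Proof. by move=> jm; have /all_nthP := ixn; apply. Qed.

Lemma pos0 s : pos 0 s = s.
Proof. by rewrite /pos take0. Qed.

Lemma posS j s : (j < m)%N -> pos j.+1 s = swapn (slot_index j) (pos j s).
Proof. by move=> jm; rewrite /pos (take_nth 0%N) // foldl_rcons. Qed.

Lemma pos_oversize j s : (m <= j)%N -> pos j s = pos m s.
Proof. by move=> mj; rewrite /pos take_oversize // take_size. Qed.

Lemma pos_inj j : injective (pos j).
Proof.
elim: j => [|j IHj] s s'; first by rewrite !pos0.
have [jm|mj] := ltnP j m; first by rewrite !posS // => /(can_inj (swapnK _))/IHj.
by rewrite [pos j.+1 s]pos_oversize 1?[pos j.+1 s']pos_oversize ?leqW // -!(pos_oversize _ mj) => /IHj.
Qed.

Lemma pos_le j s : (s <= n)%N -> (pos j s <= n)%N.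
Proof.
move=> sn; elim: j => [|j IHj]; first by rewrite pos0.
have [jm|mj] := ltnP j m; last by rewrite (@pos_oversize j.+1) ?leqW // -(pos_oversize _ mj).
rewrite posS // /swapn; have := slot_index_lt jm.
by case: eqP => _; [|case: eqP => _]; lia.
Qed.

Definition over (b : nat -> bool) j (x : nat) : bool :=
  if b j then x == slot_index j else x == (slot_index j).+1.

(** The r-th vertex of the part of a braid closure that starts at bottom slot s
and ends after its closing arc; b tells the signs of the letters.  The list of
closing vertices includes the start of the next strand, so that every edge of
this part joins consecutive values of r. *)
Definition bvertex (b : nat -> bool) s r : space R :=
  if (r < 3 * m)%N then
    let j := (r %/ 3)%N in
    let x : R := (pos j s)%:R in let x' : R := (pos j.+1 s)%:R in
    let h : R := (over b j (pos j s))%:R in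
    [:: xyz x j%:R 0; xyz ((3 * x + x') / 4) (j%:R + 1 / 4) h;
        xyz ((x + 3 * x') / 4) (j%:R + 3 / 4) h]`_(r %% 3)
  else
    let x : R := (pos m s)%:R in let d : R := (n - pos m s)%N.+1%:R in
    [:: xyz x m%:R 0; xyz x (m%:R + d) 0; xyz (n%:R + d) (m%:R + d) 0;
        xyz (n%:R + d) (- d) 0; xyz x (- d) 0; xyz x 0 0]`_(r - 3 * m).

Definition bpoint b s r t : space R := (1 - t) *: bvertex b s r + t *: bvertex b s r.+1.

Lemma cx_xyz (x y z : R) : cx (xyz x y z) = x.
Proof. by rewrite /cx mxE inordK. Qed.
Lemma cy_xyz (x y z : R) : cy (xyz x y z) = y.
Proof. by rewrite /cy mxE inordK. Qed.
Lemma cz_xyz (x y z : R) : cz (xyz x y z) = z.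
Proof. by rewrite /cz mxE inordK. Qed.
Definition xyzE := (cx_xyz, cy_xyz, cz_xyz).

Lemma bvertex_letter b s j e : (j < m)%N -> (e < 3)%N -> bvertex b s (3 * j + e) =
  [:: xyz (pos j s)%:R j%:R 0;
     xyz ((3 * (pos j s)%:R + (pos j.+1 s)%:R) / 4) (j%:R + 1 / 4) (over b j (pos j s))%:R;
     xyz (((pos j s)%:R + 3 * (pos j.+1 s)%:R) / 4) (j%:R + 3 / 4) (over b j (pos j s))%:R]`_e.
Proof.
move=> jm e3; rewrite /bvertex ifT; last by clear ixn; lia.
have -> : ((3 * j + e) %/ 3 = j)%N by rewrite mulnC divnMDl // divn_small // addn0.
by have -> : ((3 * j + e) %% 3 = e)%N by rewrite mulnC modnMDl modn_small.
Qed.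

Lemma bvertex_closing b s e : bvertex b s (3 * m + e) =
  [:: xyz (pos m s)%:R m%:R 0; xyz (pos m s)%:R (m%:R + (n - pos m s)%N.+1%:R) 0;
     xyz (n%:R + (n - pos m s)%N.+1%:R) (m%:R + (n - pos m s)%N.+1%:R) 0;
     xyz (n%:R + (n - pos m s)%N.+1%:R) (- (n - pos m s)%N.+1%:R) 0;
     xyz (pos m s)%:R (- (n - pos m s)%N.+1%:R) 0; xyz (pos m s)%:R 0 0]`_e.
Proof. by rewrite /bvertex ltnNge leq_addr addKn. Qed.

Lemma bvertex_start b s j : (j <= m)%N -> bvertex b s (3 * j) = xyz (pos j s)%:R j%:R 0.
Proof.
rewrite leq_eqVlt => /predU1P[->|jm]; first by rewrite -[(3 * m)%N]addn0 bvertex_closing.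
by rewrite -[(3 * j)%N]addn0 bvertex_letter.
Qed.

(** How far the point with parameter t on the e-th of the three edges of a
letter has advanced through the letter in the y-direction. *)
Definition phase e t : R :=
  if e == 0%N then t / 4 else if e == 1%N then 1 / 4 + t / 2 else 3 / 4 + t / 4.

Lemma letter_point b s j e t : (j < m)%N -> (e < 3)%N ->
  cx (bpoint b s (3 * j + e) t) = (pos j s)%:R + ((pos j.+1 s)%:R - (pos j s)%:R) * phase e t
  /\ cy (bpoint b s (3 * j + e) t) = j%:R + phase e t.
Proof.
move=> jm; rewrite /bpoint.
case: e => [|[|[|//]]] _; rewrite -?addnS.
- by rewrite !bvertex_letter // /phase /= !cE !xyzE; split; field.
- by rewrite !bvertex_letter // /phase /= !cE !xyzE; split; field.
- have -> : (3 * j + 3 = 3 * j.+1)%N by clear ixn; lia.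
  by rewrite bvertex_letter // bvertex_start // /phase /= !cE !xyzE -natr1; split; field.
Qed.

Lemma letter_crossing_height b s j : (j < m)%N ->
  cz (bpoint b s (3 * j + 1) (1 / 2)) = (over b j (pos j s))%:R.
Proof.
by move=> jm; rewrite /bpoint -addnS !bvertex_letter //= !cE !xyzE; field.
Qed.

Lemma letter_crossing_dir b s j : (j < m)%N ->
  cx (bvertex b s (3 * j + 2)) - cx (bvertex b s (3 * j + 1)) = ((pos j.+1 s)%:R - (pos j s)%:R) / 2
  /\ cy (bvertex b s (3 * j + 2)) - cy (bvertex b s (3 * j + 1)) = 1 / 2.
Proof.
by move=> jm; rewrite !bvertex_letter //= !xyzE; split; field.
Qed.

Lemma phase_itv e t : (e < 3)%N -> 0 <= t < 1 -> 0 <= phase e t < 1.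
Proof.
by case: e => [|[|[|//]]] _ /andP[t0 t1]; rewrite /phase /=; apply/andP; split; lra.
Qed.

Lemma phase_inj e e' t t' : (e < 3)%N -> (e' < 3)%N -> 0 <= t < 1 -> 0 <= t' < 1 ->
  phase e t = phase e' t' -> e = e' /\ t = t'.
Proof.
case: e => [|[|[|//]]] _; case: e' => [|[|[|//]]] _ /andP[t0 t1] /andP[t'0 t'1];
  rewrite /phase /= => h; (split; first (try by []; exfalso; lra)); lra.
Qed.

Lemma phase_half e t : (e < 3)%N -> 0 <= t < 1 -> phase e t = 1 / 2 -> e = 1%N /\ t = 1 / 2.
Proof.
case: e => [|[|[|//]]] _ /andP[t0 t1]; rewrite /phase /= => h.
- by exfalso; lra.
- by split=> //; lra.
- by exfalso; lra.
Qed.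

Lemma nat_phase_eq j j' (p p' : R) : 0 <= p < 1 -> 0 <= p' < 1 ->
  j%:R + p = j'%:R + p' -> j = j' /\ p = p'.
Proof.
move=> /andP[p0 p1] /andP[p'0 p'1] E; suff jj : j = j' by split=> //; move: E; rewrite jj; lra.
apply/eqP; rewrite eqn_leq; apply/andP; split; rewrite leqNgt; apply/negP => h.
  have : j'.+1%:R <= j%:R :> R by rewrite ler_nat.
  by rewrite -natr1; lra.
have : j.+1%:R <= j'%:R :> R by rewrite ler_nat.
by rewrite -natr1; lra.
Qed.

Definition crossing_slots j s s' : Prop :=
  (pos j s = slot_index j /\ pos j s' = (slot_index j).+1) \/
  (pos j s = (slot_index j).+1 /\ pos j s' = slot_index j).

(** Inside a letter the strands move linearly in terms of the phase, and only
the two exchanged ones can meet, half-way. *)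
Lemma swapn_phase i x x' (p : R) : x != x' -> 0 <= p < 1 ->
  x%:R + ((swapn i x)%:R - x%:R) * p = x'%:R + ((swapn i x')%:R - x'%:R) * p ->
  p = 1 / 2 /\ ((x = i /\ x' = i.+1) \/ (x = i.+1 /\ x' = i)).
Proof.
move=> xx' /andP[p0 p1].
have lt u v : (u < v)%N -> u%:R + 1 <= v%:R :> R by move=> uv; rewrite natr1 ler_nat.
rewrite /swapn; case: (eqVneq x i) => [xi|xi]; case: (eqVneq x' i) => [xi'|xi'].
- by move: xx'; rewrite xi xi' eqxx.
- case: (eqVneq x' i.+1) => [xi''|xi''] E.
    by split; [move: E; rewrite xi xi'' -natr1; lra|left].
  exfalso; move: E; rewrite xi subrr mul0r addr0 -natr1.
  have [h|h] := ltnP i x'; last first.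
    have := lt x' i; rewrite ltn_neqAle xi' h => /(_ isT); nra.
  have := lt i.+1 x'; rewrite ltn_neqAle eq_sym xi'' h => /(_ isT); rewrite -natr1; nra.
- case: (eqVneq x i.+1) => [xi''|xi''] E.
    by split; [move: E; rewrite xi' xi'' -natr1; lra|right].
  exfalso; move: E; rewrite xi' subrr mul0r addr0 -natr1.
  have [h|h] := ltnP i x; last first.
    have := lt x i; rewrite ltn_neqAle xi h => /(_ isT); nra.
  have := lt i.+1 x; rewrite ltn_neqAle eq_sym xi'' h => /(_ isT); rewrite -natr1; nra.
case: (eqVneq x i.+1) => [xi1|xi1]; case: (eqVneq x' i.+1) => [xi1'|xi1'].
- by move: xx'; rewrite xi1 xi1' eqxx.
- move=> E; exfalso; move: E; rewrite xi1 subrr mul0r addr0 -natr1.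
  have [h|h] := ltnP x' i.
    have := lt x' i h; nra.
  have := lt i.+1 x'; rewrite !ltn_neqAle eq_sym xi1' eq_sym xi' h => /(_ isT); rewrite -natr1; nra.
- move=> E; exfalso; move: E; rewrite xi1' subrr mul0r addr0 -natr1.
  have [h|h] := ltnP x i.
    have := lt x i h; nra.
  have := lt i.+1 x; rewrite !ltn_neqAle eq_sym xi1 eq_sym xi h => /(_ isT); rewrite -natr1; nra.
by move=> E; exfalso; move: E; rewrite !subrr !mul0r !addr0 => /eqP; rewrite eqr_nat (negPf xx').
Qed.

(** On each edge of a closing arc one coordinate is constant and the other one
varies with the distance p from its starting point.  The numbers x and d
determine each other by x + d = n + 1, so the arcs are nested. *)
Lemma closing_point b s e t : (s <= n)%N -> (e < 5)%N -> 0 <= t < 1 ->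
  let x : R := (pos m s)%:R in let d : R := n%:R - x + 1 in
  exists p q : R, [/\ 0 <= p < q, p = t * q, 0 <= x <= n%:R,
    q = [:: d; n%:R + d - x; m%:R + 2 * d; n%:R + d - x; d]`_e &
    cx (bpoint b s (3 * m + e) t) = [:: x; x + p; n%:R + d; n%:R + d - p; x]`_e /\
    cy (bpoint b s (3 * m + e) t) = [:: m%:R + p; m%:R + d; m%:R + d - p; - d; - d + p]`_e].
Proof.
move=> sn e5 /andP[t0 t1] x d.
have xn : (pos m s <= n)%N := pos_le m sn.
have dE : (n - pos m s)%N.+1%:R = d by rewrite -natr1 natrB.
have x0 : 0 <= x by rewrite ler0n.
have xn' : x <= n%:R by rewrite ler_nat.
have d1 : 1 <= d by rewrite /d lerDr subr_ge0.
have m0 : 0 <= m%:R :> R by [].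
set q := [:: d; n%:R + d - x; m%:R + 2 * d; n%:R + d - x; d]`_e.
have q0 : 0 < q by rewrite /q; case: e {q} e5 => [|[|[|[|[|//]]]]] _ /=; lra.
exists (t * q), q; split => //.
    by apply/andP; split; [exact: mulr_ge0 (ltW q0)|rewrite gtr_pMl].
  by rewrite x0.
rewrite /bpoint -addnS !bvertex_closing dE /q -/x.
by case: e {q q0} e5 => [|[|[|[|[|//]]]]] _ /=; rewrite !cE !xyzE; split; ring.
Qed.

Lemma closing_inj b s s' e e' t t' : (s <= n)%N -> (s' <= n)%N -> (e < 5)%N -> (e' < 5)%N ->
  0 <= t < 1 -> 0 <= t' < 1 ->
  cx (bpoint b s (3 * m + e) t) = cx (bpoint b s' (3 * m + e') t') ->
  cy (bpoint b s (3 * m + e) t) = cy (bpoint b s' (3 * m + e') t') ->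
  [/\ s = s', e = e' & t = t'].
Proof.
move=> sn s'n e5 e'5 tI t'I.
have [p [q [/andP[p0 pq] pE /andP[x0 xn] qE [-> ->]]]] := closing_point b sn e5 tI.
have [p' [q' [/andP[p'0 p'q] p'E /andP[x'0 x'n] q'E [-> ->]]]] := closing_point b s'n e'5 t'I.
have m0 : 0 <= m%:R :> R by [].
have fin : (pos m s)%:R = (pos m s')%:R :> R -> e = e' -> p = p' -> [/\ s = s', e = e' & t = t'].
  move=> /eqP; rewrite eqr_nat => /eqP/pos_inj ss ee pp; split => //.
  have qq : q = q' by rewrite qE q'E ss ee.
  have q0 : q != 0 by rewrite gt_eqF // (le_lt_trans p0).
  by apply: (mulIf q0); rewrite -pE pp p'E qq.
(* edges of different kinds do not meet because the arcs are nested; each of the 25 cases is linear *)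
move: qE q'E fin; case: e e5 => [|[|[|[|[|//]]]]] _; case: e' e'5 => [|[|[|[|[|//]]]]] _ /=;
  move=> qE q'E fin ex ey; first [by apply: (fin _ erefl); lra | by exfalso; lra].
Qed.

Lemma letter_closing b s s' j e e' t t' : (s <= n)%N -> (s' <= n)%N -> (j < m)%N ->
  (e < 3)%N -> (e' < 5)%N -> 0 <= t < 1 -> 0 <= t' < 1 ->
  cx (bpoint b s (3 * j + e) t) = cx (bpoint b s' (3 * m + e') t') ->
  cy (bpoint b s (3 * j + e) t) = cy (bpoint b s' (3 * m + e') t') -> False.
Proof.
move=> sn s'n jm e3 e'5 tI t'I.
have [-> ->] := letter_point b s t jm e3.
have [p' [q' [/andP[p'0 p'q] p'E /andP[x'0 x'n] q'E [-> ->]]]] := closing_point b s'n e'5 t'I.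
have /andP[h0 h1] := phase_itv e3 tI.
have a0 : (pos j s)%:R <= n%:R :> R by rewrite ler_nat pos_le.
have a1 : (pos j.+1 s)%:R <= n%:R :> R by rewrite ler_nat pos_le.
have jm' : j%:R + 1 <= m%:R :> R by rewrite natr1 ler_nat.
have j0 : 0 <= j%:R :> R by [].
have xl : (pos j s)%:R + ((pos j.+1 s)%:R - (pos j s)%:R) * phase e t <= n%:R :> R.
  have -> : (pos j s)%:R + ((pos j.+1 s)%:R - (pos j s)%:R) * phase e t
    = (1 - phase e t) * (pos j s)%:R + phase e t * (pos j.+1 s)%:R by ring.
  have : (1 - phase e t) * (pos j s)%:R <= (1 - phase e t) * n%:R by rewrite ler_wpM2l // subr_ge0 ltW.
  have : phase e t * (pos j.+1 s)%:R <= phase e t * n%:R by rewrite ler_wpM2l.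
  by lra.
move: q'E; case: e' e'5 => [|[|[|[|[|//]]]]] _ /= q'E ex ey; lra.
Qed.

Lemma strand_code r : (r < 3 * m + 5)%N ->
  (exists j e, [/\ (j < m)%N, (e < 3)%N & r = (3 * j + e)%N]) \/
  (exists2 e, (e < 5)%N & r = (3 * m + e)%N).
Proof.
move=> rT; have [h|h] := ltnP r (3 * m); last by right; exists (r - 3 * m)%N; lia.
left; exists (r %/ 3)%N, (r %% 3)%N; split; [by rewrite ltn_divLR // mulnC|by rewrite ltn_mod|].
by rewrite mulnC -divn_eq.
Qed.

(** The crossings of the letters are the only double points of the closure of
a braid. *)
Lemma bpoint_shadow_inj b s s' r r' t t' : (s <= n)%N -> (s' <= n)%N ->
  (r < 3 * m + 5)%N -> (r' < 3 * m + 5)%N -> 0 <= t < 1 -> 0 <= t' < 1 ->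
  cx (bpoint b s r t) = cx (bpoint b s' r' t') -> cy (bpoint b s r t) = cy (bpoint b s' r' t') ->
  [/\ s = s', r = r' & t = t'] \/
  exists2 j, (j < m)%N & [/\ r = (3 * j + 1)%N, r' = (3 * j + 1)%N, t = 1 / 2, t' = 1 / 2 &
    crossing_slots j s s'].
Proof.
move=> sn s'n rT r'T tI t'I.
have [[j [e [jm e3 ->]]]|[e e5 ->]] := strand_code rT;
  have [[j' [e' [j'm e'3 ->]]]|[e' e'5 ->]] := strand_code r'T.
- have [-> ->] := letter_point b s t jm e3; have [-> ->] := letter_point b s' t' j'm e'3.
  move=> ex ey; have [jj pp] := nat_phase_eq (phase_itv e3 tI) (phase_itv e'3 t'I) ey.
  have [ee tt] := phase_inj e3 e'3 tI t'I pp; subst j' e' t'.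
  have [ss|ss] := eqVneq s s'; first by left; rewrite ss.
  right; exists j => //; rewrite !posS // in ex.
  have pn : pos j s != pos j s' by apply: contra_neq ss; exact: pos_inj.
  have [ph cs] := swapn_phase pn (phase_itv e3 tI) ex.
  by have [-> ->] := phase_half e3 tI ph; split.
- by move=> ex ey; case: (letter_closing sn s'n jm e3 e'5 tI t'I ex ey).
- by move=> ex ey; case: (letter_closing s'n sn j'm e'3 e5 t'I tI (esym ex) (esym ey)).
- by move=> ex ey; left; have [-> -> ->] := closing_inj sn s'n e5 e'5 tI t'I ex ey.
Qed.

Lemma crossing_shadow b s s' j : (j < m)%N -> crossing_slots j s s' ->
  cx (bpoint b s (3 * j + 1) (1 / 2)) = cx (bpoint b s' (3 * j + 1) (1 / 2)) /\
  cy (bpoint b s (3 * j + 1) (1 / 2)) = cy (bpoint b s' (3 * j + 1) (1 / 2)).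
Proof.
move=> jm cs.
have [-> ->] := letter_point b s (1 / 2) jm (isT : (1 < 3)%N).
have [-> ->] := letter_point b s' (1 / 2) jm (isT : (1 < 3)%N).
split => //; rewrite !posS //.
have ph : phase 1 (1 / 2) = 1 / 2 by rewrite /phase /=; field.
have ne : ((slot_index j).+1 == slot_index j) = false by rewrite eqn_leq ltnn.
rewrite /crossing_slots in cs; rewrite ph; move: (pos j s) (pos j s') cs => y y' cs.
by case: cs => -[-> ->]; rewrite /swapn eqxx ne eqxx -natr1; lra.
Qed.

End BraidModel.

(** * Closed braids with lifted components *)

Section Diagrams.
Variable R : realType.
Variable n : nat.
Implicit Types (w : braid_word n) (s : 'I_n.+1).

Definition slots w : seq nat := [seq nat_of_ord g.1 | g : 'I_n * bool <- w].
Definition bits w (j : nat) : bool := nth false [seq g.2 | g : 'I_n * bool <- w] j.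

Lemma size_slots w : size (slots w) = size w.
Proof. exact: size_map. Qed.

Lemma slots_lt w : all (fun i => (i < n)%N) (slots w).
Proof. by apply/allP => i /mapP[g _ ->]; exact: ltn_ord. Qed.

Lemma swap_slotsE (i : 'I_n) s : swap_slots i s = swapn i s :> nat.
Proof.
rewrite /swap_slots /swapn; case: tpermP => [->|->|].
- by rewrite /= eqxx /bump leq0n add1n.
- by rewrite /= /bump leq0n add1n eqxx; case: eqP => //; lia.
- move=> /eqP h0 /eqP h1; have -> : (s == i :> nat) = false by rewrite -(negbTE h0).
  have -> // : (s == i.+1 :> nat) = false by rewrite -(negbTE h1).
Qed.

Lemma braid_permE w s : braid_perm w s = pos (slots w) (size w) s :> nat.
Proof.
rewrite /pos take_oversize ?size_slots // /braid_perm.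
elim: w s => [|g w IHw] s /=; first by rewrite big_nil perm1.
by rewrite big_cons permM IHw swap_slotsE.
Qed.

Lemma size_strand w j s : size (strand_vertices R w j s) = (3 * size w)%N.
Proof. by elim: w j s => [|g w IHw] j s //=; rewrite IHw; lia. Qed.

Lemma nth_strand w j0 s j e : (j < size w)%N -> (e < 3)%N ->
  (strand_vertices R w j0 s)`_(3 * j + e) =
  [:: xyz (pos (slots w) j s)%:R (j0 + j)%:R 0;
     xyz ((3 * (pos (slots w) j s)%:R + (pos (slots w) j.+1 s)%:R) / 4) ((j0 + j)%:R + 1 / 4)
       (over (slots w) (bits w) j (pos (slots w) j s))%:R;
     xyz (((pos (slots w) j s)%:R + 3 * (pos (slots w) j.+1 s)%:R) / 4) ((j0 + j)%:R + 3 / 4)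
       (over (slots w) (bits w) j (pos (slots w) j s))%:R]`_e :> space R.
Proof.
elim: w j0 s j => [//|g w IHw] j0 s j jw e3 /=.
case: j jw => [|j] jw.
  rewrite muln0 add0n addn0 /pos /= take0 /= -swap_slotsE.
  by clear IHw; case: e e3 => [|[|[|//]]].
have -> : (3 * j.+1 + e = (3 * j + e).+3)%N by lia.
by rewrite /= IHw // swap_slotsE addSnnS.
Qed.

(** The vertices follow the letters of w', and the permutation is that of w.
Keeping both separate lets words with the same slots and different signs have
components of the same type. *)
Definition strand w w' s : seq (space R) :=
  strand_vertices R w' 0 s ++ closing_vertices R (size w) (braid_perm w s).

Definition period w : nat := (3 * size w + 5)%N.

Lemma slots_size w w' : slots w' = slots w -> size w' = size w.
Proof. by move=> h; rewrite -size_slots h size_slots. Qed.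

Lemma size_strand_period w w' s : slots w' = slots w -> size (strand w w' s) = period w.
Proof. by move=> h; rewrite size_cat size_strand (slots_size h). Qed.

Lemma nth_strand_bvertex w w' s r : slots w' = slots w -> (r < period w)%N ->
  (strand w w' s)`_r = bvertex R n (slots w) (bits w') s r.
Proof.
move=> h rT; rewrite /strand nth_cat size_strand (slots_size h).
case: ltnP => r3.
  have e3 : (r %% 3 < 3)%N by rewrite ltn_mod.
  have jm : (r %/ 3 < size w)%N by rewrite ltn_divLR // mulnC.
  have rE : r = (3 * (r %/ 3) + r %% 3)%N by rewrite mulnC -divn_eq.
  by rewrite rE nth_strand ?(slots_size h) // h bvertex_letter ?size_slots.
have rE : r = (3 * size (slots w) + (r - 3 * size w))%N by rewrite size_slots; lia.
have : (r - 3 * size w < 5)%N by move: rT; rewrite /period; lia.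
move: rE; move: (r - 3 * size w)%N => e -> e5.
rewrite (@bvertex_closing R n (slots w) (bits w') s e) size_slots /closing_vertices braid_permE.
by case: e e5 => [|[|[|[|[|//]]]]].
Qed.

(** The closure of w', with each component c lifted by the height tau c.  This
does not change the shadow. *)
Definition diagram w w' (tau : braid_component w -> R) : polygons R (braid_component w) :=
  fun c => [seq v + xyz 0 0 (tau c)
    | v <- flatten [seq strand w w' s | s <- fingraph.orbit (braid_perm w) (val c)]].

Lemma xyz0 : xyz 0 0 0 = 0 :> space R.
Proof. by apply: space_eqP; rewrite !xyzE !cE. Qed.

Lemma diagram_closure w : diagram w (fun=> 0) = braid_closure R w.
Proof.
apply/funext => c; rewrite /diagram xyz0.
by rewrite (eq_map (fun v => addr0 v)) map_id.
Qed.

Lemma nth_flatten_uniform (T : nat) (ss : seq (seq (space R))) o r :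
  all (fun s : seq (space R) => size s == T) ss -> (o < size ss)%N -> (r < T)%N ->
  (flatten ss)`_(o * T + r) = (nth [::] ss o)`_r.
Proof.
elim: ss o => [//|s ss IHss] [|o] /= /andP[/eqP sT aT] oss rT.
  by rewrite mul0n add0n nth_cat sT rT.
rewrite nth_cat sT ltnNge mulSn -addnA leq_addr /= addKn IHss //.
Qed.

Lemma size_flatten_uniform (T : nat) (ss : seq (seq (space R))) :
  all (fun s : seq (space R) => size s == T) ss -> size (flatten ss) = (size ss * T)%N.
Proof.
by elim: ss => [//|s ss IHss] /= /andP[/eqP sT aT]; rewrite size_cat sT IHss // mulSn.
Qed.

Section Fixed.
Variable w : braid_word n.
Implicit Types (c : braid_component w) (a : place R (braid_component w)).
Local Notation f := (braid_perm w).
Local Notation T := (period w).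

Lemma f_inj : injective f.
Proof. exact: perm_inj. Qed.

Lemma strand_component_subproof s : froots f (froot f s).
Proof. exact: (roots_root (fconnect_sym f_inj)). Qed.

Definition strand_component s : braid_component w :=
  exist (fun s => froots f s) (froot f s) (strand_component_subproof s).

(** The strands of a component are concatenated in the order of the orbit of its
root, each occupying [period w] vertices. *)
Definition strand_place s (r : nat) (t : R) : place R (braid_component w) :=
  (strand_component s, findex f (froot f s) s * T + r, t)%N.

Section OneDiagram.
Variables (w' : braid_word n) (tau : braid_component w -> R).
Hypothesis ww' : slots w' = slots w.
Local Notation D := (diagram w' tau).
Local Notation bv := (bvertex R n (slots w) (bits w')).
Local Notation bp := (bpoint n (slots w) (bits w')).

Lemma diagram_uniform (c : braid_component w) : all (fun s : seq (space R) => size s == T)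
  [seq strand w w' s | s <- fingraph.orbit f (val c)].
Proof. by apply/allP => v /mapP[s _ ->]; rewrite size_strand_period. Qed.

Lemma size_diagram c : size (D c) = (fingraph.order f (val c) * T)%N.
Proof.
by rewrite size_map (size_flatten_uniform (diagram_uniform c)) size_map size_orbit.
Qed.

Lemma T_gt0 : (0 < T)%N. Proof. by rewrite /period addn_gt0 orbT. Qed.

Lemma diagram_nth c o r : (o < fingraph.order f (val c))%N -> (r < T)%N ->
  (D c)`_(o * T + r) = bv (iter o f (val c)) r + xyz 0 0 (tau c).
Proof.
move=> oo rT; rewrite (nth_map 0); last first.
  rewrite (size_flatten_uniform (diagram_uniform c)) size_map size_orbit.
  by apply: (@leq_trans (o.+1 * T)); [rewrite mulSn addnC ltn_add2r|rewrite leq_mul2r oo orbT].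
congr (_ + _); rewrite nth_flatten_uniform ?diagram_uniform ?size_map ?size_orbit //.
rewrite (nth_map (val c)) ?size_orbit // nth_strand_bvertex //.
by rewrite /fingraph.orbit nth_traject.
Qed.

Lemma bvertex_wrap s : bv s T = bv (f s) 0.
Proof.
have := @bvertex_start R n (slots w) (bits w') (f s) 0 (leq0n _).
rewrite muln0 pos0 => ->.
by rewrite /period -size_slots bvertex_closing /= [in RHS]braid_permE size_slots.
Qed.

Lemma diagram_vertex c o r : (o < fingraph.order f (val c))%N -> (r < T)%N ->
  vertex (D c) (o * T + r) = bv (iter o f (val c)) r + xyz 0 0 (tau c).
Proof.
move=> oo rT; rewrite /vertex modn_small ?diagram_nth // size_diagram.
by apply: (@leq_trans (o.+1 * T)); [rewrite mulSn addnC ltn_add2r|rewrite leq_mul2r oo orbT].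
Qed.

Lemma diagram_vertexS c o r : (o < fingraph.order f (val c))%N -> (r < T)%N ->
  vertex (D c) (o * T + r).+1 = bv (iter o f (val c)) r.+1 + xyz 0 0 (tau c).
Proof.
move=> oo rT; have [rT'|rT'] := ltnP r.+1 T; first by rewrite -addnS diagram_vertex.
have rE : r.+1 = T by lia.
rewrite -addnS rE bvertex_wrap.
have -> : (o * T + T = o.+1 * T + 0)%N by rewrite mulSn addn0 addnC.
rewrite -[f _]/(iter o.+1 f (val c)).
move: oo; rewrite leq_eqVlt => /predU1P[oE|oo]; last by rewrite diagram_vertex ?T_gt0.
rewrite oE addn0 -size_diagram -vertex_mod modnn (iter_order f_inj).
by have := @diagram_vertex c 0 0; rewrite mul0n add0n; apply; rewrite ?T_gt0 ?order_gt0.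
Qed.

Lemma iter_strand s : iter (findex f (froot f s) s) f (froot f s) = s.
Proof. by rewrite iter_findex // (fconnect_sym f_inj); exact: connect_root. Qed.

Lemma strand_findex s : (findex f (froot f s) s < fingraph.order f (froot f s))%N.
Proof. by apply: findex_max; rewrite (fconnect_sym f_inj); exact: connect_root. Qed.

Lemma at_strand_place s r t : (r < T)%N ->
  at_place D (strand_place s r t) = bp s r t + xyz 0 0 (tau (strand_component s)).
Proof.
move=> rT; have := strand_findex s => os.
have h0 := @diagram_vertex (strand_component s) _ r os rT.
have h1 := @diagram_vertexS (strand_component s) _ r os rT.
rewrite /= iter_strand in h0 h1.
rewrite /at_place /edge_point /= h0 h1 /bpoint.
by apply/rowP => k; rewrite !mxE; ring.
Qed.

Lemma is_strand_place s r t : (r < T)%N -> 0 <= t < 1 -> is_place D (strand_place s r t).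
Proof.
move=> rT tI; split => //=; rewrite size_diagram /=.
have := strand_findex s => os.
by apply: (@leq_trans ((findex f (froot f s) s).+1 * T)); [rewrite mulSn addnC ltn_add2r|rewrite leq_mul2r os orbT].
Qed.

Lemma strand_placeP a : is_place D a ->
  exists s r, [/\ (r < T)%N, 0 <= a.2 < 1 & a = strand_place s r a.2].
Proof.
case: a => [[c k] t] [/= kD tI]; rewrite size_diagram in kD.
have oo : (k %/ T < fingraph.order f (val c))%N by rewrite ltn_divLR ?T_gt0.
exists (iter (k %/ T) f (val c)), (k %% T)%N; split => //; first by rewrite ltn_mod T_gt0.
have rE : froot f (iter (k %/ T) f (val c)) = val c.
  have : fconnect f (val c) (iter (k %/ T) f (val c)) by exact: fconnect_iter.
  move=> /(fingraph.rootP (fconnect_sym f_inj)) <-.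
  by case: c {kD oo} => x /= /eqP.
rewrite /strand_place; congr (_, _, _).
  by apply: val_inj => /=; rewrite rE.
by rewrite rE findex_iter // -divn_eq.
Qed.

End OneDiagram.

Lemma strand_place_inj s s' r r' t t' : (r < T)%N -> (r' < T)%N ->
  strand_place s r t = strand_place s' r' t' -> [/\ s = s', r = r' & t = t'].
Proof.
move=> rT r'T [e1 e2 ->].
have rr : r = r' by have := congr1 (modn^~ T) e2; rewrite !modnMDl !modn_small.
have oo : findex f (froot f s) s = findex f (froot f s') s'.
  have := congr1 (divn^~ T) e2; rewrite !divnMDl ?T_gt0 //.
  by rewrite !divn_small // !addn0.
by split => //; rewrite -(iter_strand s) oo e1 iter_strand.
Qed.

End Fixed.
End Diagrams.

(** * Crossings of closed braids *)

Section DiagramCrossings.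
Variable R : realType.
Variable n : nat.
Variable w : braid_word n.
Implicit Types (s : 'I_n.+1) (c : braid_component w) (a b d : place R (braid_component w)).
Local Notation T := (period w).
Local Notation cslots := (crossing_slots (slots w)).

(** The middle of the middle edge of letter j is where its two strands cross. *)
Definition crossing_place (j : nat) s : place R (braid_component w) :=
  strand_place w s (3 * j + 1) (1 / 2 : R).

Lemma half_itv : 0 <= (1 / 2 : R) < 1.
Proof. by apply/andP; split; lra. Qed.

Lemma crossing_lt j : (j < size w)%N -> (3 * j + 1 < T)%N.
Proof. by rewrite /period; lia. Qed.

Lemma crossing_place_inj j j' s s' : (j < size w)%N -> (j' < size w)%N ->
  crossing_place j s = crossing_place j' s' -> j = j' /\ s = s'.
Proof.
move=> jm j'm /(strand_place_inj (crossing_lt jm) (crossing_lt j'm))[-> e _].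
by split=> //; lia.
Qed.

Lemma crossing_slots_partner j s s1 s2 : cslots j s s1 -> cslots j s s2 -> s1 = s2.
Proof.
move=> h1 h2; apply/val_inj/(@pos_inj (slots w) j).
by case: h1 h2 => -[h1 ->] [] [h2 ->] //; lia.
Qed.

Lemma crossing_slots_neq j s s' : cslots j s s' -> s <> s'.
Proof. by move=> h e; move: h; rewrite e => -[] [->]; lia. Qed.

Section OneDiagram.
Variables (w' : braid_word n) (tau : braid_component w -> R).
Hypothesis ww' : slots w' = slots w.
Local Notation D := (diagram w' tau).

Definition strand_level (j : nat) s : R :=
  (over (slots w) (bits w') j (pos (slots w) j s))%:R + tau (strand_component w s).

Lemma crossing_level j s : (j < size w)%N -> level D (crossing_place j s) = strand_level j s.
Proof.
move=> jm; rewrite /level /crossing_place at_strand_place ?crossing_lt // czD cz_xyz.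
by rewrite letter_crossing_height ?size_slots.
Qed.

Lemma cx_at_strand s r (t : R) : (r < T)%N ->
  cx (at_place D (strand_place w s r t)) = cx (bpoint n (slots w) (bits w') s r t).
Proof. by move=> rT; rewrite at_strand_place // cxD cx_xyz addr0. Qed.

Lemma cy_at_strand s r (t : R) : (r < T)%N ->
  cy (at_place D (strand_place w s r t)) = cy (bpoint n (slots w) (bits w') s r t).
Proof. by move=> rT; rewrite at_strand_place // cyD cy_xyz addr0. Qed.

Lemma shadow_strand_places s s' r r' (t t' : R) : (r < T)%N -> (r' < T)%N ->
  0 <= t < 1 -> 0 <= t' < 1 ->
  shadow (at_place D (strand_place w s r t)) = shadow (at_place D (strand_place w s' r' t')) ->
  [/\ s = s', r = r' & t = t'] \/
  exists2 j, (j < size w)%N & [/\ strand_place w s r t = crossing_place j s,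
    strand_place w s' r' t' = crossing_place j s' & cslots j s s'].
Proof.
move=> rT r'T tI t'I /shadow_eq; rewrite !cx_at_strand // !cy_at_strand // => -[ex ey].
have [||||[] e -> ->|[j jm [rE r'E tE t'E cs]]] := bpoint_shadow_inj (slots_lt w) _ _ _ _ tI t'I ex ey.
- by rewrite -ltnS.
- by rewrite -ltnS.
- by rewrite size_slots.
- by rewrite size_slots.
- by left; split => //; apply: val_inj.
right; exists j; first by rewrite -(size_slots w).
by split => //; rewrite /crossing_place ?rE ?tE ?r'E ?t'E.
Qed.

Lemma diagram_double_point a b : double_point D a b ->
  exists j s s', [/\ (j < size w)%N, a = crossing_place j s, b = crossing_place j s' & cslots j s s'].
Proof.
case=> /(strand_placeP ww')[s [r [rT tI aE]]] /(strand_placeP ww')[s' [r' [r'T t'I bE]]] ab.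
rewrite aE bE => /(shadow_strand_places rT r'T tI t'I)[[e1 e2 e3]|[j jm [e1 e2 cs]]].
  by case: ab; rewrite aE bE e1 e2 e3.
by exists j, s, s'.
Qed.

Lemma crossing_double_point j s s' : (j < size w)%N -> cslots j s s' ->
  double_point D (crossing_place j s) (crossing_place j s').
Proof.
move=> jm cs; have jT := crossing_lt jm.
split; try by apply: is_strand_place => //; exact: half_itv.
  by move=> /(crossing_place_inj jm jm)[_]; exact: crossing_slots_neq cs.
apply/shadow_eq; rewrite /crossing_place !cx_at_strand // !cy_at_strand //.
have jm' : (j < size (slots w))%N by rewrite size_slots.
exact: (crossing_shadow R n (bits w') jm' cs).
Qed.

Lemma diagram_link :
  (forall j s s', (j < size w)%N -> cslots j s s' -> strand_level j s <> strand_level j s') ->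
  is_link D.
Proof.
move=> H; split.
  move=> c; rewrite size_diagram //; apply: (@leq_trans (1 * T)%N).
    by rewrite mul1n /period; lia.
  by rewrite leq_mul2r fingraph.order_gt0 orbT.
move=> a b /[dup] pa /(strand_placeP ww')[s [r [rT tI aE]]] /[dup] pb /(strand_placeP ww')[s' [r' [r'T t'I bE]]] e.
have := congr1 (@shadow R) e; rewrite aE bE => /(shadow_strand_places rT r'T tI t'I)[[e1 e2 e3]|[j jm [e1 e2 cs]]].
  by rewrite e1 e2 e3.
case: (H j s s' jm cs); rewrite -!crossing_level // -e1 -e2 -aE -bE.
by rewrite /level e.
Qed.

Lemma diagram_regular : regular D.
Proof.
split.
- apply: (@sub_finite_set _ _ ((fun x : 'I_(size w) * 'I_n.+1 * 'I_n.+1 =>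
      (crossing_place x.1.1 x.1.2, crossing_place x.1.1 x.2)) @` setT)); last first.
    by apply: finite_image; exact: finite_finset.
  move=> [a b] /= /diagram_double_point[j [s [s' [jm -> -> _]]]].
  by exists (Ordinal jm, s, s').
- move=> a b d /diagram_double_point[j [s [s' [jm -> -> cs]]]].
  move=> /diagram_double_point[j2 [s2 [s2' [jm2 e -> cs2]]]].
  have [jj ss] := crossing_place_inj jm jm2 e; subst j2 s2.
  by rewrite (crossing_slots_partner cs cs2).
- move=> a b /diagram_double_point[j [s [s' [_ -> _ _]]]] /=.
  by rewrite mulf_neq0 ?oner_neq0 // invr_neq0 // pnatr_eq0.
Qed.

(** Both strands run upwards in y, and the one from the left slot moves to the
right; so the crossing is positive if that one is on top. *)
Lemma crossing_turn j s s' : (j < size w)%N ->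
  pos (slots w) j s = slot_index (slots w) j -> pos (slots w) j s' = (slot_index (slots w) j).+1 ->
  turn_sign D (crossing_place j s) (crossing_place j s') = -1.
Proof.
move=> jm ps ps'.
have dirE x : edge_dir D (crossing_place j x)
    = bvertex R n (slots w) (bits w') x (3 * j + 2) - bvertex R n (slots w) (bits w') x (3 * j + 1).
  have os := strand_findex w x.
  have h0 := @diagram_vertex R n w w' tau ww' (strand_component w x) _ _ os (crossing_lt jm).
  have h1 := @diagram_vertexS R n w w' tau ww' (strand_component w x) _ _ os (crossing_lt jm).
  rewrite /= iter_strand in h0 h1.
  by rewrite /edge_dir /= h0 h1 opprD addrACA subrr addr0 -addnS.
have jm' : (j < size (slots w))%N by rewrite size_slots.
rewrite /turn_sign /turn !dirE /cross2 !(cxD, cxN, cyD, cyN).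
have [-> ->] := letter_crossing_dir R n (bits w') s jm'.
have [-> ->] := letter_crossing_dir R n (bits w') s' jm'.
rewrite !posS // ps ps' /swapn eqxx (_ : (_.+1 == _) = false) ?eqxx; last by rewrite eqn_leq ltnn.
rewrite ifF // -natr1; apply/negbTE; rewrite -leNgt.
by lra.
Qed.

End OneDiagram.

Lemma bvertex_shadow (b1 b2 : nat -> bool) s r :
  shadow (bvertex R n (slots w) b1 s r) = shadow (bvertex R n (slots w) b2 s r).
Proof.
rewrite /bvertex; case: ifP => // _; have := ltn_mod r 3.
by case: (r %% 3)%N => [|[|[|//]]] _ /=; apply/shadow_eq; rewrite !xyzE.
Qed.

Lemma diagram_same_shadow w1 w2 tau1 tau2 : slots w1 = slots w -> slots w2 = slots w ->
  same_shadow (diagram w1 tau1 : polygons R (braid_component w)) (diagram w2 tau2).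
Proof.
move=> h1 h2 c; apply: (@eq_from_nth _ 0); first by rewrite [LHS]size_map [RHS]size_map !size_diagram.
move=> k; rewrite size_map size_diagram // => kD.
rewrite !(nth_map (0 : space R) (0 : R * R) (@shadow R)) ?size_diagram //.
have oo : (k %/ T < fingraph.order (braid_perm w) (val c))%N by rewrite ltn_divLR ?T_gt0.
have rT : (k %% T < T)%N by rewrite ltn_mod T_gt0.
rewrite (divn_eq k T) !diagram_nth //.
have /shadow_eq[e0 e1] := bvertex_shadow (bits w1) (bits w2) (iter (k %/ T) (braid_perm w) (val c)) (k %% T).
by apply/shadow_eq; rewrite !(cxD, cyD) !xyzE e0 e1.
Qed.

Section Change.
Variables (w1 w2 : braid_word n) (tau1 tau2 : braid_component w -> R).
Hypotheses (h1 : slots w1 = slots w) (h2 : slots w2 = slots w).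
Local Notation lev1 := (strand_level w1 tau1).
Local Notation lev2 := (strand_level w2 tau2).
Variables (j0 : nat) (s0 s0' : 'I_n.+1).
Hypotheses (jm0 : (j0 < size w)%N) (cs0 : cslots j0 s0 s0').
Hypothesis comp0 : strand_component w s0 != strand_component w s0'.
Hypotheses (up1 : lev1 j0 s0' < lev1 j0 s0) (up2 : lev2 j0 s0 < lev2 j0 s0').
Hypothesis same : forall j s s', (j < size w)%N -> j != j0 -> cslots j s s' ->
  (lev1 j s' < lev1 j s) = (lev2 j s' < lev2 j s).

Lemma crossing_slotsC j s s' : cslots j s s' -> cslots j s' s.
Proof. by case=> -[a b]; [right|left]. Qed.

Lemma aboveE w' (tau : braid_component w -> R) j s s' : slots w' = slots w -> (j < size w)%N ->
  above (diagram w' tau) (crossing_place j s) (crossing_place j s')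
  = (strand_level w' tau j s' < strand_level w' tau j s).
Proof.
move=> h jm; rewrite /above -[height _]/(level (diagram w' tau) (crossing_place j s')).
by rewrite -[X in _ < X]/(level (diagram w' tau) (crossing_place j s)) !crossing_level.
Qed.

Lemma diagram_crossing_change :
  crossing_change_at (diagram w1 tau1) (diagram w2 tau2) (crossing_place j0 s0) (crossing_place j0 s0').
Proof.
split.
- exact: diagram_regular.
- exact: diagram_same_shadow.
- exact: crossing_double_point.
- exact: comp0.
split; first by rewrite aboveE.
move=> a b /(diagram_double_point h1)[j [s [s' [jm -> -> cs]]]].
rewrite !aboveE //; have [jj|jj] := eqVneq j j0.
  subst j; have [ss|ss] := eqVneq s s0.
    subst s; rewrite -(crossing_slots_partner cs0 cs) inE eqxx /= up1 /=.
    by apply/negbTE; rewrite -leNgt ltW.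
  have ss' : s' = s0.
    apply/val_inj/(@pos_inj (slots w) j0); move/eqP: ss => ss.
    have ps : pos (slots w) j0 s <> pos (slots w) j0 s0 by move=> /pos_inj/val_inj.
    by case: cs cs0 => -[q1 q2] [] [q3 q4]; move: ps; rewrite q1 q2 q3.
  subst s'; rewrite -(crossing_slots_partner cs0 (crossing_slotsC cs)).
  rewrite !inE eqxx orbT /= up2; symmetry; apply/negP.
  by move=> h; have := lt_trans h up1; rewrite ltxx.
rewrite (_ : _ \in _ = false) /=; first by apply/esym/same.
apply/negbTE; rewrite !inE negb_or; apply/andP; split; apply/eqP => /(congr1 fst)/(crossing_place_inj jm jm0)[e _];
  by move: jj; rewrite e eqxx.
Qed.

End Change.
End DiagramCrossings.

(** * Translating polygons apart *)

Section Translation.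
Variable R : realType.
Implicit Types (P : polygon R) (u : space R).

Definition shift u P : polygon R := [seq v + u | v <- P].

Lemma vertex_shift u P k : (0 < size P)%N -> vertex (shift u P) k = vertex P k + u.
Proof.
by move=> P0; rewrite /vertex size_map (nth_map 0) // ltn_pmod.
Qed.

Lemma edge_point_shift u P k (t : R) : (0 < size P)%N ->
  edge_point (shift u P) k t = edge_point P k t + u.
Proof.
by move=> P0; rewrite /edge_point !vertex_shift //; apply/rowP => i; rewrite !mxE; ring.
Qed.

Lemma carrier_shift u P : carrier (shift u P) = (fun v => v + u) @` carrier P.
Proof.
apply/seteqP; split => v.
  move=> [k [t [kP tI ->]]]; rewrite size_map in kP.
  have P0 : (0 < size P)%N by case: size kP.
  by exists (edge_point P k t); [exists k, t|rewrite edge_point_shift].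
move=> [x [k [t [kP tI ->]]] <-].
have P0 : (0 < size P)%N by case: size kP.
by exists k, t; rewrite edge_point_shift // size_map.
Qed.

Lemma shift_knot_isotopic u P : knot_isotopic P (shift u P).
Proof.
exists (fun t v => v + t *: u); split.
- apply: continuous_subspaceT; apply: addv_cont; first exact: cf_snd.
  by apply: scalev_cont; [exact: cf_fst|move=> ?; exact: cvg_cst].
- move=> t _; have ct (z : space R) : continuous (fun v : space R => v + z).
    apply: (@addv_cont R (space R) (fun v => v) (fun=> z)); first exact: cf_id.
    exact: cst_continuous.
  split; first exact: ct.
  exists (fun v => v - t *: u); split; [exact: ct|move=> v; exact: addrK|move=> v; exact: subrK].
- by move=> v; rewrite scale0r addr0.
- by move=> _; rewrite carrier_shift; under eq_fun do rewrite scale1r.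
Qed.

(** The radius of a ball around 0 containing P. *)
Definition spread P : R := 1 + \sum_(v <- P) `|v|.

Lemma spread_gt0 P : 0 < spread P.
Proof. by rewrite ltr_pwDl // sumr_ge0. Qed.

Lemma vertex_norm P k : (0 < size P)%N -> `|vertex P k| < spread P.
Proof.
move=> P0; have vP : vertex P k \in P by rewrite mem_nth // ltn_pmod.
rewrite /spread (big_rem _ vP) /=.
have : 0 <= \sum_(v <- rem (vertex P k) P) `|v| by rewrite sumr_ge0.
by lra.
Qed.

Lemma carrier_norm P v : carrier P v -> `|v| < spread P.
Proof.
move=> [k [t [kP /andP[t0 t1] ->]]]; have P0 : (0 < size P)%N by case: size kP.
apply: (le_lt_trans (ler_normD _ _)).
rewrite !normrZ (ger0_norm t0) ger0_norm ?subr_ge0 ?ltW //.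
have h0 := vertex_norm k P0; have h1 := vertex_norm k.+1 P0.
have : (1 - t) * `|vertex P k| < (1 - t) * spread P by rewrite ltr_pM2l // subr_gt0.
have : t * `|vertex P k.+1| <= t * spread P by rewrite ler_wpM2l // ltW.
by lra.
Qed.

Lemma carrier_shift_ball u P (r : R) : spread P <= r -> carrier (shift u P) `<=` ball u r.
Proof.
move=> Pr v; rewrite carrier_shift => -[x xP <-]; rewrite -ball_normE /ball_ /=.
by rewrite opprD addrCA subrr addr0 normrN; apply: lt_le_trans Pr; exact: carrier_norm.
Qed.

Lemma xyzZ (z : R) : xyz 0 0 z = z *: xyz 0 0 1.
Proof. by apply: space_eqP; rewrite !cE !xyzE ?mulr0 ?mulr1. Qed.

Lemma vertical_norm_gt0 : 0 < `|xyz 0 0 1 : space R|.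
Proof.
rewrite normr_gt0; apply/eqP => /(congr1 (@cz R)); rewrite xyzE cE => /eqP.
by rewrite oner_eq0.
Qed.

Lemma vertical_balls_disjoint (z z' r : R) :
  2 * r <= `|z - z'| * `|xyz 0 0 1 : space R| ->
  forall x, ball (xyz 0 0 z : space R) r x -> ~ ball (xyz 0 0 z' : space R) r x.
Proof.
move=> h x; rewrite -!ball_normE /ball_ /= => h1 h2.
have E : xyz 0 0 z - xyz 0 0 z' = (z - z') *: xyz 0 0 1 :> space R.
  by rewrite [xyz 0 0 z]xyzZ [xyz 0 0 z']xyzZ scalerBl.
have := ler_distD x (xyz 0 0 z : space R) (xyz 0 0 z').
rewrite E normrZ [`|x - _|]distrC => h3.
have := le_trans h h3; lra.
Qed.

End Translation.

(** * The torus braid *)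

Section TorusWord.
Variables (n B : nat).
(** Within a block of letters 0, 1, 2 and so on, the strand at slot 0 is carried
to the right, one slot per letter, and each strand it has passed drops by one
slot. *)
Definition block_pos (i x : nat) : nat :=
  if x == 0%N then i else if (x <= i)%N then x.-1 else x.

(** A full block shifts the slots by -1 modulo n + 1, which is n. *)
Definition start_pos (k s : nat) : nat := ((s + n * k) %% n.+1)%N.

Lemma swapn_block i x : swapn i (block_pos i x) = block_pos i.+1 x.
Proof.
rewrite /swapn /block_pos; case: x => [|x] /=; first by rewrite eqxx.
case: (ltngtP x i) => xi.
- have -> : (x == i) = false by lia.
  have -> : (x == i.+1) = false by lia.
  by have -> : (x < i.+1)%N by lia.
- have -> : (x.+1 == i) = false by lia.
  have -> : (x.+1 == i.+1) = false by lia.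
  by have -> : (x < i.+1)%N = false by lia.
by rewrite xi ltnSn eqxx; have -> : (i.+1 == i) = false by lia.
Qed.

Lemma block_pos_end k s : block_pos n (start_pos k s) = start_pos k.+1 s.
Proof.
have -> : start_pos k.+1 s = ((n + start_pos k s) %% n.+1)%N.
  by rewrite /start_pos modnDmr; congr (_ %% _)%N; lia.
have : (start_pos k s <= n)%N by rewrite -ltnS ltn_pmod.
rewrite /block_pos; case: (start_pos k s) => [|x] xn /=.
  by rewrite addn0 modn_small.
by rewrite xn addnS -addSn modnDl modn_small // ltnW.
Qed.

Definition torus_slots : seq nat := flatten (nseq B (iota 0 n)).

Lemma size_torus_slots : size torus_slots = (B * n)%N.
Proof.
rewrite size_flatten /shape map_nseq size_iota sumn_nseq mulnC //.
Qed.

Lemma torus_slot_index k i : (k < B)%N -> (i < n)%N ->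
  slot_index torus_slots (k * n + i) = i.
Proof.
rewrite /slot_index /torus_slots; elim: B k => [//|b IHb] [|k] kb iN /=.
  by rewrite mul0n add0n nth_cat size_iota iN nth_iota.
rewrite nth_cat size_iota mulSn -addnA ltnNge leq_addr /= addKn IHb //.
Qed.

Lemma torus_pos k i s : (s <= n)%N -> (k < B)%N -> (i <= n)%N ->
  pos torus_slots (k * n + i) s = block_pos i (start_pos k s).
Proof.
have step k' i' : (k' < B)%N -> (i' < n)%N ->
    pos torus_slots (k' * n + i') s = block_pos i' (start_pos k' s) ->
    pos torus_slots (k' * n + i'.+1) s = block_pos i'.+1 (start_pos k' s).
  move=> kB iN IH; rewrite addnS posS ?size_torus_slots; last first.
    by apply: (@leq_trans (k'.+1 * n)); [lia | rewrite leq_mul2r kB orbT].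
  by rewrite torus_slot_index // IH swapn_block.
move=> sn; elim: k i => [|k IHk] i kB.
  elim: i => [|i IHi] iN; last exact: (step _ _ kB iN (IHi (ltnW iN))).
  rewrite pos0 /block_pos /start_pos muln0 addn0 modn_small //.
  by case: (s).
elim: i => [|i IHi] iN; last exact: (step _ _ kB iN (IHi (ltnW iN))).
rewrite addn0 mulSn addnC (IHk _ (ltnW kB) (leqnn n)) block_pos_end /block_pos.
by case: (start_pos _ _).
Qed.

Lemma torus_pos_end s : (s <= n)%N -> pos torus_slots (B * n) s = start_pos B s.
Proof.
move=> sn; case E : B => [|b].
  by rewrite mul0n pos0 /start_pos muln0 addn0 modn_small.
have := @torus_pos b n s sn; rewrite E => H.
by rewrite mulSn addnC H // block_pos_end.
Qed.

Lemma torus_pos_lower k i : (k < B)%N -> (i < n)%N ->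
  pos torus_slots (k * n + i) (k %% n.+1) = i.
Proof.
move=> kB iN; rewrite (torus_pos _ kB (ltnW iN)); last by rewrite -ltnS ltn_pmod.
rewrite /block_pos ifT // /start_pos modnDml.
by rewrite -mulSn mulnC modnMl.
Qed.

Lemma torus_pos_upper k i : (k < B)%N -> (i < n)%N ->
  pos torus_slots (k * n + i) ((k + i.+1) %% n.+1) = i.+1.
Proof.
move=> kB iN; rewrite (torus_pos _ kB (ltnW iN)); last by rewrite -ltnS ltn_pmod.
have -> : start_pos k ((k + i.+1) %% n.+1) = i.+1.
  rewrite /start_pos modnDml.
  have -> : (k + i.+1 + n * k = k * n.+1 + i.+1)%N by lia.
  by rewrite modnMDl modn_small.
by rewrite /block_pos /= ltnn.
Qed.

End TorusWord.

(** * Counting descents *)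

Section Counting.
Implicit Types (F : nat -> nat) (l p q r : nat).
Local Open Scope nat_scope.

Lemma sum_shift_period F l k : 0 < l ->
  \sum_(0 <= i < l) F ((k + i) %% l) = \sum_(0 <= i < l) F i.
Proof.
move=> l0; elim: k => [|k IHk].
  by apply: eq_big_nat => i /andP[_ il]; rewrite add0n modn_small.
rewrite -IHk; case: l l0 {IHk} => [//|l] _.
rewrite big_nat_recr // [in RHS]big_nat_recl //= addnC; congr (_ + _).
  by rewrite addn0 addSnnS modnDr.
by apply: eq_big_nat => i _; rewrite addSnnS.
Qed.

Lemma sum_periods F l p k : 0 < l ->
  \sum_(0 <= i < l * p) F ((k + i) %% l) = p * \sum_(0 <= i < l) F i.
Proof.
move=> l0; elim: p => [|p IHp]; first by rewrite muln0 big_geq.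
rewrite mulnS addnC (big_cat_nat _ (n := l * p)) //= ?leq_addr // IHp.
rewrite mulSn addnC; congr (_ + _).
rewrite -{1}[l * p]add0n big_addn addKn -(sum_shift_period F k l0).
apply: eq_big_nat => j _; rewrite addnA addnC mulnC modnMDl //.
Qed.

Lemma sum_below l r : r <= l -> \sum_(0 <= i < l) (i < r : nat) = r.
Proof.
move=> rl; rewrite (big_cat_nat _ (n := r)) //=.
rewrite (eq_big_nat _ _ (F2 := fun=> 1)); last by move=> i /andP[_ ->].
rewrite sum_nat_const_nat subn0 muln1 big1_seq ?addn0 // => i.
by rewrite mem_index_iota => /andP[_ /andP[ri _]]; rewrite ltnNge ri.
Qed.

Lemma sum_blocks F m k :
  \sum_(0 <= j < k * m) F j = \sum_(0 <= i < k) \sum_(0 <= j < m) F (i * m + j).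
Proof.
elim: k => [|k IHk]; first by rewrite mul0n !big_geq.
rewrite big_nat_recr //= -IHk mulSn addnC (big_cat_nat _ (n := k * m)) //= ?leq_addr //.
congr (_ + _); rewrite -{1}[k * m]add0n big_addn addKn.
by apply: eq_big_nat => j _; rewrite addnC.
Qed.

(** For fixed k, the residues of k + 1, ..., k + l p - 1 together with that of k
itself run p times through all residues, and k mod l of these are smaller than
k mod l. *)
Lemma count_descents l p q : 0 < l -> 0 < p ->
  \sum_(0 <= k < l * q) \sum_(0 <= i < (l * p).-1)
     ((k + i.+1) %% l < k %% l : nat)
  = (l * (l - 1)) %/ 2 * (p * q).
Proof.
move=> l0 p0.
transitivity (\sum_(0 <= k < l * q) p * ((0 + k) %% l)).
  apply: eq_big_nat => k _; rewrite add0n.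
  have := @sum_periods (fun y => (y < k %% l : nat)) l p k l0.
  rewrite sum_below; last by rewrite ltnW // ltn_pmod.
  case: (l * p) (muln_gt0 l p) => [|m] /=; first by rewrite l0 p0.
  by move=> _ <-; rewrite [in RHS]big_nat_recl // addn0 ltnn add0n.
rewrite -big_distrr /= (sum_periods id) // mulnA mulnC; congr (_ * _).
by rewrite bin2_sum bin2 divn2 subn1.
Qed.

End Counting.

(** * Reversing crossings of the torus braid *)

Section Flips.
Variable n : nat.
Implicit Types (w : braid_word n) (S : seq nat).

Definition flipped S w : braid_word n :=
  [seq (g.2.1, g.1 \notin S) | g : nat * ('I_n * bool) <- zip (iota 0 (size w)) w].

Lemma slots_flipped S w : slots (flipped S w) = slots w.
Proof.
rewrite /slots /flipped -map_comp (@eq_map _ _ _ ((fun g : 'I_n * bool => nat_of_ord g.1) \o snd)) //.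
by rewrite map_comp -/(unzip2 _) unzip2_zip // size_iota.
Qed.

Lemma bits_flipped S w j : (j < size w)%N -> bits (flipped S w) j = (j \notin S).
Proof.
move=> jm; rewrite /bits /flipped -map_comp.
rewrite (@eq_map _ _ _ ((fun i => i \notin S) \o fst)) // map_comp -/(unzip1 _).
by rewrite unzip1_zip ?size_iota // (nth_map 0%N) ?size_iota // nth_iota.
Qed.

Lemma flipped0 w : all snd w -> flipped [::] w = w.
Proof.
move=> /allP wt; rewrite /flipped.
rewrite (@eq_map _ _ _ ((fun g : 'I_n * bool => (g.1, true)) \o snd)) // map_comp -/(unzip2 _).
rewrite unzip2_zip ?size_iota // -[RHS]map_id; apply/eq_in_map => -[i b] /wt /= -> //.
Qed.

Lemma bits_all w j : all snd w -> (j < size w)%N -> bits w j.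
Proof. by move=> wt jm; rewrite -(flipped0 wt) bits_flipped // in_nil. Qed.

End Flips.

Section TorusDiagrams.
Variable R : realType.
Variables n B : nat.
Variable w : braid_word n.
Hypothesis wE : slots w = torus_slots n B.
Implicit Types (S : seq nat) (tau : braid_component w -> R).
Local Notation cslots := (crossing_slots (slots w)).

(** Letter j is the letter number j mod n of the block number j / n.  By
[torus_pos], the strand that travels to the right during that block is the one
from slot j / n; it is always at the left one of the two slots to be
exchanged. *)
Definition left_strand (j : nat) : 'I_n.+1 := inord ((j %/ n) %% n.+1).
Definition right_strand (j : nat) : 'I_n.+1 := inord ((j %/ n + (j %% n).+1) %% n.+1).

Lemma size_torus : size w = (B * n)%N.
Proof. by rewrite -size_slots wE size_torus_slots. Qed.

Lemma letter_split j : (j < size w)%N ->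
  [/\ (j %/ n < B)%N, (j %% n < n)%N & j = (j %/ n * n + j %% n)%N].
Proof.
rewrite size_torus => jm; have n0 : (0 < n)%N by case: (n) jm => //; rewrite muln0.
by rewrite ltn_divLR // ltn_pmod // -divn_eq.
Qed.

Lemma left_strandP j : (j < size w)%N ->
  pos (slots w) j (left_strand j) = slot_index (slots w) j.
Proof.
move=> /letter_split[kB iN jE]; rewrite /left_strand inordK ?ltn_pmod // wE {1 3}jE.
by rewrite torus_pos_lower // torus_slot_index.
Qed.

Lemma right_strandP j : (j < size w)%N ->
  pos (slots w) j (right_strand j) = (slot_index (slots w) j).+1.
Proof.
move=> /letter_split[kB iN jE]; rewrite /right_strand inordK ?ltn_pmod // wE {1 4}jE.
by rewrite torus_pos_upper // torus_slot_index.
Qed.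

Lemma crossing_strands j (s s' : 'I_n.+1) : (j < size w)%N -> cslots j s s' ->
  (s = left_strand j /\ s' = right_strand j) \/ (s = right_strand j /\ s' = left_strand j).
Proof.
move=> jm [[e e']|[e e']]; [left|right]; split; apply/val_inj/(@pos_inj (slots w) j);
  by rewrite ?left_strandP ?right_strandP.
Qed.

Lemma left_right_slots j : (j < size w)%N -> cslots j (left_strand j) (right_strand j).
Proof. by move=> jm; left; rewrite left_strandP // right_strandP. Qed.

Lemma left_level (w' : braid_word n) tau j : (j < size w)%N ->
  strand_level w' tau j (left_strand j) = (bits w' j)%:R + tau (strand_component w (left_strand j)).
Proof.
move=> jm; rewrite /strand_level left_strandP // /over eqxx.
by rewrite (ltn_eqF (ltnSn _)); case: (bits w' j).
Qed.

Lemma right_level (w' : braid_word n) tau j : (j < size w)%N ->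
  strand_level w' tau j (right_strand j) = (~~ bits w' j)%:R + tau (strand_component w (right_strand j)).
Proof.
move=> jm; rewrite /strand_level right_strandP // /over eqxx.
by rewrite (gtn_eqF (ltnSn _)); case: (bits w' j).
Qed.

(** In a positive crossing the left strand is the upper one.  Diagrams having
this property for the same S have the same crossings, whether these come from
negative letters or from lifting components. *)
Definition reversed_at (w' : braid_word n) (tau : braid_component w -> R) S : Prop :=
  forall j, (j < size w)%N ->
    if j \in S then strand_level w' tau j (left_strand j) < strand_level w' tau j (right_strand j)
    else strand_level w' tau j (right_strand j) < strand_level w' tau j (left_strand j).

Lemma flipped_reversed S : reversed_at (flipped S w) (fun=> 0) S.
Proof.
move=> j jm; rewrite left_level // right_level // bits_flipped // !addr0.
by case: (j \in S); rewrite /= ltr01.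
Qed.

Lemma reversed_link (w' : braid_word n) tau S : slots w' = slots w -> reversed_at w' tau S ->
  is_link (diagram w' tau).
Proof.
move=> h rS; apply: diagram_link => // j s s' jm /(crossing_strands jm).
have := rS j jm; case: ifP => _ lt [[-> ->]|[-> ->]] e; move: lt; by rewrite e ltxx.
Qed.

Lemma reversed_step (w1 w2 : braid_word n) tau1 tau2 S j0 :
  slots w1 = slots w -> slots w2 = slots w ->
  reversed_at w1 tau1 S -> reversed_at w2 tau2 (rcons S j0) ->
  (j0 < size w)%N -> j0 \notin S ->
  strand_component w (left_strand j0) != strand_component w (right_strand j0) ->
  crossing_change_at (diagram w1 tau1) (diagram w2 tau2)
    (crossing_place R w j0 (left_strand j0)) (crossing_place R w j0 (right_strand j0)).
Proof.
move=> h1 h2 r1 r2 jm j0S comp.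
apply: diagram_crossing_change => //.
- exact: left_right_slots.
- by have := r1 _ jm; rewrite (negbTE j0S).
- by have := r2 _ jm; rewrite mem_rcons mem_head.
move=> j s s' jw jj /(crossing_strands jw).
have := r1 _ jw; have := r2 _ jw; rewrite mem_rcons inE (negbTE jj) /=.
by case: ifP => _ l2 l1 [[-> ->]|[-> ->]]; rewrite ?l1 ?l2 // !ltNge !ltW.
Qed.

Lemma reversed_reach L k (w1 w2 : braid_word n) tau1 tau2 S j0 :
  slots w1 = slots w -> slots w2 = slots w ->
  reversed_at w1 tau1 S -> reversed_at w2 tau2 (rcons S j0) ->
  (j0 < size w)%N -> j0 \notin S ->
  strand_component w (left_strand j0) != strand_component w (right_strand j0) ->
  reachable L k (diagram w1 tau1) ->
  reachable L k.+1 (diagram w2 tau2) /\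
    lk_sum (diagram w2 tau2) = lk_sum (diagram w1 tau1) - 1.
Proof.
move=> h1 h2 r1 r2 jm j0S comp re.
have cc := reversed_step h1 h2 r1 r2 jm j0S comp.
have l1 := reversed_link h1 r1; have l2 := reversed_link h2 r2.
split.
  apply: (reachable_crossing re l2); case: cc => rg sh dp nc [up ch].
  split => //; by exists (crossing_place R w j0 (left_strand j0)), (crossing_place R w j0 (right_strand j0)).
rewrite (crossing_lk_sum l1 l2 cc); congr (_ + _).
apply: crossing_turn => //; [exact: left_strandP|exact: right_strandP].
Qed.

(** The letters of J are made negative one at a time. *)
Lemma reversed_chain (J : seq nat) k : all snd w -> uniq J ->
  {in J, forall j, (j < size w)%N /\
    strand_component w (left_strand j) != strand_component w (right_strand j)} ->
  (k <= size J)%N ->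
  reachable (braid_closure R w) k (diagram (flipped (take k J) w) (fun _ : braid_component w => 0 : R)) /\
  lk_sum (diagram (flipped (take k J) w) (fun _ : braid_component w => 0 : R)) = lk_sum (braid_closure R w) - k%:Z.
Proof.
move=> wt uJ HJ; elim: k => [|k IHk] kJ.
  rewrite take0 flipped0 // diagram_closure subr0; split => //; apply: reachable_start.
  rewrite -diagram_closure -[X in diagram X](flipped0 wt).
  apply: (@reversed_link _ _ [::]); [exact: slots_flipped|exact: flipped_reversed].
have [re E] := IHk (ltnW kJ).
have [jw comp] := HJ _ (mem_nth 0%N kJ).
have jS : nth 0%N J k \notin take k J.
  by have := take_uniq k.+1 uJ; rewrite (take_nth 0%N kJ) rcons_uniq => /andP[].
have r2 := @flipped_reversed (take k.+1 J); rewrite {2}(take_nth 0%N kJ) in r2.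
have [re' E'] := reversed_reach (slots_flipped _ w) (slots_flipped _ w)
  (@flipped_reversed (take k J)) r2 jw jS comp re.
by split => //; rewrite E' E; lia.
Qed.

End TorusDiagrams.

(** * The splitting number of torus links *)

Section TorusLink.
Variable R : realType.
Variables p q l : nat.
Hypotheses (p0 : (0 < p)%N) (q0 : (0 < q)%N) (pq : coprime p q) (l0 : (0 < l)%N).
Local Notation n := (l * p)%N.-1.
Local Notation B := (l * q)%N.
Local Notation w := (torus_word (l * p) B).
Local Notation f := (braid_perm w).

Lemma torus_strands : n.+1 = (l * p)%N.
Proof. by rewrite prednK // muln_gt0 l0. Qed.

Lemma modn_strands x : (x %% n.+1 = x %% (l * p))%N.
Proof. by rewrite torus_strands. Qed.

Lemma strand_lt (s : 'I_n.+1) : (s < l * p)%N.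
Proof. exact: leq_trans (ltn_ord s) (eq_leq torus_strands). Qed.

Lemma torus_word_slots : slots w = torus_slots n B.
Proof.
rewrite /slots /torus_word /torus_slots map_flatten map_nseq -map_comp.
by rewrite (@eq_map _ _ _ (@nat_of_ord n)) // val_enum_ord.
Qed.

Lemma torus_word_positive : all snd w.
Proof.
by apply/allP => g /flattenP[s /nseqP[-> _] /mapP[i _ ->]].
Qed.

Lemma torus_perm (s : 'I_n.+1) : f s = ((s + n * B) %% n.+1)%N :> nat.
Proof.
rewrite braid_permE -size_slots torus_word_slots size_torus_slots torus_pos_end //.
by rewrite -ltnS.
Qed.

Lemma torus_perm_iter o (s : 'I_n.+1) : iter o f s = ((s + o * (n * B)) %% n.+1)%N :> nat.
Proof.
elim: o => [|o IHo] /=; first by rewrite addn0 modn_small.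
by rewrite torus_perm IHo modnDml; congr (_ %% _)%N; rewrite mulSn -addnA (addnC (n * B)%N).
Qed.

Lemma fconnect_residue (s s' : 'I_n.+1) : fconnect f s s' -> (s' %% l = s %% l)%N.
Proof.
move=> /iter_findex <-; rewrite torus_perm_iter modn_strands modn_dvdm ?dvdn_mulr //.
have -> : (s + findex f s s' * (n * B) = (findex f s s' * (n * q)) * l + s)%N by ring.
by rewrite modnMDl.
Qed.

(** The permutation shifts slots by -l q modulo l p.  Dividing by l, one has to
reach u' from u by steps of n q modulo p, which is possible since p is coprime to
q and to n = l p - 1. *)
Lemma residue_fconnect (s s' : 'I_n.+1) : (s %% l = s' %% l)%N -> fconnect f s s'.
Proof.
move=> e; set r := (s %% l)%N in e.
set u := (s %/ l)%N; set u' := (s' %/ l)%N.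
have sE : (s = u * l + r :> nat)%N by exact: divn_eq.
have s'E : (s' = u' * l + r :> nat)%N by rewrite e; exact: divn_eq.
have cop : coprime p (n * q).
  rewrite coprimeMr pq andbT coprime_sym.
  have : coprime n n.+1 by exact: coprimenS.
  by rewrite torus_strands coprimeMr => /andP[].
pose x := chinese p (n * q) (u' + u * p.-1) 0.
have xp : (x = u' + u * p.-1 %[mod p])%N by exact: chinese_modl.
have /dvdnP[k xk] : (n * q %| x)%N.
  by apply/eqP; rewrite (chinese_modr cop) mod0n.
have u'p : (u' < p)%N by rewrite ltn_divLR // (mulnC p); exact: strand_lt.
suff -> : s' = iter k f s by exact: fconnect_iter.
apply: val_inj; rewrite /= torus_perm_iter modn_strands.
have -> : (s + k * (n * B) = (u + x) * l + r)%N by rewrite {1}sE xk; ring.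
have ux : ((u + x) %% p = u')%N.
  rewrite -modnDmr xp modnDmr.
  have -> : (u + (u' + u * p.-1) = u * p + u')%N by rewrite -{2}(prednK p0); ring.
  by rewrite modnMDl modn_small.
have uxl : ((u + x) * l = u' * l %[mod l * p])%N.
  by rewrite (mulnC l) -muln_modl ux -muln_modl (modn_small u'p).
by rewrite -modnDml uxl modnDml -s'E modn_small //; exact: strand_lt.
Qed.

Definition residue (c : braid_component w) : nat := (val c %% l)%N.

Lemma residue_inj : injective residue.
Proof.
move=> c c' /residue_fconnect /(fingraph.rootP (fconnect_sym (@f_inj _ w))) e.
apply: val_inj; case: c e => [x /= /eqP xr]; case: c' => [y /= /eqP yr].
by rewrite xr yr.
Qed.

Lemma residue_strand s : residue (strand_component w s) = (s %% l)%N.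
Proof. by apply/esym/fconnect_residue; rewrite (fconnect_sym (@f_inj _ w)); exact: connect_root. Qed.

Lemma residue_left j : residue (strand_component w (left_strand n j)) = (j %/ n %% l)%N.
Proof.
rewrite residue_strand /left_strand inordK ?ltn_pmod // torus_strands.
by rewrite modn_dvdm ?dvdn_mulr.
Qed.

Lemma residue_right j :
  residue (strand_component w (right_strand n j)) = ((j %/ n + (j %% n).+1) %% l)%N.
Proof.
rewrite residue_strand /right_strand inordK ?ltn_pmod // torus_strands.
by rewrite modn_dvdm ?dvdn_mulr.
Qed.

(** The strand on top of a positive crossing has the larger residue. *)
Definition descent (j : nat) : bool :=
  (residue (strand_component w (right_strand n j)) < residue (strand_component w (left_strand n j)))%N.

Definition descents : seq nat := [seq j <- iota 0 (size w) | descent j].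

Lemma size_descents : size descents = ((l * (l - 1)) %/ 2 * (p * q))%N.
Proof.
rewrite -count_descents // size_filter -sum1_count big_mkcond /= (size_torus torus_word_slots).
rewrite -{1}[(B * n)%N]subn0 -/(index_iota 0 (B * n)) sum_blocks.
apply: eq_big_nat => k _; apply: eq_big_nat => i /andP[_ iN].
have n0 : (0 < n)%N by exact: leq_ltn_trans iN.
rewrite /descent residue_left residue_right divnMDl // (divn_small iN) addn0.
by rewrite modnMDl (modn_small iN); case: (_ < _)%N.
Qed.

Lemma descents_cross j : j \in descents ->
  (j < size w)%N /\ strand_component w (left_strand n j) != strand_component w (right_strand n j).
Proof.
rewrite mem_filter mem_iota => /andP[d /= jw]; split => //.
by apply: contraTneq d => e; rewrite /descent e ltnn.
Qed.

Local Notation E := `|xyz 0 0 1 : space R|.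

Definition reach_radius : R := \sum_(c : braid_component w) spread (braid_closure R w c).
(** At least 2, so that lifting outweighs the height of a crossing; and
large enough for balls of radius [reach_radius] to be disjoint. *)
Definition gap : R := 2 * reach_radius / E + 2.
Definition lowering (c : braid_component w) : R := - gap * (residue c)%:R.

Lemma spread_reach c : spread (braid_closure R w c) <= reach_radius.
Proof.
rewrite /reach_radius (bigD1 c) //= lerDl sumr_ge0 // => d _; exact/ltW/spread_gt0.
Qed.

Lemma gap_ge2 : 2 <= gap.
Proof.
rewrite /gap lerDr divr_ge0 ?normr_ge0 // mulr_ge0 // sumr_ge0 // => d _.
exact/ltW/spread_gt0.
Qed.

Lemma lowering_gap (c d : braid_component w) : (residue c < residue d)%N ->
  lowering d + gap <= lowering c.
Proof.
move=> cd; rewrite /lowering -lerBrDl !mulNr opprK addrC -mulrBr.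
rewrite -{1}[gap]mulr1 ler_wpM2l ?(le_trans _ gap_ge2) //.
by rewrite -natrB ?(ltnW cd) // ler1n subn_gt0.
Qed.

(** At a crossing of two components the one with the smaller residue is higher by
at least 2 - 1; within a component the crossing is positive, and not a descent. *)
Lemma lowered_reversed : reversed_at w lowering descents.
Proof.
move=> j jw; rewrite !(left_level torus_word_slots, right_level torus_word_slots) //.
rewrite (bits_all torus_word_positive jw) mem_filter mem_iota jw /= andbT.
rewrite /descent; have g2 := gap_ge2.
case: ltngtP => h.
- by have := lowering_gap h; lra.
- by have := lowering_gap h; lra.
by rewrite (residue_inj h) ltrD2r ltr01.
Qed.

Lemma lowered_split : split_union_of (torus_link R (l * p) B) (diagram w lowering).
Proof.
split; first by move=> c; exact: shift_knot_isotopic.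
exists (fun c => xyz 0 0 (lowering c)), (fun=> reach_radius); split.
  by move=> c; apply: carrier_shift_ball; exact: spread_reach.
have far c d : (residue c < residue d)%N ->
    2 * reach_radius <= `|lowering c - lowering d| * E.
  move=> cd; have h := lowering_gap cd; have g2 := gap_ge2.
  have E0 := vertical_norm_gt0 R.
  rewrite ger0_norm; last by lra.
  rewrite -ler_pdivrMr //; apply: (@le_trans _ _ gap); last by lra.
  by rewrite /gap lerDl.
move=> c d _ _ [x [xc xd]]; apply: residue_inj.
case: (ltngtP (residue c) (residue d)) => // cd.
  by case: (vertical_balls_disjoint (far _ _ cd) xc xd).
by case: (vertical_balls_disjoint (far _ _ cd) xd xc).
Qed.

(** All descents but the last are reversed within the closed braids of words.
The last reversal leads directly to the lowered diagram, whose crossings are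
then the required ones.  If there is no descent, there is only one component and
nothing is lowered. *)
Lemma lowered_reachable :
  reachable (torus_link R (l * p) B) (size descents) (diagram w lowering) /\
  lk_sum (diagram w lowering) = lk_sum (torus_link R (l * p) B) - (size descents)%:Z.
Proof.
have uJ : uniq descents by rewrite filter_uniq // iota_uniq.
have wt := torus_word_positive.
have [N0|N0] := posnP (size descents).
  have l1 : l = 1%N.
    move: N0; rewrite size_descents => /eqP; rewrite !muln_eq0 (gtn_eqF p0) (gtn_eqF q0) !orbF.
    case: (l) l0 => [|[|m]] // _; rewrite eqn0Ngt divn_gt0 // subn1 /=.
    by rewrite (leq_mul (isT : (2 <= m.+2)%N) (isT : (1 <= m.+1)%N)).
  have -> : lowering = fun=> 0.
    apply/funext => c; have -> : lowering c = - gap * (residue c)%:R by [].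
    have : (residue c < l)%N by rewrite ltn_pmod.
    by rewrite [X in (_ < X)%N]l1 ltnS leqn0 => /eqP ->; rewrite mulr0.
  have [re e] := @reversed_chain R _ _ w torus_word_slots descents 0 wt uJ descents_cross (leq0n _).
  by move: re e; rewrite take0 flipped0 // N0.
have kJ : ((size descents).-1 < size descents)%N by rewrite prednK.
have [re e] := @reversed_chain R _ _ w torus_word_slots descents _ wt uJ descents_cross (ltnW kJ).
have [jw comp] := descents_cross (mem_nth 0%N kJ).
have dE : descents = rcons (take (size descents).-1 descents) (nth 0%N descents (size descents).-1).
  by rewrite -take_nth // prednK // take_size.
have jS : nth 0%N descents (size descents).-1 \notin take (size descents).-1 descents.
  by move: uJ; rewrite {1}dE rcons_uniq => /andP[].
have r2 := lowered_reversed; rewrite dE in r2.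
have [re' e'] := reversed_reach torus_word_slots (slots_flipped _ w) erefl
  (@flipped_reversed R _ _ w torus_word_slots (take (size descents).-1 descents)) r2 jw jS comp re.
rewrite prednK // in re'; split => //.
by rewrite e' e -[in RHS](prednK N0) /torus_link; lia.
Qed.

End TorusLink.

Theorem corollary3 (R : realType) (p q l : nat)
    (p_gt0 : (0 < p)%N) (q_gt0 : (0 < q)%N) (coprime_pq : coprime p q)
    (l_gt0 : (0 < l)%N) :
  is_splitting_number (torus_link R (l * p)%N (l * q)%N)
    ((l * (l - 1)) %/ 2 * (p * q))%N.
Proof.
have [re e] := lowered_reachable R p_gt0 q_gt0 coprime_pq l_gt0.
have sp := lowered_split R p_gt0 coprime_pq l_gt0.
rewrite (size_descents q p_gt0 l_gt0) in re e.
split; first by eexists; split; [exact: re | exact: sp].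
move=> m /splits_lower_bound; move: e.
rewrite (split_lk_sum (reachable_link re) sp) => /eqP; rewrite eq_sym subr_eq0 => /eqP ->.
by rewrite ger0_norm.
Qed.
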